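(* Assume that $\rho$ and $\log M$ are bounded, i.e. there are constants $\rho_{\max}\ge0$ and $L_{\max}<\infty$ with $\rho(x,y)\le\rho_{\max}$ and $|\log M(y)|\le L_{\max}$ for all $x\in A$, $y\in\hat A$, and that $\mathbb P$ is stationary and ergodic. Then for any $D>D_{\min}$ and any $\epsilon>0$ there is a sequence of finite sets $C_n\subset\hat A^n$ such that (i) $\frac1n\log M^n(C_n)\leq R(D)+\epsilon$ for all $n\ge1$; and (ii) $P_n([C_n]_D)\to1$ as $n\to\infty$. If moreover $\mathbb P$ is ergodic in blocks, there are sets $C_n$ satisfying (i) and (iii) $\mathbb P$-almost surely, $\rho_n(X_1^n,C_n)\leq D$ for all sufficiently large $n$.
   Context: General setting: $A$ and $\hat A$ are Polish spaces with Borel $\sigma$-algebras; $\mathbb P$ is a probability measure on $A^{\mathbb N}$, $\{X_n\}$ a process with law $\mathbb P$, $P_n$ the law of $X_1^n$. $\mathbb P$ is stationary if $X_1^n$ and $X_{1+k}^{n+k}$ have the same law for all $n,k$. For $k\ge1$, $\mathbb P$ is ergodic in $k$-blocks if the process $\{X_{nk+1}^{(n+1)k}:n\ge0\}$ is ergodic, and ergodic in blocks if it is ergodic in $k$-blocks for every $k\ge1$. $\rho:A\times\hat A\to[0,\infty)$ is measurable, $\rho_n(x_1^n,y_1^n)=\frac1n\sum_{i=1}^n\rho(x_i,y_i)$, $\rho_n(x_1^n,C)=\min_{y_1^n\in C}\rho_n(x_1^n,y_1^n)$, and $[C]_D=\{x_1^n\in A^n:\rho_n(x_1^n,y_1^n)\le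 D\text{ for some }y_1^n\in C\}$. $M:\hat A\to(0,\infty)$ is measurable, $M^n(C)=\sum_{y_1^n\in C}\prod_iM(y_i)$. Relative entropy $H(\mu\|\nu)=\int\log\frac{d\mu}{d\nu}d\mu$ if $\mu\ll\nu$, else $+\infty$. ${\cal M}_n(P_n,Q_n,D)$ is the set of probability measures $W_n$ on $A^n\times\hat A^n$ with marginals $P_n$ and $Q_n$ and $\int\rho_n\,dW_n\le D$; $I_n(P_n,Q_n,D)=\inf_{W_n\in{\cal M}_n(P_n,Q_n,D)}H(W_n\|P_n\times Q_n)$ ($+\infty$ if empty); $R_n(D)=\inf_{Q_n}\{I_n(P_n,Q_n,D)+E_{Q_n}[\log M^n(Y_1^n)]\}$; $R(D)=\lim_n\frac1nR_n(D)$ (which exists for stationary $\mathbb P$); $D_{\min}=\inf\{D\ge0:R(D)<+\infty\}$. Logarithms are natural. *)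

(* Defs.v *)
From HB Require Import structures.
From mathcomp Require Import all_boot all_order all_algebra.
From mathcomp Require Import all_classical all_reals all_analysis.
Set Implicit Arguments.
Unset Strict Implicit.
Unset Printing Implicit Defensive.
Import Order.TTheory GRing.Theory Num.Theory.
Local Open Scope classical_set_scope.
Local Open Scope ring_scope.

Definition separable_space (T : topologicalType) :=
  exists S : set T, countable S /\ closure S = setT.

(* a complete (pseudo)metric space which is Hausdorff (hence metric) and
   separable, i.e. a Polish space with a fixed compatible complete metric *)
Definition polish (R : realType) (T : completePseudoMetricType R) :=
  hausdorff_space T /\ separable_space T.

Definition borel (T : ptopologicalType) := g_sigma_algebraType (@open T).

Definition cylinders d (T : measurableType d) : set (set (nat -> T)) :=
  [set C | exists (i : nat) (S : set T), measurable S /\ C = (fun x => x i) @^-1` S].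

Arguments cylinders {d} T.

Definition seqspace d (T : measurableType d) := g_sigma_algebraType (cylinders T).

Definition shift d (T : measurableType d) (x : seqspace T) : seqspace T :=
  fun m => x m.+1.

(* X_{k+1}^{k+n}  (0-indexed: x k, ..., x (k+n-1)) *)
Definition window d (T : measurableType d) (k n : nat) (x : seqspace T) : n.-tuple T :=
  [tuple x (k + i)%N | i < n].

Definition blocks d (T : measurableType d) (k : nat) (x : seqspace T)
  : seqspace (k.-tuple T) := fun m => window (m * k) k x.

Arguments shift {d T}.
Arguments window {d T}.
Arguments blocks {d T}.

Section process.
Context (R : realType) d (T : measurableType d).
Variable P : probability (seqspace T) R.

Definition Pn (n : nat) : set (n.-tuple T) -> \bar R := pushforward P (window 0 n).

Definition stationary :=
  forall (n k : nat) (S : set (n.-tuple T)), measurable S ->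
    P (window 0 n @^-1` S) = P (window k n @^-1` S).

Definition ergodic :=
  forall B : set (seqspace T), measurable B -> shift @^-1` B = B ->
    P B = 0%E \/ P B = 1%E.

(* the k-block process has law  P o (blocks k)^-1  on (T^k)^N *)
Definition ergodic_in_k_blocks (k : nat) :=
  forall B : set (seqspace (k.-tuple T)), measurable B -> shift @^-1` B = B ->
    P (blocks k @^-1` B) = 0%E \/ P (blocks k @^-1` B) = 1%E.

Definition ergodic_in_blocks := forall k : nat, (0 < k)%N -> ergodic_in_k_blocks k.
End process.
Arguments Pn {R d T} P n _.

Definition elog (R : realType) (x : R) : \bar R :=
  if x <= 0 then -oo%E else (ln x)%:E.

(* relative entropy H(mu || nu) = \int log (dmu/dnu) dmu if mu << nu, +oo otherwise;
   dmu/dnu ranges over the (nu-a.e. unique) densities of mu w.r.t. nu;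
   if there is none (mu not << nu) the infimum over the empty set is +oo *)
Definition density (R : realType) d (X : measurableType d)
    (mu nu : set X -> \bar R) (f : X -> R) :=
  measurable_fun setT f /\ (forall x, 0 <= f x) /\
  forall S, measurable S -> mu S = (\int[nu]_(x in S) (f x)%:E)%E.

Definition relent (R : realType) d (X : measurableType d) (mu nu : set X -> \bar R)
  : \bar R :=
  ereal_inf [set (\int[mu]_x elog (f x))%E | f in density mu nu].

Section rate_distortion.
Context (R : realType) dA dB (A : measurableType dA) (B : measurableType dB).
Variables (rho : A * B -> R) (M : B -> R).

Definition rhon (n : nat) (x : n.-tuple A) (y : n.-tuple B) : R :=
  n%:R^-1 * \sum_(i < n) rho (tnth x i, tnth y i).

(* rho_n(x, C) = min_{y in C} rho_n(x,y)  (+oo if C is empty) *)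
Definition rhon_set (n : nat) (x : n.-tuple A) (C : set (n.-tuple B)) : \bar R :=
  ereal_inf [set (rhon x y)%:E | y in C].

Definition blowup (n : nat) (C : set (n.-tuple B)) (D : R) : set (n.-tuple A) :=
  [set x | exists2 y, C y & rhon x y <= D].

Definition Mn (n : nat) (C : set (n.-tuple B)) : R :=
  \sum_(y \in C) \prod_(i < n) M (tnth y i).

Definition couplings (n : nat) (Pn : set (n.-tuple A) -> \bar R)
    (Qn : set (n.-tuple B) -> \bar R) (D : R)
  : set (probability (n.-tuple A * n.-tuple B)%type R) :=
  [set W | (forall S, measurable S -> W (S `*` setT) = Pn S) /\
           (forall S, measurable S -> W (setT `*` S) = Qn S) /\
           (\int[W]_w (rhon w.1 w.2)%:E <= D%:E)%E].

Definition In (n : nat) (Pn : set (n.-tuple A) -> \bar R)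
    (Qn : probability (n.-tuple B) R) (D : R) : \bar R :=
  ereal_inf [set relent W (Pn \x Qn)%E | W in couplings Pn Qn D].

Definition Rn (n : nat) (Pn : set (n.-tuple A) -> \bar R) (D : R) : \bar R :=
  ereal_inf [set e | exists Qn : probability (n.-tuple B) R,
     e = (In Pn Qn D + \int[Qn]_y (\sum_(i < n) ln (M (tnth y i)))%:E)%E].
End rate_distortion.

Section rate_distortion_function.
Context (R : realType) dA dB (A : measurableType dA) (B : measurableType dB).
Variables (rho : A * B -> R) (M : B -> R) (P : probability (seqspace A) R).

Definition RD (D : R) : \bar R :=
  limn (fun n : nat => ((n%:R^-1)%:E * Rn rho M (Pn P n) D)%E).

Definition Dmin : \bar R :=
  ereal_inf [set D%:E | D in [set D : R | 0 <= D /\ (RD D < +oo)%E]].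
End rate_distortion_function.

(* Main.v *)
(* The source is coded by concatenating blocks of a fixed length [k].  The [k * m]
   blocks come in [k] runs of [m], and one letter is skipped between two runs, so that
   run [t] is aligned at [t] modulo [k].  By Birkhoff's theorem for the [k]-th power
   of the shift, the average of a block functional over run [t] tends to a
   [shift^k]-invariant function evaluated at [shift^t x]; averaging over the [k] runs
   gives a shift-invariant function, hence the mean.  Plain ergodicity therefore
   suffices, with almost sure convergence, and (ii) follows from (iii).

   A block channel whose density [f] with respect to [P_k x Q] is bounded away from
   [0] and infinity gives a code: for a typical source word, Chernoff bounds under the
   product of the conditional laws show that the product law [Q^J] charges the set of
   good codewords with at least [exp (- J * (I + 2 * del)) / 2], and codewords are
   picked greedily, each covering the average share of what is still uncovered.

   A test channel of finite rate is approximated by such bounded channels by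
   truncating its density, at an arbitrarily small cost in distortion.  That cost is
   absorbed by interspersing blocks of a channel of distortion [D0 < D], which exists
   because [Dmin < D]; concatenating channels also gives Fekete's argument for the
   convergence of [R_n / n]. *)

Require Import Defs.
From HB Require Import structures.
From mathcomp Require Import all_boot all_order all_algebra.
From mathcomp Require Import all_classical all_reals all_analysis.
From mathcomp Require Import measurable_realfun.
From mathcomp Require Import ring lra zify.
Set Implicit Arguments.
Unset Strict Implicit.
Unset Printing Implicit Defensive.
Import Order.TTheory GRing.Theory Num.Theory.
Import numFieldNormedType.Exports.
Local Open Scope classical_set_scope.
Local Open Scope ring_scope.

(** Three budgets fix the constants. Distortion: the channel keeps [3 * del] per letter in reserve,
    one [del] for the deviation of the source from its mean, one for the deviation of the codeword
    from its conditional mean, one for the letters outside all blocks; this is why a channel of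
    distortion strictly below [D] is sought. Rate: the same deviations, for the information and for
    the mass [M], cost [4 * del], the letters outside the blocks another, and the last of the
    [6 * del] pays for a codebook larger by a factor [exp (del * n)] than covering requires.
    Probability: that factor makes the uncovered set exponentially small, so Borel-Cantelli applies.
    The density is bounded away from [0] as well as from infinity because Chernoff bounds are
    applied to its logarithm too. Unbounded densities are confined to the truncation step; elsewhere
    all expectations are of bounded functions and real-valued. [RD] is a [limn], informative only
    once the sequence is known to converge. Convergence is proved above [Dmin], where some block
    length has finite rate at a smaller distortion. *)

Local Notation Ex P f := (Rintegral P setT f).

(** * Expectations of bounded measurable functions *)

(** This class is stable under sums, products, [expR], [ln] away from [0], and partial expectations.
    Every integrability side condition under a probability reduces to membership in it. *)
Definition bmf (R : realType) d (T : measurableType d) (f : T -> R) :=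
  measurable_fun setT f /\ exists K, forall x, `|f x| <= K.

Section bounded_measurable.
Context (R : realType) d (T : measurableType d).
Implicit Types f g : T -> R.

Lemma bmf_measurable f : bmf f -> measurable_fun setT f.
Proof. by case. Qed.

Lemma bmf_bound f : bmf f -> exists2 K, 0 < K & forall x, `|f x| <= K.
Proof.
move=> [_ [K Kf]]; exists (`|K| + 1); first by rewrite ltr_wpDl.
by move=> x; rewrite (le_trans (Kf x))// (le_trans (ler_norm K))// lerDl.
Qed.

Lemma bmf_itv f a b : measurable_fun setT f -> (forall x, a <= f x <= b) ->
  bmf f.
Proof.
move=> mf ab; split => //; exists (`|a| + `|b|) => x.
have /andP[ax xb] := ab x.
have ? := ler_norm b; have := ler_norm (- a); rewrite normrN => ?.
have ? := normr_ge0 a; have ? := normr_ge0 b.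
by rewrite ler_norml; apply/andP; split; lra.
Qed.

Lemma measurable_ltset f g : measurable_fun setT f -> measurable_fun setT g ->
  measurable [set x | f x < g x].
Proof.
move=> mf mg; rewrite -[X in measurable X]setTI.
by rewrite -preimage_true; exact: measurable_fun_ltr.
Qed.

Lemma measurable_leset f g : measurable_fun setT f -> measurable_fun setT g ->
  measurable [set x | f x <= g x].
Proof.
move=> mf mg; rewrite -[X in measurable X]setTI.
by rewrite -preimage_true; exact: measurable_fun_ler.
Qed.

Lemma bmf_cst (c : R) : bmf (fun _ : T => c).
Proof. by split; [exact: measurable_cst|exists `|c|]. Qed.

Lemma bmfD f g : bmf f -> bmf g -> bmf (fun x => f x + g x).
Proof.
move=> [mf [K Kf]] [mg [L Lg]]; split; first exact: measurable_funD.
by exists (K + L) => x; rewrite (le_trans (ler_normD _ _))// lerD.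
Qed.

Lemma bmfM f g : bmf f -> bmf g -> bmf (fun x => f x * g x).
Proof.
move=> [mf [K Kf]] [mg [L Lg]]; split; first exact: measurable_funM.
by exists (K * L) => x; rewrite normrM ler_pM.
Qed.

Lemma bmfN f : bmf f -> bmf (fun x => - f x).
Proof.
move=> [mf [K Kf]]; split; first exact: measurableT_comp.
by exists K => x; rewrite normrN.
Qed.

Lemma bmfB f g : bmf f -> bmf g -> bmf (fun x => f x - g x).
Proof. by move=> bf bg; apply: bmfD => //; exact: bmfN. Qed.

Lemma bmfZ c f : bmf f -> bmf (fun x => c * f x).
Proof. by apply: bmfM; exact: bmf_cst. Qed.

Lemma bmf_sum I (s : seq I) (Q : pred I) (F : I -> T -> R) :
  (forall i, bmf (F i)) -> bmf (fun x => \sum_(i <- s | Q i) F i x).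
Proof.
move=> bF; elim: s => [|i s IH].
  by under eq_fun do rewrite big_nil; exact: bmf_cst.
under eq_fun do rewrite big_cons.
by case: (Q i) => //; exact: bmfD.
Qed.

Lemma bmf_prod I (s : seq I) (Q : pred I) (F : I -> T -> R) :
  (forall i, bmf (F i)) -> bmf (fun x => \prod_(i <- s | Q i) F i x).
Proof.
move=> bF; elim: s => [|i s IH].
  by under eq_fun do rewrite big_nil; exact: bmf_cst.
under eq_fun do rewrite big_cons.
by case: (Q i) => //; exact: bmfM.
Qed.

Lemma bmf_ln f a b : bmf f -> 0 < a -> (forall x, a <= f x <= b) ->
  bmf (fun x => ln (f x)).
Proof.
move=> [mf _] a0 ab; apply: (@bmf_itv _ (ln a) (ln b)).
  by apply: measurableT_comp => //; exact: measurable_ln.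
move=> x; have /andP[ax xb] := ab x.
by rewrite !ler_ln ?posrE ?ax//; lra.
Qed.

Lemma bmf_expR f : bmf f -> bmf (fun x => expR (f x)).
Proof.
move=> [mf [K Kf]]; apply: (@bmf_itv _ 0 (expR K)).
  by apply: measurableT_comp => //; exact: measurable_expR.
by move=> x; rewrite expR_ge0 ler_expR (le_trans (ler_norm _)).
Qed.

Lemma bmf_indic (S : set T) : measurable S -> bmf (\1_S : T -> R).
Proof.
move=> mS; apply: (@bmf_itv _ 0 1); first exact: measurable_indic.
by move=> x; rewrite indicE; case: (x \in S) => /=; rewrite lexx ler01.
Qed.

Lemma bmf_comp d2 (T2 : measurableType d2) (g : T -> T2) (h : T2 -> R) :
  bmf h -> measurable_fun setT g -> bmf (fun x => h (g x)).
Proof.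
move=> [mh [K Kh]] mg; split; first exact: measurableT_comp.
by exists K => x.
Qed.

End bounded_measurable.

#[local] Hint Resolve bmf_cst : core.

Section expectation.
Context (R : realType) d (T : measurableType d) (P : probability T R).
Implicit Types f g : T -> R.

Lemma bmf_integrable f : bmf f -> P.-integrable setT (EFin \o f).
Proof.
move=> [mf [K Kf]]; apply: measurable_bounded_integrable => //.
  by rewrite -ge0_fin_numE// fin_num_measure.
exists K; split; first exact: num_real.
by move=> M KM x _ /=; rewrite (le_trans (Kf x))// ltW.
Qed.

Lemma EFin_Ex f : bmf f -> (\int[P]_x (f x)%:E = (Ex P f)%:E)%E.
Proof.
move=> bf; rewrite /Rintegral fineK//; apply: integrable_fin_num => //.
exact: bmf_integrable.
Qed.

Lemma ExD f g : bmf f -> bmf g -> Ex P (fun x => f x + g x) = Ex P f + Ex P g.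
Proof. by move=> bf bg; rewrite RintegralD//; exact: bmf_integrable. Qed.

Lemma ExB f g : bmf f -> bmf g -> Ex P (fun x => f x - g x) = Ex P f - Ex P g.
Proof. by move=> bf bg; rewrite RintegralB//; exact: bmf_integrable. Qed.

Lemma ExZ c f : bmf f -> Ex P (fun x => c * f x) = c * Ex P f.
Proof. by move=> bf; rewrite RintegralZl//; exact: bmf_integrable. Qed.

Lemma ExZr c f : bmf f -> Ex P (fun x => f x * c) = Ex P f * c.
Proof. by move=> bf; rewrite RintegralZr//; exact: bmf_integrable. Qed.

Lemma Ex_cst (c : R) : Ex P (fun _ => c) = c.
Proof. by rewrite Rintegral_cst//= probability_setT/= mulr1. Qed.

Lemma le_Ex f g : bmf f -> bmf g -> (forall x, f x <= g x) -> Ex P f <= Ex P g.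
Proof. by move=> bf bg fg; apply: le_Rintegral => //; exact: bmf_integrable. Qed.

Lemma Ex_ge0 f : (forall x, 0 <= f x) -> 0 <= Ex P f.
Proof. by move=> f0; exact: Rintegral_ge0. Qed.

Lemma Ex_ge_cst c f : bmf f -> (forall x, c <= f x) -> c <= Ex P f.
Proof. by move=> bf cf; rewrite -[leLHS]Ex_cst; exact: le_Ex. Qed.

Lemma Ex_le_cst c f : bmf f -> (forall x, f x <= c) -> Ex P f <= c.
Proof. by move=> bf cf; rewrite -[leRHS]Ex_cst; exact: le_Ex. Qed.

Lemma Ex_sum I (s : seq I) (Q : pred I) (F : I -> T -> R) :
  (forall i, bmf (F i)) ->
  Ex P (fun x => \sum_(i <- s | Q i) F i x) = \sum_(i <- s | Q i) Ex P (F i).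
Proof.
move=> bF; elim: s => [|i s IH].
  by under eq_Rintegral do rewrite big_nil; rewrite Ex_cst big_nil.
under eq_Rintegral do rewrite big_cons.
rewrite big_cons; case: (Q i) => //.
by rewrite ExD ?IH//; exact: bmf_sum.
Qed.

Lemma Ex_indic (S : set T) : measurable S -> (Ex P \1_S)%:E = P S.
Proof.
by move=> mS; rewrite -EFin_Ex; [rewrite integral_indic// setIT|exact: bmf_indic].
Qed.

Lemma Ex_exists_gt c f : bmf f -> c < Ex P f -> exists x, c < f x.
Proof.
move=> bf cE; apply: contrapT => /forallNP nc.
have : Ex P f <= c by apply: Ex_le_cst => // x; rewrite leNgt; apply/negP.
by rewrite leNgt cE.
Qed.

End expectation.

(** * Fubini's theorem and image laws for bounded functions *)

Section fubini.
Context (R : realType) d1 d2 (T1 : measurableType d1) (T2 : measurableType d2).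
Variables (P1 : probability T1 R) (P2 : probability T2 R).
Variable f : T1 * T2 -> R.
Hypothesis bf : bmf f.

Lemma bmf_curry x : bmf (fun y => f (x, y)).
Proof. by apply: bmf_comp => //; exact: measurable_pair1. Qed.

Lemma bmf_flip y : bmf (fun x => f (x, y)).
Proof. by apply: bmf_comp => //; exact: measurable_pair2. Qed.

Let intf : (P1 \x P2)%E.-integrable setT (EFin \o f).
Proof. exact: bmf_integrable. Qed.

(** [measurable_fubini_F] takes integrability for a product measure. A Dirac mass stands in for the
    first factor, so that [bmf_Ex_snd] depends on [P2] alone. *)
Let intf_snd : (\d_(point : T1) \x P2)%E.-integrable setT (EFin \o f).
Proof. exact: bmf_integrable. Qed.

Let intf_fst : (P1 \x \d_(point : T2))%E.-integrable setT (EFin \o f).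
Proof. exact: bmf_integrable. Qed.

Lemma bmf_Ex_snd : bmf (fun x => Ex P2 (fun y => f (x, y))).
Proof.
have [K K0 Kf] := bmf_bound bf.
apply: (@bmf_itv _ _ _ _ (- K) K).
  apply/measurable_EFinP; have := measurable_fubini_F intf_snd.
  congr (measurable_fun _ _); apply/funext => x.
  by rewrite /fubini_F /= EFin_Ex//; exact: bmf_curry.
move=> x; apply/andP; split.
  by apply: Ex_ge_cst => [|y]; [exact: bmf_curry|have := Kf (x, y); rewrite ler_norml => /andP[]].
by apply: Ex_le_cst => [|y]; [exact: bmf_curry|have := Kf (x, y); rewrite ler_norml => /andP[]].
Qed.

Lemma bmf_Ex_fst : bmf (fun y => Ex P1 (fun x => f (x, y))).
Proof.
have [K K0 Kf] := bmf_bound bf.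
apply: (@bmf_itv _ _ _ _ (- K) K).
  apply/measurable_EFinP; have := measurable_fubini_G intf_fst.
  congr (measurable_fun _ _); apply/funext => y.
  by rewrite /fubini_G /= EFin_Ex//; exact: bmf_flip.
move=> y; apply/andP; split.
  by apply: Ex_ge_cst => [|x]; [exact: bmf_flip|have := Kf (x, y); rewrite ler_norml => /andP[]].
by apply: Ex_le_cst => [|x]; [exact: bmf_flip|have := Kf (x, y); rewrite ler_norml => /andP[]].
Qed.

Lemma Ex_prod1 : Ex (P1 \x P2)%E f = Ex P1 (fun x => Ex P2 (fun y => f (x, y))).
Proof.
rewrite {1 2}/Rintegral -(integral12_prod_meas1 intf); congr fine.
by apply: eq_integral => x _; rewrite /fubini_F /= EFin_Ex//; exact: bmf_curry.
Qed.

Lemma Ex_prod2 : Ex (P1 \x P2)%E f = Ex P2 (fun y => Ex P1 (fun x => f (x, y))).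
Proof.
rewrite {1 2}/Rintegral -(integral21_prod_meas1 intf); congr fine.
by apply: eq_integral => y _; rewrite /fubini_G /= EFin_Ex//; exact: bmf_flip.
Qed.

End fubini.

Section pushforward.
Context (R : realType) d1 d2 (T1 : measurableType d1) (T2 : measurableType d2).

Definition law (P : probability T1 R) (phi : T1 -> T2)
    (mphi : measurable_fun setT phi) : probability T2 R :=
  distribution P (HB.pack phi (isMeasurableFun.Build _ _ _ _ phi mphi)
                    : {mfun T1 >-> T2}).

Variables (P : probability T1 R) (phi : T1 -> T2).
Hypothesis mphi : measurable_fun setT phi.

Lemma lawE S : law P mphi S = P (phi @^-1` S).
Proof. by []. Qed.

Lemma Ex_law (f : T2 -> R) :
  bmf f -> Ex (law P mphi) f = Ex P (fun x => f (phi x)).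
Proof.
move=> bf; rewrite /Rintegral [in LHS]integral_pushforward//.
- by have [mf _] := bf; exact/measurable_EFinP.
- by apply: bmf_integrable; exact: bmf_comp.
Qed.

End pushforward.

(** * Upper limits of sequences in a fixed interval *)

Section limn_sup_bounded.
Context (R : realType) (u : nat -> R) (a b : R).
Hypothesis ub : forall n, a <= u n <= b.

Lemma itv_has_ubound (A : set R) : A `<=` range u -> has_ubound A.
Proof. by move=> Au; exists b => _ /Au[n _ <-]; have /andP[] := ub n. Qed.

Lemma itv_has_lbound (A : set R) : A `<=` range u -> has_lbound A.
Proof. by move=> Au; exists a => _ /Au[n _ <-]; have /andP[] := ub n. Qed.

Lemma limn_sup_itvE : limn_sup u = inf (range (sups u)).
Proof.
by apply/cvg_lim => //; apply: cvg_sups_inf;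
  [exact: itv_has_ubound|exact: itv_has_lbound].
Qed.

Lemma sups_itv n : a <= sups u n <= b.
Proof.
have un : sdrop u n (u n) by exists n => //=.
have sub : sdrop u n `<=` range u by move=> _ [k _ <-]; exists k.
have /andP[au _] := ub n; apply/andP; split.
  by rewrite (le_trans au)//; apply: ub_le_sup => //; exact: itv_has_ubound.
by apply: ge_sup; [exists (u n)|move=> _ [k _ <-]; have /andP[] := ub k].
Qed.

Lemma limn_sup_itv : a <= limn_sup u <= b.
Proof.
rewrite limn_sup_itvE; apply/andP; split.
  by apply: lb_le_inf; [exists (sups u 0), 0%N|move=> _ [n _ <-]; have /andP[] := sups_itv n].
have /andP[_] := sups_itv 0; apply: le_trans.
by apply: ge_inf; [exists a => _ [n _ <-]; have /andP[] := sups_itv n|exists 0%N].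
Qed.

Lemma lt_limn_sup c N : c < limn_sup u -> exists n, (N <= n)%N /\ c < u n.
Proof.
rewrite limn_sup_itvE => cu.
have : c < sups u N.
  apply: (lt_le_trans cu); apply: ge_inf; last by exists N.
  by exists a => _ [n _ <-]; have /andP[] := sups_itv n.
move=> /sup_gt-[]; first by exists (u N), N => //=.
by move=> _ [n /= Nn <-] cn; exists n.
Qed.

Lemma gt_limn_sup c :
  limn_sup u < c -> exists N, forall n, (N <= n)%N -> u n < c.
Proof.
rewrite limn_sup_itvE => /inf_lt-[]; first by exists (sups u 0), 0%N.
move=> _ [N _ <-] sc; exists N => n Nn; apply: le_lt_trans sc.
apply: ub_le_sup; last by exists n.
by apply: itv_has_ubound => _ [k _ <-]; exists k.
Qed.

End limn_sup_bounded.

(** * Measure-preserving and ergodic maps *)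

Section invariant_measure.
Context (R : realType) d (T : measurableType d) (P : probability T R).

Definition measure_preserving (S : T -> T) :=
  measurable_fun setT S /\ forall B, measurable B -> P (S @^-1` B) = P B.

Lemma Ex_preserving (S : T -> T) (f : T -> R) : measure_preserving S -> bmf f ->
  Ex P (fun x => f (S x)) = Ex P f.
Proof.
move=> [mS PS] bf; rewrite -(Ex_law P mS bf) /Rintegral; congr fine.
by apply: eq_measure_integral => B mB _; exact: PS.
Qed.

Lemma measure_preserving_iter (S : T -> T) n :
  measure_preserving S -> measure_preserving (iter n S).
Proof.
move=> [mS PS]; elim: n => [|n [mSn PSn]]; first by split => //; exact: measurable_id.
split; first exact: (measurableT_comp mS mSn).
move=> B mB; have mSB : measurable (S @^-1` B).
  by rewrite -[X in measurable X]setTI; exact: mS.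
by rewrite -(PS B mB) -(PSn _ mSB).
Qed.

Lemma ae_preserving (S : T -> T) (Q : T -> Prop) : measure_preserving S ->
  {ae P, forall x, Q x} -> {ae P, forall x, Q (S x)}.
Proof.
move=> [mS PS] [N [mN PN QN]]; exists (S @^-1` N); split.
- by rewrite -[X in measurable X]setTI; exact: mS.
- by rewrite PS.
- by move=> x /= nQ; exact: (QN (S x)).
Qed.

Lemma Ex_eq0_ae (g : T -> R) : bmf g -> (forall x, 0 <= g x) -> Ex P g <= 0 ->
  {ae P, forall x, g x = 0}.
Proof.
move=> bg g0 Eg; have mg : measurable_fun setT (EFin \o g).
  by have [? _] := bg; exact/measurable_EFinP.
have : (\int[P]_x `|(EFin \o g) x| = 0)%E.
  under eq_integral do rewrite gee0_abs ?lee_fin//=.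
  by rewrite EFin_Ex//; congr EFin; apply/eqP; rewrite eq_le Eg Ex_ge0.
move=> /(ae_eq_integral_abs P measurableT mg).
by apply: filterS => x /(_ I) [].
Qed.

Lemma ExM_indic_null (g : T -> R) (B : set T) : bmf g -> measurable B ->
  P B = 0%E -> Ex P (fun x => g x * \1_B x) = 0.
Proof.
move=> bg mB PB; have [K K0 Kg] := bmf_bound bg.
have bB := bmf_indic R mB; have bgB := bmfM bg bB.
have E1 : Ex P \1_B = 0 by apply/EFin_inj; rewrite Ex_indic.
have KB x : `|g x * \1_B x| <= K * \1_B x.
  by rewrite normrM [X in _ * X]ger0_norm ?indicE// ler_wpM2r.
apply/eqP; rewrite eq_le; apply/andP; split.
  have <- : Ex P (fun x => K * \1_B x) = 0 by rewrite ExZ// E1 mulr0.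
  by apply: le_Ex => // [|x]; [exact: bmfZ|exact: le_trans (ler_norm _) (KB x)].
have <- : Ex P (fun x => - K * \1_B x) = 0 by rewrite ExZ// E1 mulr0.
apply: le_Ex => // [|x]; first exact: bmfZ.
by have := KB x; rewrite ler_norml mulNr => /andP[].
Qed.

Definition ergodic_map (S : T -> T) :=
  forall B, measurable B -> S @^-1` B = B -> P B = 0%E \/ P B = 1%E.

(** With [g = h - Ex P h], the set [B] where [g > 0] is invariant, hence null or of full measure. In
    both cases [g * \1_B] has mean [0], because [g] itself does. So the nonnegative function
    [2 * (g * \1_B) - g], which is the absolute value of [g], has mean [0] and vanishes almost
    everywhere. *)
Lemma ergodic_invariant_cst (S : T -> T) (h : T -> R) : ergodic_map S ->
  bmf h -> (forall x, h (S x) = h x) -> {ae P, forall x, h x = Ex P h}.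
Proof.
move=> erg bh hS; set c := Ex P h; set g := fun x => h x - c.
have bg : bmf g by exact: bmfB.
have Eg : Ex P g = 0 by rewrite ExB// Ex_cst subrr.
set B := [set x | 0 < g x].
have mB : measurable B.
  by apply: measurable_ltset => //; exact: bmf_measurable bg.
have bB := bmf_indic R mB.
have gB : Ex P (fun x => g x * \1_B x) = 0.
  have [|PB|PB] := erg _ mB.
  - by rewrite /B /g; apply/seteqP; split => x; rewrite /= hS.
  - exact: ExM_indic_null.
  - have bC : bmf (\1_(~` B) : T -> R) by apply: bmf_indic; exact: measurableC.
    have PC : P (~` B) = 0%E by rewrite probability_setC// PB subee.
    have := ExM_indic_null bg (measurableC mB) PC.
    have -> : (fun x => g x * \1_(~` B) x) = (fun x => g x - g x * \1_B x).
      by apply/funext => x; rewrite !indicE in_setC; case: (x \in B) => /=; lra.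
    by rewrite ExB ?Eg//; [lra|exact: bmfM].
have : {ae P, forall x, 2 * (g x * \1_B x) - g x = 0}.
  have bgB := bmfM bg bB; apply: Ex_eq0_ae.
  - by apply: bmfB => //; exact: bmfZ.
  - move=> x; rewrite indicE; have [/set_mem Bx|nBx] := boolP (x \in B).
      by have : 0 < g x := Bx; rewrite /=; lra.
    have : g x <= 0 by rewrite leNgt; apply: contra nBx => gx; exact: mem_set.
    by rewrite /=; lra.
  - by rewrite ExB//; [rewrite ExZ// gB Eg; lra|exact: bmfZ].
apply: filterS => x; rewrite indicE /g.
by case: (boolP (x \in B)) => /= _; lra.
Qed.

End invariant_measure.

(** * Birkhoff's theorem *)

Section birkhoff.
Context (R : realType) d (T : measurableType d) (P : probability T R).
Variable S : T -> T.
Hypothesis PS : measure_preserving P S.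

Definition bsum (f : T -> R) n x := \sum_(i < n) f (iter i S x).

Definition bavg (f : T -> R) n x := bsum f n x / n%:R.

Definition blimsup (f : T -> R) x := limn_sup (bavg f ^~ x).

Lemma bsumD (f : T -> R) m n x :
  bsum f (m + n) x = bsum f m x + bsum f n (iter m S x).
Proof.
rewrite /bsum big_split_ord/=; congr (_ + _); apply: eq_bigr => i _ /=.
by rewrite addnC iterD.
Qed.

Lemma bmf_iter (f : T -> R) n : bmf f -> bmf (fun x => f (iter n S x)).
Proof.
by move=> bf; apply: bmf_comp => //; have [] := measure_preserving_iter n PS.
Qed.

Lemma bmf_bsum (f : T -> R) n : bmf f -> bmf (bsum f n).
Proof. by move=> bf; apply: bmf_sum => i; exact: bmf_iter. Qed.

Lemma Ex_bsum (f : T -> R) n : bmf f -> Ex P (bsum f n) = n%:R * Ex P f.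
Proof.
move=> bf; rewrite /bsum Ex_sum; last by move=> i; exact: bmf_iter.
rewrite (eq_bigr (fun _ => Ex P f)).
  by rewrite sumr_const card_ord mulr_natl.
by move=> i _; apply: Ex_preserving => //; exact: measure_preserving_iter.
Qed.

Section unit_interval.
Variable f : T -> R.
Hypothesis mf : measurable_fun setT f.
Hypothesis f01 : forall x, 0 <= f x <= 1.

Let bf : bmf f. Proof. exact: bmf_itv mf f01. Qed.

Lemma bsum_itv n x : 0 <= bsum f n x <= n%:R.
Proof.
rewrite /bsum; apply/andP; split.
  by apply: sumr_ge0 => i _; have /andP[] := f01 (iter i S x).
rewrite -[leRHS]mul1r -[X in _ <= _ * X%:R]card_ord mulr_natr -sumr_const.
by apply: ler_sum => i _; have /andP[] := f01 (iter i S x).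
Qed.

Lemma bavg_itv n x : 0 <= bavg f n x <= 1.
Proof.
have /andP[b0 bn] := bsum_itv n x; rewrite /bavg divr_ge0//=.
case: n b0 bn => [|n] b0 bn; first by rewrite invr0 mulr0.
by rewrite ler_pdivrMr// mul1r.
Qed.

Lemma blimsup_itv x : 0 <= blimsup f x <= 1.
Proof. by apply: limn_sup_itv => n; exact: bavg_itv. Qed.

Lemma bmf_bavg n : bmf (bavg f n).
Proof. by apply: bmfM => //; exact: bmf_bsum. Qed.

Lemma bmf_blimsup : bmf (blimsup f).
Proof.
apply: bmf_itv blimsup_itv; apply: measurable_fun_limn_sup.
- by move=> x _; apply: (@itv_has_ubound _ (bavg f ^~ x) 0 1) => // n; exact: bavg_itv.
- by move=> x _; apply: (@itv_has_lbound _ (bavg f ^~ x) 0 1) => // n; exact: bavg_itv.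
- by move=> n; have [] := bmf_bavg n.
Qed.

Lemma bavg_shift n x : (0 < n)%N -> `|bavg f n (S x) - bavg f n x| <= n%:R^-1.
Proof.
move=> n0; have -> : bavg f n (S x) - bavg f n x = (f (iter n S x) - f x) / n%:R.
  rewrite /bavg -mulrBl; congr (_ / _).
  have := bsumD f 1 n x; rewrite add1n -addn1 bsumD /bsum !big_ord1/=; lra.
rewrite normrM [X in _ * X]ger0_norm ?invr_ge0//.
rewrite ler_piMl ?invr_ge0//.
have /andP[? ?] := f01 x; have /andP[? ?] := f01 (iter n S x).
by rewrite ler_norml; apply/andP; split; lra.
Qed.

Lemma blimsup_shift x : blimsup f (S x) = blimsup f x.
Proof.
have near_avg e : 0 < e ->
    exists N, forall n, (N <= n)%N -> `|bavg f n (S x) - bavg f n x| <= e.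
  move=> e0; exists (Num.truncn e^-1).+1 => n Nn.
  have n0 : (0 < n)%N by exact: leq_trans Nn.
  rewrite (le_trans (bavg_shift _ n0))// invf_ple ?posrE ?ltr0n//.
  by rewrite (le_trans (ltW (truncnS_gt _)))// ler_nat.
have U z n : 0 <= bavg f n z <= 1 by exact: bavg_itv.
apply/eqP; rewrite eq_le; apply/andP; split; rewrite leNgt; apply/negP => lt.
- set e := (blimsup f (S x) - blimsup f x) / 3.
  have e0 : 0 < e by rewrite /e; lra.
  have [N1 H1] := near_avg e e0.
  have [|N2 H2] := gt_limn_sup (U x) (c := blimsup f x + e).
    by rewrite -/(blimsup f x); lra.
  have [|n [Nn H3]] := lt_limn_sup (U (S x)) (c := blimsup f x + 2 * e) (maxn N1 N2).
    by rewrite -/(blimsup f (S x)) /e; lra.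
  have := H1 n (leq_trans (leq_maxl _ _) Nn).
  have := H2 n (leq_trans (leq_maxr _ _) Nn).
  by rewrite ler_norml => ? /andP[]; move: H3 => /=; lra.
- set e := (blimsup f x - blimsup f (S x)) / 3.
  have e0 : 0 < e by rewrite /e; lra.
  have [N1 H1] := near_avg e e0.
  have [|N2 H2] := gt_limn_sup (U (S x)) (c := blimsup f (S x) + e).
    by rewrite -/(blimsup f (S x)); lra.
  have [|n [Nn H3]] := lt_limn_sup (U x) (c := blimsup f (S x) + 2 * e) (maxn N1 N2).
    by rewrite -/(blimsup f x) /e; lra.
  have := H1 n (leq_trans (leq_maxl _ _) Nn).
  have := H2 n (leq_trans (leq_maxr _ _) Nn).
  by rewrite ler_norml => ? /andP[]; move: H3 => /=; lra.
Qed.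

Lemma blimsup_iter n x : blimsup f (iter n S x) = blimsup f x.
Proof. by elim: n => //= n <-; exact: blimsup_shift. Qed.

Section covering_by_good_stretches.
Variables (e : R) (e0 : 0 < e) (N : nat).

(** Here stretches of length at most [N] all fall short of the upper limit. The set decreases to the
    empty set as [N] grows, since the upper limit is approached along arbitrarily long averages. *)
Definition bad_start : set T :=
  [set x | forall n, (0 < n <= N)%N -> bavg f n x < blimsup f x - e].

Lemma measurable_bad_start : measurable bad_start.
Proof.
have -> : bad_start = \bigcap_n
    [set x | if (0 < n <= N)%N then bavg f n x < blimsup f x - e else true].
  apply/seteqP; split => x /= bx n.
    by move=> _ /=; case: ifP => // nN; exact: bx.
  by move=> nN; have := bx n I; rewrite /= nN.
apply: bigcapT_measurable => n; case: (0 < n <= N)%N.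
  apply: measurable_ltset; first by have [] := bmf_bavg n.
  by have [] := bmfB bmf_blimsup (bmf_cst _ e).
by rewrite (_ : [set _ | _] = setT)//; apply/seteqP.
Qed.

(* From a good point a stretch of length at most N has average at least
   [blimsup f x - e]; a bad point is a stretch of length 1 on which the
   indicator makes up for the deficit. *)
Lemma bsum_ge_good_stretches L x :
  L%:R * (blimsup f x - e) - N%:R <= bsum (fun z => f z + \1_bad_start z) L x.
Proof.
have e_gt0 := e0; have F0 z : 0 <= f z + \1_bad_start z.
  by have /andP[? ?] := f01 z; rewrite addr_ge0// indicE.
have [n] := ubnP L; elim: n L x => // n IH L x Ln.
have /andP[U0 U1] := blimsup_itv x.
(* A last stretch of at most [N] letters is what the term [- N%:R] pays for. *)
have [LN|NL] := leqP L N.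
  have : 0 <= bsum (fun z => f z + \1_bad_start z) L x by apply: sumr_ge0.
  apply: le_trans; rewrite subr_le0.
  rewrite (@le_trans _ _ (L%:R * 1))//; last by rewrite mulr1 ler_nat.
  by apply: ler_wpM2l => //; rewrite lerBlDr (le_trans U1)// lerDl ltW.
have [bx|] := pselect (bad_start x).
  have L0 : (0 < L)%N by exact: leq_ltn_trans NL.
  rewrite -(prednK L0) -add1n bsumD /= [bsum _ 1 _]/bsum big_ord1 /=.
  have -> : \1_bad_start x = 1 :> R by rewrite indicE mem_set.
  have L1n : (L.-1 < n)%N by rewrite prednK.
  have := IH L.-1 (S x) L1n; rewrite blimsup_shift.
  rewrite natrD mulrDl mul1r; have /andP[? ?] := f01 x; lra.
move=> /existsNP[m] /not_implyP[/andP[m0 mN] /negP]; rewrite -leNgt => am.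
have mL : (m <= L)%N by exact: leq_trans mN (ltnW NL).
rewrite -(subnKC mL) bsumD.
have Lmn : (L - m < n)%N by lia.
have := IH (L - m)%N (iter m S x) Lmn; rewrite blimsup_iter.
have : m%:R * (blimsup f x - e) <= bsum (fun z => f z + \1_bad_start z) m x.
  rewrite -ler_pdivlMl ?ltr0n// mulrC; apply: (le_trans am).
  rewrite /bavg ler_pM2r ?invr_gt0 ?ltr0n//; apply: ler_sum => i _.
  by rewrite lerDl indicE.
rewrite natrD mulrDl; lra.
Qed.

End covering_by_good_stretches.

Lemma bad_start_cvg0 e : 0 < e ->
  (P \o bad_start e) n @[n --> \oo] --> (0 : \bar R)%E.
Proof.
move=> e0; have cap0 : \bigcap_n bad_start e n = set0.
  apply/seteqP; split => // x bx.
  (* The threshold [1] rules out the empty average, of which [bad_start] says nothing. *)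
  have [|n [n1]] := lt_limn_sup (bavg_itv ^~ x) (c := blimsup f x - e) 1.
    by rewrite -/(blimsup f x) ltrBlDr ltrDl.
  by move=> /=; rewrite ltNge ltW// (bx n I)// leqnn andbT.
rewrite -(measure0 P) -cap0; apply: nonincreasing_cvg_mu.
- by rewrite -ge0_fin_numE// fin_num_measure//; exact: measurable_bad_start.
- by move=> n; exact: measurable_bad_start.
- by rewrite cap0.
- move=> m n mn; apply/subsetPset => x /= bx k /andP[k0 km]; apply: bx.
  by rewrite k0 (leq_trans km).
Qed.

(** The Katznelson-Weiss argument: integrating [bsum_ge_good_stretches] over the invariant measure
    bounds [L * (Ex P (blimsup f) - e') - N] by [L] times [Ex P f] plus the probability of a bad
    start. That probability is at most [e'] for a suitable [N], which stays fixed while [L]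
    grows. *)
Lemma Ex_blimsup_le : Ex P (blimsup f) <= Ex P f.
Proof.
apply/ler_addgt0Pr => e e0; set e' := e / 3.
have e'0 : 0 < e' by rewrite /e'; lra.
have [N PN] : exists N, (P (bad_start e' N) <= e'%:E)%E.
  have /fine_cvgP[_ /cvgrPdist_le/(_ _ e'0)[N _ HN]] := bad_start_cvg0 e'0.
  exists N; have := HN N (leqnn _).
  rewrite /= sub0r normrN ger0_norm ?fine_ge0// => le.
  rewrite -[X in (X <= _)%E]fineK ?lee_fin//.
  by apply: fin_num_measure; exact: measurable_bad_start.
have mB := measurable_bad_start e' N; have bB := bmf_indic R mB.
have EB : Ex P (\1_(bad_start e' N) : T -> R) <= e'.
  by rewrite -lee_fin Ex_indic.
have main L : L%:R * (Ex P (blimsup f) - e') - N%:R <= L%:R * (Ex P f + e').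
  have bU : bmf (fun x => L%:R * (blimsup f x - e')).
    by apply: bmfZ; apply: bmfB => //; exact: bmf_blimsup.
  have bF : bmf (bsum (fun z => f z + \1_(bad_start e' N) z) L).
    by apply: bmf_bsum; exact: bmfD.
  have := le_Ex P (bmfB bU (bmf_cst _ N%:R)) bF
    (bsum_ge_good_stretches e'0 N L).
  rewrite ExB// Ex_cst ExZ; last by apply: bmfB => //; exact: bmf_blimsup.
  rewrite ExB ?Ex_cst//; last exact: bmf_blimsup.
  rewrite Ex_bsum; last exact: bmfD.
  move/le_trans; apply; rewrite ler_wpM2l// ExD//; lra.
rewrite leNgt; apply/negP => lt.
(* [main] reads [L * c <= N], which fails for the first integer [L] beyond [N / c]. *)
set c := Ex P (blimsup f) - Ex P f - 2 * e'.
have c0 : 0 < c by rewrite /c /e'; lra.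
have := main (Num.truncn (N%:R / c)).+1.
have := truncnS_gt (N%:R / c); rewrite ltr_pdivrMr//.
set L := (Num.truncn _).+1%:R; rewrite /c; lra.
Qed.

End unit_interval.

(** The inequality is applied to [f] and to [1 - f]. The two upper limits always add up to at least
    [1], and their sum has mean at most [1], so it equals [1] almost everywhere; there the upper and
    lower limits of the averages of [f] coincide. *)
Lemma birkhoff_unit_interval (f : T -> R) : measurable_fun setT f ->
  (forall x, 0 <= f x <= 1) ->
  Ex P (blimsup f) = Ex P f /\
  {ae P, forall x, bavg f n x @[n --> \oo] --> blimsup f x}.
Proof.
move=> mf f01; pose g x := 1 - f x.
have mg : measurable_fun setT g by exact: measurable_funB.
have g01 x : 0 <= g x <= 1.
  by have /andP[? ?] := f01 x; rewrite /g; apply/andP; split; lra.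
have bf := bmf_itv mf f01; have bg := bmf_itv mg g01.
have bUf := bmf_blimsup mf f01; have bUg := bmf_blimsup mg g01.
have Ef := Ex_blimsup_le mf f01; have Eg := Ex_blimsup_le mg g01.
have Eg1 : Ex P g = 1 - Ex P f by rewrite ExB// Ex_cst.
have avg1 n x : (0 < n)%N -> bavg g n x = 1 - bavg f n x.
  move=> n0; rewrite /bavg /bsum /g sumrB sumr_const card_ord mulrBl divff//.
  by rewrite pnatr_eq0 -lt0n.
clearbody g.
have ge1 x : 1 <= blimsup f x + blimsup g x.
  rewrite leNgt; apply/negP => lt1; set e := (1 - (blimsup f x + blimsup g x)) / 2.
  have [N1 H1] := @gt_limn_sup _ _ _ _ (bavg_itv f01 ^~ x) (blimsup f x + e)
    ltac:(by rewrite -/(blimsup f x) /e; lra).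
  have [N2 H2] := @gt_limn_sup _ _ _ _ (bavg_itv g01 ^~ x) (blimsup g x + e)
    ltac:(by rewrite -/(blimsup g x) /e; lra).
  have := H1 (maxn N1 N2).+1 (leqW (leq_maxl _ _)).
  have := H2 (maxn N1 N2).+1 (leqW (leq_maxr _ _)).
  by rewrite /= avg1// /e; lra.
split.
  apply/eqP; rewrite eq_le Ef/=.
  have : 1 <= Ex P (fun x => blimsup f x + blimsup g x).
    by apply: Ex_ge_cst => //; exact: bmfD.
  by rewrite ExD//; lra.
have : {ae P, forall x, blimsup f x + blimsup g x - 1 = 0}.
  apply: Ex_eq0_ae.
  - by apply: bmfB => //; exact: bmfD.
  - by move=> x; rewrite subr_ge0.
  - by rewrite ExB ?Ex_cst//; [rewrite ExD//; lra|exact: bmfD].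
apply: filterS => x x0; apply/cvgrPdist_le => e e0.
have [N1 H1] := @gt_limn_sup _ _ _ _ (bavg_itv f01 ^~ x) (blimsup f x + e)
  ltac:(by rewrite -/(blimsup f x); lra).
have [N2 H2] := @gt_limn_sup _ _ _ _ (bavg_itv g01 ^~ x) (blimsup g x + e)
  ltac:(by rewrite -/(blimsup g x); lra).
exists (maxn N1 N2).+1 => // n /= Nn.
have := H1 n (leq_trans (leqW (leq_maxl _ _)) Nn).
have := H2 n (leq_trans (leqW (leq_maxr _ _)) Nn).
rewrite /= avg1 ?(leq_trans _ Nn)// ler_norml => ? ?.
by apply/andP; split; lra.
Qed.

End birkhoff.

(** * Averages over shifted runs of blocks *)

Lemma cvg_sumr (R : realType) (I : finType) (F : I -> nat -> R) (l : I -> R) :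
  (forall i, F i n @[n --> \oo] --> l i) ->
  \sum_i F i n @[n --> \oo] --> \sum_i l i.
Proof.
move=> Fl; elim: (index_enum _) => [|i s IH].
  by under eq_cvg do rewrite big_nil; rewrite big_nil; exact: cvg_cst.
by under eq_cvg do rewrite big_cons; rewrite big_cons; exact: cvgD.
Qed.

Section segments.
Context (R : realType) d (T : measurableType d) (P : probability T R).
Variable S : T -> T.
Hypothesis PS : measure_preserving P S.
Hypothesis ergS : ergodic_map P S.

Lemma sum_mul_split (V : zmodType) (F : nat -> V) k m :
  \sum_(j < k * m) F j = \sum_(t < k) \sum_(i < m) F (t * m + i)%N.
Proof.
elim: k => [|k IH]; first by rewrite !big_ord0.
by rewrite big_ord_recr/= -IH mulSnr big_split_ord.
Qed.

(** Block [i] of run [t] starts at [k * (t * m + i) + t], that is, at time [t * m + i] of the orbit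
    of [iter t S x] under the [k]-th power of [S]. Hence the sum over a run is the difference of two
    Birkhoff sums from that point, of lengths [t.+1 * m] and [t * m]. *)
Lemma segment_sumE (f : T -> R) k m x :
  (\sum_(j < k * m) f (iter (j * k + j %/ m) S x)) / (k * m)%:R =
  k%:R^-1 * \sum_(t < k)
    (t.+1%:R * bavg (iter k S) f (t.+1 * m) (iter t S x) -
     t%:R * bavg (iter k S) f (t * m) (iter t S x)).
Proof.
case: m => [|m].
  rewrite muln0 invr0 big_ord0 big1 ?mulr0// => t _.
  by rewrite /bavg !muln0 invr0 !mulr0 subrr.
have avgE t y : t%:R * bavg (iter k S) f (t * m.+1) y =
    bsum (iter k S) f (t * m.+1) y / m.+1%:R.
  case: t => [|t]; first by rewrite mul0n /bsum big_ord0 !mul0r.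
  by rewrite /bavg natrM invfM mulrCA (mulrA t.+1%:R) divff ?mul1r.
have /= -> := sum_mul_split (fun j => f (iter (j * k + j %/ m.+1) S x)) k m.+1.
rewrite mulr_suml mulr_sumr; apply: eq_bigr => t _.
rewrite !avgE -mulrBl mulSnr bsumD (addrC (bsum _ _ (t * _) _)) addrK.
rewrite natrM invfM [RHS]mulrCA; congr (_ * _).
apply: eq_bigr => i _.
rewrite divnMDl// divn_small// addn0 -iterM -iterM -iterD -iterD.
by congr (f (iter _ _ _)); lia.
Qed.

Lemma segment_average_unit (f : T -> R) k : (0 < k)%N ->
  measurable_fun setT f -> (forall x, 0 <= f x <= 1) ->
  {ae P, forall x,
    (\sum_(j < k * m) f (iter (j * k + j %/ m) S x)) / (k * m)%:R
      @[m --> \oo] --> Ex P f}.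
Proof.
move=> k0 mf f01; set Sk := iter k S; pose U : T -> R := blimsup Sk f.
have PSk : measure_preserving P Sk by exact: measure_preserving_iter.
have [EU aeU] := birkhoff_unit_interval PSk mf f01.
have bU : bmf U by exact: (bmf_blimsup PSk mf f01).
pose psi x := \sum_(t < k) U (iter t S x).
have bpsi : bmf psi by exact: (bmf_bsum PS k bU).
have Epsi : Ex P psi = k%:R * Ex P f by rewrite -EU; exact: (@Ex_bsum _ _ _ _ _ PS U k).
have psiS x : psi (S x) = psi x.
  rewrite /psi -(prednK k0) big_ord_recr [RHS]big_ord_recl /= addrC.
  congr (_ + _); last by apply: eq_bigr => i _; rewrite -iterSr.
  by rewrite -iterSr prednK//; exact: blimsup_shift.
have := ergodic_invariant_cst ergS bpsi psiS.
have := @ae_foralln _ _ _ P (fun t x => bavg Sk f n (iter t S x) @[n --> \oo] --> U (iter t S x)).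
move=> /(_ (fun t => ae_preserving (measure_preserving_iter t PS) aeU)).
apply: filterS2 => x cvgU psix.
have cvgt (s t : nat) : s%:R * bavg Sk f (s * m) (iter t S x) @[m --> \oo] -->
    s%:R * U (iter t S x).
  case: s => [|s].
    by under eq_cvg do rewrite mul0r; rewrite mul0r; exact: cvg_cst.
  apply: cvgMr; apply: (cvg_comp (fun m => s.+1 * m)%N _ _ (cvgU t)).
  apply/cvgnyPge => A; exists A => // m /= Am.
  by rewrite (leq_trans Am)// leq_pmull.
(* Run [t] contributes [t.+1 * U - t * U = U] at [iter t S x], so the limit is [psi x / k], and
   [psi] is almost everywhere its mean. *)
have -> : Ex P f = k%:R^-1 * \sum_(t < k) (t.+1%:R * U (iter t S x) - t%:R * U (iter t S x)).
  rewrite (eq_bigr (fun t : 'I_k => U (iter t S x))); last first.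
    by move=> t _; rewrite -mulrBl -natrB// subSnn mul1r.
  by rewrite -/(psi x) psix Epsi mulrA mulVf ?mul1r// pnatr_eq0 -lt0n.
under eq_cvg do rewrite segment_sumE.
apply: cvgMr; apply: cvg_sumr => t; apply: cvgB; exact: cvgt.
Qed.

Theorem segment_average (f : T -> R) k : (0 < k)%N -> bmf f ->
  {ae P, forall x,
    (\sum_(j < k * m) f (iter (j * k + j %/ m) S x)) / (k * m)%:R
      @[m --> \oo] --> Ex P f}.
Proof.
move=> k0 bf; have [K K0 Kf] := bmf_bound bf.
have [mf _] := bf.
pose g x := (f x + K) / (2 * K).
have bg : bmf g by apply: bmfM => //; exact: bmfD.
have g01 x : 0 <= g x <= 1.
  have := Kf x; rewrite ler_norml => /andP[? ?].
  by rewrite /g divr_ge0 ?ler_pdivrMr; lra.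
have fE x : f x = 2 * K * g x - K.
  by rewrite /g mulrC divfK; lra.
have Ef : Ex P f = 2 * K * Ex P g - K.
  rewrite -ExZ// -[X in _ - X](Ex_cst P) -ExB//; last exact: bmfZ.
  by apply: eq_Rintegral => x _; exact: fE.
have := segment_average_unit k0 (bmf_measurable bg) g01.
clearbody g.
apply: filterS => x cg; rewrite Ef.
have : 2 * K * ((\sum_(j < k * m) g (iter (j * k + j %/ m) S x)) / (k * m)%:R) - K
    @[m --> \oo] --> 2 * K * Ex P g - K.
  by apply: cvgB; [exact: cvgMr|exact: cvg_cst].
apply: cvg_trans; apply: near_eq_cvg; exists 1%N => // m /= m1.
under [in RHS]eq_bigr do rewrite fE.
rewrite sumrB sumr_const card_ord -mulr_sumr mulrBl mulrA -(mulr_natr K) mulfK//.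
by rewrite pnatr_eq0 -lt0n muln_gt0 k0.
Qed.

End segments.

(** * Sequence space and tuples *)

Section sequence_space.
Context d (T : measurableType d).

Lemma measurable_coord i : measurable_fun setT (fun x : seqspace T => x i).
Proof.
by move=> _ Y mY; rewrite setTI; apply: sub_sigma_algebra; exists i, Y.
Qed.

Lemma measurable_seqspace d' (X : measurableType d') (f : X -> seqspace T) :
  (forall i, measurable_fun setT (fun x => f x i)) -> measurable_fun setT f.
Proof.
move=> mf; apply: (@measurability _ _ _ _ setT f (cylinders T)) => //.
by move=> _ [_ [i [S [mS ->]]] <-]; rewrite setTI -[X in measurable X]setTI; exact: mf.
Qed.

Lemma measurable_window s n : measurable_fun setT (window s n : seqspace T -> _).
Proof.
apply/measurable_fun_tnthP => i.
rewrite (_ : _ \o _ = fun x : seqspace T => x (s + i)%N); first exact: measurable_coord.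
by apply/funext => x /=; rewrite tnth_mktuple.
Qed.

Lemma measurable_shift : measurable_fun setT (@Defs.shift _ T).
Proof. by apply: measurable_seqspace => i; exact: measurable_coord. Qed.

Lemma iter_shiftE n (x : seqspace T) : iter n Defs.shift x = fun m => x (n + m)%N.
Proof.
elim: n => [|n IH] /=; first exact/funext.
by rewrite IH /Defs.shift; apply/funext => m; rewrite addnS addSn.
Qed.

Lemma window_shift s n (x : seqspace T) : window s n x = window 0 n (iter s Defs.shift x).
Proof. by rewrite iter_shiftE; apply: eq_from_tnth => i; rewrite !tnth_mktuple. Qed.

Lemma measurable_reindex n k (h : 'I_k -> 'I_n) :
  measurable_fun setT (fun y : n.-tuple T => [tuple tnth y (h i) | i < k]).
Proof.
apply/measurable_fun_tnthP => i.
rewrite (_ : _ \o _ = fun y : n.-tuple T => tnth y (h i)); first exact: measurable_tnth.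
by apply/funext => x /=; rewrite tnth_mktuple.
Qed.

(** One-coordinate cylinders are not stable under intersection. These sets generate the same
    sigma-algebra and are stable, as uniqueness of measures demands; they are also the sets of which
    stationarity speaks. *)
Definition window_sets : set (set (seqspace T)) :=
  [set B | exists n (S : set (n.-tuple T)), measurable S /\ B = window 0 n @^-1` S].

Lemma window_sets_measurable : measurable = <<s window_sets >>.
Proof.
apply/seteqP; split.
  apply: smallest_sub; first exact: smallest_sigma_algebra.
  move=> _ [i [S [mS ->]]]; apply: sub_sigma_algebra.
  exists i.+1, ((fun y => tnth y ord_max) @^-1` S); split.
    by rewrite -[X in measurable X]setTI; exact: measurable_tnth.
  by apply/seteqP; split => x /=; rewrite tnth_mktuple.
apply: smallest_sub; first exact: sigma_algebra_measurable.
move=> _ [n [S [mS ->]]]; rewrite -[X in measurable X]setTI.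
exact: measurable_window.
Qed.

Lemma window_sets_widen n N (S : set (n.-tuple T)) : (n <= N)%N -> measurable S ->
  exists S' : set (N.-tuple T), measurable S' /\
    window 0 n @^-1` S = window 0 N @^-1` S'.
Proof.
move=> nN mS.
exists ((fun y => [tuple tnth y (widen_ord nN i) | i < n]) @^-1` S); split.
  by rewrite -[X in measurable X]setTI; exact: measurable_reindex.
suff H : forall x : seqspace T, window 0 n x = [tuple tnth (window 0 N x) (widen_ord nN i) | i < n].
  by apply/seteqP; split => x /=; rewrite H.
by move=> x; apply: eq_from_tnth => i; rewrite !tnth_mktuple.
Qed.

Lemma window_sets_setI_closed : setI_closed window_sets.
Proof.
move=> _ _ [m [S [mS ->]]] [n [S' [mS' ->]]].
have [U [mU ->]] := window_sets_widen (leq_maxl m n) mS.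
have [V [mV ->]] := window_sets_widen (leq_maxr m n) mS'.
by exists (maxn m n), (U `&` V); split; [exact: measurableI|].
Qed.

Lemma stationary_preserving (R : realType) (P : probability (seqspace T) R) :
  stationary P -> measure_preserving P (@Defs.shift _ T).
Proof.
move=> statP; split; first exact: measurable_shift.
move=> B mB; rewrite -(lawE P measurable_shift).
apply: (measure_unique window_sets (fun _ => setT)) => //.
- exact: window_sets_measurable.
- exact: window_sets_setI_closed.
- by move=> _; exists 0%N, setT; split.
- by rewrite bigcup_const//; exists 0%N.
- move=> _ [n [S [mS ->]]]; rewrite [RHS](statP n 1%N S mS).
  have E : Defs.shift @^-1` (window 0 n @^-1` S) = window 1 n @^-1` S.
    by apply/seteqP; split => x /=; rewrite (window_shift 1).
  by rewrite -E.
- by move=> k; rewrite -ge0_fin_numE// fin_num_measure.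
Qed.

End sequence_space.
Arguments measurable_window {d T} s n.

Section tuple_product.
Context (R : realType) d (T : measurableType d).

Lemma measurable_cons_tuple n :
  measurable_fun setT (fun z : T * n.-tuple T => [tuple of z.1 :: z.2]).
Proof. by apply: measurable_cons. Qed.

(** The [n]-fold product law, built by adding one coordinate at a time so that Fubini yields
    [Ex_iid_prod] by induction. *)
Fixpoint iid (Q : probability T R) n : probability (n.-tuple T) R :=
  match n with
  | 0 => \d_ [tuple]
  | m.+1 => law (Q \x iid Q m)%E (@measurable_cons_tuple m)
  end.

Lemma bmf_tnth n (g : 'I_n -> T -> R) i : (forall i, bmf (g i)) ->
  bmf (fun y : n.-tuple T => g i (tnth y i)).
Proof. by move=> bg; apply: bmf_comp => //; exact: measurable_tnth. Qed.

Lemma Ex_iid_prod (Q : probability T R) n (g : 'I_n -> T -> R) :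
  (forall i, bmf (g i)) ->
  Ex (iid Q n) (fun y => \prod_i g i (tnth y i)) = \prod_i Ex Q (g i).
Proof.
elim: n g => [|n IH] g bg.
  under eq_Rintegral do rewrite big_ord0.
  by rewrite big_ord0 Ex_cst.
have bP : bmf (fun y : n.+1.-tuple T => \prod_i g i (tnth y i)).
  by apply: bmf_prod => i; exact: bmf_tnth.
rewrite /= Ex_law// Ex_prod1; last exact: (bmf_comp bP (@measurable_cons_tuple n)).
rewrite big_ord_recl -IH//.
rewrite -ExZr//; apply: eq_Rintegral => x _.
have bP' : bmf (fun y : n.-tuple T => \prod_i g (lift ord0 i) (tnth y i)).
  apply: bmf_prod => i.
  exact: (@bmf_tnth n (fun j => g (lift ord0 j)) i (fun j => bg (lift ord0 j))).
rewrite -ExZ//.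
apply: eq_Rintegral => y _.
by rewrite big_ord_recl tnth0; congr (_ * _); apply: eq_bigr => i _; rewrite tnthS.
Qed.

Lemma split_lshift m n (i : 'I_m) : fintype.split (lshift n i) = inl i.
Proof. exact: (unsplitK (inl i)). Qed.

Lemma split_rshift m n (i : 'I_n) : fintype.split (rshift m i) = inr i.
Proof. exact: (unsplitK (inr i)). Qed.

Definition tcat m n (z : m.-tuple T * n.-tuple T) : (m + n).-tuple T :=
  [tuple match fintype.split i with inl j => tnth z.1 j | inr j => tnth z.2 j end | i < m + n].

Lemma tnth_tcat_l m n z (i : 'I_m) : tnth (@tcat m n z) (lshift n i) = tnth z.1 i.
Proof. by rewrite tnth_mktuple split_lshift. Qed.

Lemma tnth_tcat_r m n z (i : 'I_n) : tnth (@tcat m n z) (rshift m i) = tnth z.2 i.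
Proof. by rewrite tnth_mktuple split_rshift. Qed.

Lemma measurable_tcat m n : measurable_fun setT (@tcat m n).
Proof.
apply/measurable_fun_tnthP => i; case: (splitP i) => j ij.
  have -> : i = lshift n j by exact/val_inj.
  rewrite (_ : _ \o _ = fun z : m.-tuple T * n.-tuple T => tnth z.1 j).
    by apply: (measurableT_comp (measurable_tnth j)).
  by apply/funext => z /=; rewrite tnth_tcat_l.
have -> : i = rshift m j by exact/val_inj.
rewrite (_ : _ \o _ = fun z : m.-tuple T * n.-tuple T => tnth z.2 j).
  by apply: (measurableT_comp (measurable_tnth j)).
by apply/funext => z /=; rewrite tnth_tcat_r.
Qed.

Definition tfst m n (x : (m + n).-tuple T) := [tuple tnth x (lshift n i) | i < m].
Definition tsnd m n (x : (m + n).-tuple T) := [tuple tnth x (rshift m i) | i < n].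

Lemma tcat_tfst m n z : tfst (@tcat m n z) = z.1.
Proof. by apply: eq_from_tnth => i; rewrite tnth_mktuple tnth_tcat_l. Qed.

Lemma tcat_tsnd m n z : tsnd (@tcat m n z) = z.2.
Proof. by apply: eq_from_tnth => i; rewrite tnth_mktuple tnth_tcat_r. Qed.

Lemma measurable_tfst m n : measurable_fun setT (@tfst m n).
Proof. exact: measurable_reindex. Qed.

Lemma measurable_tsnd m n : measurable_fun setT (@tsnd m n).
Proof. exact: measurable_reindex. Qed.

End tuple_product.

(** * Greedy covering and Chernoff bounds *)

Section greedy_covering.
Context (R : realType) d1 d2 (X : measurableType d1) (Y : measurableType d2).
Variables (P : probability X R) (mu : probability Y R).
Variables (B : set (X * Y)) (G : set X) (q q0 : R).
Hypothesis mB : measurable B.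
Hypothesis mG : measurable G.
Hypotheses (q_gt0 : 0 < q) (q_lt : q < q0) (q_le1 : q <= 1).
Hypothesis ball_ge : forall x, G x -> q0 <= Ex mu (fun y => \1_B (x, y)).

Definition uncovered (s : seq Y) : set X :=
  [set x | G x /\ forall y, y \in s -> ~ B (x, y)].

Let measurable_covered y : measurable [set x | B (x, y)].
Proof.
rewrite -[X in measurable X]setTI.
by have := @measurable_pair2 _ _ X Y y; apply.
Qed.

Lemma measurable_uncovered s : measurable (uncovered s).
Proof.
elim: s => [|y s IH].
  by rewrite (_ : uncovered _ = G)//; apply/seteqP; split => [x []//|x Gx]; split.
have -> : uncovered (y :: s) = uncovered s `\` [set x | B (x, y)].
  apply/seteqP; split => [x [Gx xs]|x [[Gx xs] xy]].
    split; last by apply: xs; rewrite mem_head.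
    by split => // z zs; apply: xs; rewrite in_cons zs orbT.
  by split => // z; rewrite in_cons => /orP[/eqP->|/xs].
exact: measurableD.
Qed.

(** By Fubini, the part of the uncovered set that a random [y] covers has mean at least [q0] times
    its probability, so some [y] covers more than the fraction [q < q0]. The middle clause carries
    the constraints on [y] contained in [B] over to every chosen codeword. *)
Lemma greedy_cover N : exists s : seq Y, [/\ (size s <= N)%N,
  forall y, y \in s -> exists x, B (x, y) &
  Ex P \1_(uncovered s) <= (1 - q) ^+ N].
Proof.
elim: N => [|N [s [sN sB Es]]].
  exists [::]; split => //; rewrite expr0; apply: Ex_le_cst.
    exact: bmf_indic (measurable_uncovered _).
  by move=> x; rewrite indicE; case: (_ \in _).
have q1 : 0 <= 1 - q by rewrite subr_ge0.
set U := uncovered s in Es; have mU : measurable U := measurable_uncovered s.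
have bU : bmf (\1_U : X -> R) := bmf_indic R mU.
have bB : bmf (\1_B : X * Y -> R) := bmf_indic R mB.
(* Nothing is added once the uncovered set is null; the strict inequality below needs positive
   probability. *)
have [U0|U0] := leP (Ex P \1_U) 0.
  by exists s; split => //; [exact: leqW|exact: le_trans U0 (exprn_ge0 _ _)].
pose F z := \1_U z.1 * \1_B z : R.
have bF : bmf F by apply: bmfM => //; exact: (bmf_comp bU).
have : q * Ex P \1_U < Ex mu (fun y => Ex P (fun x => F (x, y))).
  rewrite -Ex_prod2// Ex_prod1//.
  apply: (@lt_le_trans _ _ (q0 * Ex P \1_U)); first by rewrite ltr_pM2r.
  rewrite -ExZ//; apply: le_Ex; [exact: bmfZ|exact: bmf_Ex_snd|].
  move=> x; rewrite /F/= ExZ; last exact: bmf_curry.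
  rewrite indicE; have [/set_mem [Gx _]|_] := boolP (x \in U); last by rewrite mulr0 mul0r.
  by rewrite mulr1 mul1r; exact: ball_ge.
move=> /Ex_exists_gt-[|y yF]; first exact: bmf_Ex_fst.
have yF0 : 0 < Ex P (fun x => F (x, y)) by rewrite (lt_trans _ yF)// mulr_gt0.
(* The chosen [y] covers a set of positive probability, hence at least one point. *)
have [|x] := Ex_exists_gt _ yF0; first exact: bmf_flip.
rewrite /F/= => Fx.
exists (y :: s); split => //.
- move=> z; rewrite in_cons => /orP[/eqP->|]; last exact: sB.
  exists x; apply: contrapT => nB; move: Fx; rewrite [\1_B _]indicE memNset//.
  by rewrite mulr0 ltxx.
- rewrite exprS; apply: (@le_trans _ _ ((1 - q) * Ex P \1_U)); last by rewrite ler_wpM2l.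
  have E : (\1_(uncovered (y :: s)) : X -> R) = fun x => \1_U x - F (x, y).
    apply/funext => z; rewrite /F/= !indicE.
    have [/set_mem[Gz zs]|nz] := boolP (z \in U); last first.
      rewrite mul0r subr0; congr (_%:R); congr nat_of_bool; apply/negbTE.
      apply: contra nz => /set_mem[Gz zys]; apply/mem_set; split => // w ws.
      by apply: zys; rewrite in_cons ws orbT.
    have [/set_mem zy|/negP zy] := boolP ((z, y) \in B).
      rewrite memNset ?mul1r ?subrr//= => -[_ /(_ y)].
      by rewrite mem_head => /(_ isT).
    rewrite mem_set/= ?mul0r ?mulr0 ?subr0//; split => // w.
    rewrite in_cons => /orP[/eqP->|/zs//]; by move=> ?; apply: zy; exact: mem_set.
  rewrite E ExB//; last exact: bmf_flip.
  by rewrite mulrBl mul1r; lra.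
Qed.

End greedy_covering.

(** From [1 - u <= expR (- u)] one gets [expR u <= (1 - u)^-1]. The product of [1 - u] and the right
    side is [1 + u ^+ 2 * (1 - 2 * u)], at least [1] for such [u]. *)
Lemma expR_le_quad (R : realType) (u : R) : u <= 1 / 2 -> expR u <= 1 + u + 2 * u ^+ 2.
Proof.
move=> u2; have u1 : 0 < 1 - u by lra.
have : 1 - u <= expR (- u) by have := expR_ge1Dx (- u); lra.
rewrite expRN => h.
have -> : expR u = (expR u)^-1^-1 by rewrite invrK.
have : (expR u)^-1^-1 <= (1 - u)^-1 by rewrite lef_pV2 ?posrE ?invr_gt0 ?expR_gt0.
move/le_trans; apply; rewrite -[leLHS]mul1r ler_pdivrMr//.
have : 0 <= u ^+ 2 * (1 - 2 * u) by rewrite mulr_ge0 ?sqr_ge0//; lra.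
by rewrite expr2 => ?; nra.
Qed.

Section chernoff.
Context (R : realType) d (Y : measurableType d) (Q : probability Y R) (J : nat).
Variable f : 'I_J -> Y -> R.
Hypothesis bf : forall j, bmf (f j).
Hypothesis f0 : forall j y, 0 <= f j y.
Hypothesis f1 : forall j, Ex Q (f j) = 1.

Lemma bmf_prod_density : bmf (fun y : J.-tuple Y => \prod_j f j (tnth y j)).
Proof. by apply: bmf_prod => j; exact: bmf_tnth. Qed.

(** The left side is the probability of a large sum under the product of the laws with densities
    [f j]. The indicator is bounded by an exponential, the expectation factors over the coordinates,
    and each factor is bounded by [expR_le_quad]. *)
Lemma chernoff (Z : 'I_J -> Y -> R) (c l t a : R) :
  (forall j, measurable_fun setT (Z j)) -> (forall j y, `|Z j y| <= c) ->
  0 < l -> l * c <= 1 / 2 -> \sum_j Ex Q (fun y => f j y * Z j y) <= t ->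
  Ex (iid Q J) (fun y => (\prod_j f j (tnth y j)) *
    \1_[set y | t + a < \sum_j Z j (tnth y j)] y)
  <= expR (- (l * a) + J%:R * (2 * (l * c) ^+ 2)).
Proof.
move=> mZ Zc l0 lc Zt.
have bZ j : bmf (Z j) by split => //; exists c.
have bS : bmf (fun y : J.-tuple Y => \sum_j Z j (tnth y j)).
  by apply: bmf_sum => j; exact: bmf_tnth.
have bE : bmf (fun y : J.-tuple Y => expR (l * (\sum_j Z j (tnth y j) - (t + a)))).
  by apply: bmf_expR; apply: bmfZ; exact: bmfB.
have bt j : bmf (fun y => f j y * expR (l * Z j y)).
  by apply: bmfM => //; apply: bmf_expR; exact: bmfZ.
have mI : measurable [set y : J.-tuple Y | t + a < \sum_j Z j (tnth y j)].
  by apply: measurable_ltset => //; exact: bmf_measurable bS.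
apply: (@le_trans _ _ (Ex (iid Q J) (fun y => (\prod_j f j (tnth y j)) *
    expR (l * (\sum_j Z j (tnth y j) - (t + a)))))).
  have bD := bmf_prod_density; have bI := bmf_indic R mI.
  apply: le_Ex; [exact: bmfM|exact: bmfM|].
  move=> y; apply: ler_wpM2l; first by apply: prodr_ge0.
  rewrite indicE; have [/set_mem/= ty|_] := boolP (_ \in _); last exact: expR_ge0.
  by rewrite -[1%:R]expR0 ler_expR mulr_ge0 ?ltW// subr_gt0.
have -> : (fun y : J.-tuple Y => (\prod_j f j (tnth y j)) *
    expR (l * (\sum_j Z j (tnth y j) - (t + a)))) =
  (fun y => expR (- (l * (t + a))) * \prod_j (f j (tnth y j) * expR (l * Z j (tnth y j)))).
  apply/funext => y; rewrite big_split/= mulrBr expRD mulr_sumr expR_sum.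
  by rewrite [RHS]mulrCA (mulrC (expR (- _))).
rewrite ExZ; last by apply: bmf_prod => j; exact: (bmf_tnth _ bt).
rewrite (@Ex_iid_prod _ _ _ Q J (fun j y => f j y * expR (l * Z j y)) bt).
have step j : Ex Q (fun y => f j y * expR (l * Z j y)) <=
    expR (l * Ex Q (fun y => f j y * Z j y) + 2 * (l * c) ^+ 2).
  apply: le_trans (expR_ge1Dx _).
  have -> : 1 + (l * Ex Q (fun y => f j y * Z j y) + 2 * (l * c) ^+ 2) =
      Ex Q (fun y => f j y * (1 + 2 * (l * c) ^+ 2) + l * (f j y * Z j y)).
    have bfZ : bmf (fun y => f j y * Z j y) by exact: bmfM.
    rewrite ExD; [|by apply: bmfM|exact: bmfZ].
    by rewrite ExZr// ExZ// f1 mul1r; ring.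
  apply: le_Ex => //; first by apply: bmfD; [exact: bmfM|apply: bmfZ; exact: bmfM].
  move=> y; have -> : f j y * (1 + 2 * (l * c) ^+ 2) + l * (f j y * Z j y) =
    f j y * (1 + l * Z j y + 2 * (l * c) ^+ 2) by ring.
  apply: ler_wpM2l => //.
  have := Zc j y; rewrite ler_norml => /andP[Z1 Z2].
  apply: (le_trans (expR_le_quad _)).
    by rewrite (le_trans _ lc)// ler_pM2l.
  rewrite lerD2l ler_pM2l// !exprMn ler_pM2l ?exprn_gt0//.
  by rewrite -real_normK ?num_real// ler_sqr ?nnegrE// (le_trans _ (Zc j y)).
apply: (@le_trans _ _ (expR (- (l * (t + a))) *
    \prod_j expR (l * Ex Q (fun y => f j y * Z j y) + 2 * (l * c) ^+ 2))).
  apply: ler_wpM2l; first exact: expR_ge0.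
  apply: ler_prod => j _; rewrite step andbT.
  by apply: Ex_ge0 => y; rewrite mulr_ge0// expR_ge0.
rewrite -expR_sum -expRD ler_expR big_split/= -mulr_sumr sumr_const card_ord.
rewrite -[in leLHS]mulr_natl; set s := \sum_j _ in Zt *.
have : l * s <= l * t by rewrite ler_pM2l.
by lra.
Qed.

Section small_ball.
Variables (c t1 t2 t3 del : R).
Hypotheses (c0 : 0 < c) (del0 : 0 < del) (delc : del <= 2 * c).
Hypothesis large_J : expR (- (J%:R * (del ^+ 2 / (8 * c ^+ 2)))) <= 1 / 6.

(** The value [l = del / (4 * c ^+ 2)] minimises the exponent [- l * del + 2 * (l * c) ^+ 2] per
    coordinate, with minimum [- del ^+ 2 / (8 * c ^+ 2)]. The condition [l * c <= 1 / 2] becomes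
    [del <= 2 * c]. *)
Lemma chernoff_opt (Z : 'I_J -> Y -> R) (t : R) :
  (forall j, measurable_fun setT (Z j)) -> (forall j y, `|Z j y| <= c) ->
  \sum_j Ex Q (fun y => f j y * Z j y) <= t ->
  Ex (iid Q J) (fun y => (\prod_j f j (tnth y j)) *
    \1_[set y | t + J%:R * del < \sum_j Z j (tnth y j)] y) <= 1 / 6.
Proof.
move=> mZ Zc Zt; pose l := del / (4 * c ^+ 2).
have c_neq0 : c != 0 by rewrite gt_eqF.
have lcE : l * c = del / (4 * c) by rewrite /l; field.
apply: le_trans large_J; apply: (le_trans (chernoff (l := l) _ mZ Zc _ _ Zt)).
- by rewrite /l divr_gt0// mulr_gt0// exprn_gt0.
- by rewrite lcE ler_pdivrMr ?mulr_gt0//; move: delc; lra.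
- rewrite ler_expR lcE /l le_eqVlt; apply/orP; left; apply/eqP.
  by field.
Qed.

(** A change of measure from the product of the tilted laws to [iid Q J]. The product density [W]
    has mean [1]. The three events on which a sum exceeds its bound carry at most [3 * (1 / 6)] of
    it; off them [W] is at most [r = expR (t1 + J%:R * del)]. So the target set has probability at
    least [1 / (2 * r)]. *)
Lemma small_ball (Z1 Z2 Z3 : 'I_J -> Y -> R) :
  (forall j y, f j y = expR (Z1 j y)) ->
  (forall j, measurable_fun setT (Z1 j)) -> (forall j y, `|Z1 j y| <= c) ->
  (forall j, measurable_fun setT (Z2 j)) -> (forall j y, `|Z2 j y| <= c) ->
  (forall j, measurable_fun setT (Z3 j)) -> (forall j y, `|Z3 j y| <= c) ->
  \sum_j Ex Q (fun y => f j y * Z1 j y) <= t1 ->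
  \sum_j Ex Q (fun y => f j y * Z2 j y) <= t2 ->
  \sum_j Ex Q (fun y => f j y * Z3 j y) <= t3 ->
  expR (- (t1 + J%:R * del)) / 2 <=
  Ex (iid Q J) \1_[set y | \sum_j Z2 j (tnth y j) <= t2 + J%:R * del /\
                          \sum_j Z3 j (tnth y j) <= t3 + J%:R * del].
Proof.
move=> fE mZ1 Z1c mZ2 Z2c mZ3 Z3c E1 E2 E3.
set D := [set y | _ /\ _].
have mS (Z : 'I_J -> Y -> R) : (forall j, measurable_fun setT (Z j)) ->
    (forall j y, `|Z j y| <= c) ->
    bmf (fun y : J.-tuple Y => \sum_j Z j (tnth y j)).
  move=> mZ Zc; apply: bmf_sum => j.
  by apply: (@bmf_tnth _ _ _ _ Z) => i; split => //; exists c.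
have mD : measurable D.
  have -> : D = [set y | \sum_j Z2 j (tnth y j) <= t2 + J%:R * del] `&`
                [set y | \sum_j Z3 j (tnth y j) <= t3 + J%:R * del] by [].
  by apply: measurableI; apply: measurable_leset => //; apply: bmf_measurable; exact: mS.
pose bad (Z : 'I_J -> Y -> R) t := [set y : J.-tuple Y | t + J%:R * del < \sum_j Z j (tnth y j)].
have mbad (Z : 'I_J -> Y -> R) t : (forall j, measurable_fun setT (Z j)) ->
    (forall j y, `|Z j y| <= c) -> measurable (bad Z t).
  by move=> mZ Zc; apply: measurable_ltset => //; apply: bmf_measurable; exact: mS.
pose W y := \prod_j f j (tnth y j).
have bW : bmf W := bmf_prod_density.
have W0 y : 0 <= W y by apply: prodr_ge0.
have EW : Ex (iid Q J) W = 1.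
  by rewrite (@Ex_iid_prod _ _ _ Q J f bf) big1.
have b1 := bmf_indic R (mbad Z1 t1 mZ1 Z1c).
have b2 := bmf_indic R (mbad Z2 t2 mZ2 Z2c).
have b3 := bmf_indic R (mbad Z3 t3 mZ3 Z3c).
have bD := bmf_indic R mD.
pose r := expR (t1 + J%:R * del).
have key y : W y <= W y * \1_(bad Z1 t1) y + W y * \1_(bad Z2 t2) y +
    W y * \1_(bad Z3 t3) y + r * \1_D y.
  have i0 (S : set (J.-tuple Y)) : 0 <= \1_S y :> R by rewrite indicE.
  have r0 : 0 <= r by exact: expR_ge0.
  have [h1|/negP h1] := boolP (t1 + J%:R * del < \sum_j Z1 j (tnth y j)).
    have -> : \1_(bad Z1 t1) y = 1 :> R by rewrite indicE mem_set.
    by rewrite mulr1 -!addrA lerDl !addr_ge0 ?mulr_ge0.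
  have [h2|/negP h2] := boolP (t2 + J%:R * del < \sum_j Z2 j (tnth y j)).
    have -> : \1_(bad Z2 t2) y = 1 :> R by rewrite indicE mem_set.
    by rewrite mulr1 -!addrA addrCA lerDl !addr_ge0 ?mulr_ge0.
  have [h3|/negP h3] := boolP (t3 + J%:R * del < \sum_j Z3 j (tnth y j)).
    have -> : \1_(bad Z3 t3) y = 1 :> R by rewrite indicE mem_set.
    by rewrite mulr1 -addrA addrCA lerDl !addr_ge0 ?mulr_ge0.
  move: h1 h2 h3 => /negP; rewrite -leNgt => h1 /negP; rewrite -leNgt => h2 /negP.
  rewrite -leNgt => h3.
  have -> : \1_D y = 1 :> R by rewrite indicE mem_set.
  rewrite mulr1 ler_wpDl// ?addr_ge0 ?mulr_ge0//.
  rewrite /W (eq_bigr (fun j => expR (Z1 j (tnth y j)))) -?expR_sum ?ler_expR//.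
have : 1 <= 1 / 6 + 1 / 6 + 1 / 6 + r * Ex (iid Q J) \1_D.
  rewrite -[leLHS]EW; apply: le_trans (le_Ex _ bW _ key) _.
    by do ?apply: bmfD; [exact: bmfM|exact: bmfM|exact: bmfM|exact: bmfZ].
  rewrite ExD; [|by do ?apply: bmfD; exact: bmfM|exact: bmfZ].
  rewrite ExD; [|by do ?apply: bmfD; exact: bmfM|exact: bmfM].
  rewrite ExD; [|exact: bmfM|exact: bmfM].
  rewrite ExZ// lerD2r; apply: lerD; first by apply: lerD; exact: chernoff_opt.
  exact: chernoff_opt.
rewrite expRN -/r => h; rewrite ler_pdivrMr// -[leLHS]mulr1.
by rewrite ler_pdivrMl ?expR_gt0//; lra.
Qed.

End small_ball.

End chernoff.

(** * Distortion and log-mass as sums over letters *)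

Section additive_functionals.
Context (R : realType) dA dB (A : measurableType dA) (B : measurableType dB).
Variables (rho : A * B -> R) (M : B -> R).

Definition rsum n (x : n.-tuple A) (y : n.-tuple B) :=
  \sum_i rho (tnth x i, tnth y i).

Definition lsum n (y : n.-tuple B) := \sum_i ln (M (tnth y i)).

Hypotheses (mrho : measurable_fun setT rho) (rho0 : forall p, 0 <= rho p).
Hypotheses (mM : measurable_fun setT M) (M0 : forall y, 0 < M y).
Variables (rmax L : R).
Hypotheses (rho_le : forall p, rho p <= rmax) (lnM_le : forall y, `|ln (M y)| <= L).

Lemma bmf_rho : bmf rho.
Proof. by apply: (bmf_itv mrho (a := 0) (b := rmax)) => p; rewrite rho0 rho_le. Qed.

Lemma bmf_lnM : bmf (fun y => ln (M y)).
Proof. by split; [apply: measurableT_comp => //; exact: measurable_ln|exists L]. Qed.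

Lemma bmf_rsum n : bmf (fun z : n.-tuple A * n.-tuple B => rsum z.1 z.2).
Proof.
apply: bmf_sum => i; apply: (bmf_comp bmf_rho).
apply: measurable_fun_pair.
  by apply: (measurableT_comp (measurable_tnth i)).
by apply: (measurableT_comp (measurable_tnth i)).
Qed.

Lemma bmf_lsum n : bmf (@lsum n).
Proof. by apply: bmf_sum => i; apply: (bmf_comp bmf_lnM); exact: measurable_tnth. Qed.

Lemma rsum_ge0 n (x : n.-tuple A) (y : n.-tuple B) : 0 <= rsum x y.
Proof. exact: sumr_ge0. Qed.

Lemma prodM_expR n (y : n.-tuple B) : \prod_i M (tnth y i) = expR (lsum y).
Proof. by rewrite expR_sum; apply: eq_bigr => i _; rewrite lnK// posrE. Qed.

Lemma Mn_image_le (Y : eqType) n (g : Y -> n.-tuple B) (s : seq Y) (t : R) :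
  (forall y, y \in s -> lsum (g y) <= t) ->
  Mn M [set g y | y in [set` s]] <= (size s)%:R * expR t.
Proof.
move=> gt; have -> : [set g y | y in [set` s]] = [set` undup (map g s)].
  apply/seteqP; split => [_ [y /= ys <-]|z /=].
    by rewrite mem_undup; exact: map_f.
  by rewrite mem_undup => /mapP[y ys ->]; exists y.
rewrite /Mn -fsbig_seq ?undup_uniq//.
apply: (@le_trans _ _ (\sum_(z <- undup (map g s)) expR t)).
  rewrite big_seq [leRHS]big_seq; apply: ler_sum => z.
  rewrite mem_undup => /mapP[y ys ->].
  by rewrite prodM_expR ler_expR gt.
rewrite big_const_seq count_predT iter_addr_0 -[leLHS]mulr_natl.
by rewrite ler_wpM2r ?expR_ge0// ler_nat (leq_trans (size_undup _))// size_map.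
Qed.

End additive_functionals.

(** * Placing blocks inside a longer word *)

Section placement.
Context (T : Type) (J k n : nat) (h : 'I_J * 'I_k -> 'I_n) (b0 : T).

(** The letter [b0] fills the positions skipped between runs and the tail of the word; their number
    stays bounded as [n] grows, so a crude bound on their cost is enough. *)
Definition place (y : J.-tuple (k.-tuple T)) : n.-tuple T :=
  [tuple if [pick p | h p == i] is Some p then tnth (tnth y p.1) p.2 else b0 | i < n].

Hypothesis injh : injective h.

Lemma tnth_place y p : tnth (place y) (h p) = tnth (tnth y p.1) p.2.
Proof.
rewrite tnth_mktuple; case: pickP => [p' /eqP/injh->//|/(_ p)].
by rewrite eqxx.
Qed.

Lemma sum_place_le (R : realType) (F : 'I_n -> R) c : (forall i, F i <= c) ->
  \sum_i F i <= \sum_j \sum_l F (h (j, l)) + (n - J * k)%:R * c.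
Proof.
move=> Fc; rewrite (bigID [in codom h])/=; apply: lerD.
  have Uh : uniq (codom h) by rewrite map_inj_uniq ?enum_uniq.
  rewrite -big_uniq// big_image pair_big/= le_eqVlt; apply/orP; left; apply/eqP.
  by apply: eq_big => // -[j l].
apply: (@le_trans _ _ (\sum_(i in [predC codom h]) c)).
  by apply: ler_sum => i _; exact: Fc.
rewrite sumr_const; have := cardC [in codom h].
rewrite card_codom// card_prod !card_ord => /(congr1 (subn^~ (J * k)%N))/=.
by rewrite addKn => ->; rewrite mulr_natl.
Qed.

End placement.

(* The [k * m] blocks of length [k] come in [k] runs of [m] consecutive blocks;
   one letter is skipped between two runs, so that the [t]-th run starts at a
   position congruent to [t] modulo [k]. *)
Definition block_start k m j := (j * k + j %/ m)%N.

(** The skipped letters move the last run by at most [k - 1] positions, whence the room [k] besides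
    the [k * m * k] letters of the blocks. *)
Lemma block_start_lt k m n (j : 'I_(k * m)) (l : 'I_k) : (k + k * m * k <= n)%N ->
  (block_start k m j + l < n)%N.
Proof.
move=> kn; apply: leq_trans kn; rewrite /block_start.
have m0 : (0 < m)%N by case: m j => // -[j]; rewrite muln0.
have : (j %/ m < k)%N by rewrite ltn_divLR.
have : (j.+1 * k <= k * m * k)%N by rewrite leq_mul2r ltn_ord orbT.
by have := ltn_ord l; lia.
Qed.

Definition block_pos k m n (kn : (k + k * m * k <= n)%N) (p : 'I_(k * m) * 'I_k) : 'I_n :=
  Ordinal (block_start_lt p.1 p.2 kn).

Lemma block_pos_inj k m n (kn : (k + k * m * k <= n)%N) : injective (block_pos kn).
Proof.
have step (i j : nat) (l l' : 'I_k) : (i < j)%N ->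
    (block_start k m i + l < block_start k m j + l')%N.
  move=> ij; have := leq_div2r m (ltnW ij).
  have : (i.+1 * k <= j * k)%N by rewrite leq_mul2r ij orbT.
  by have := ltn_ord l; rewrite /block_start; lia.
move=> [i l] [j l'] /(congr1 val)/= E.
have ij : i = j.
  apply/val_inj; case: (ltngtP i j) => // [/(step _ _ l l')|/(step _ _ l' l)];
  by rewrite E ltnn.
by move: E; rewrite ij => /addnI/val_inj->.
Qed.

(** * The code *)

(** Integrated for a density [t], this is the nonnegativity of relative entropy, and it is used in
    that role below. *)
Lemma mul_ln_ge (R : realType) (t : R) : 0 < t -> t - 1 <= t * ln t.
Proof.
move=> t0; have := expR_ge1Dx (- ln t); rewrite expRN lnK ?posrE// => h.
have : t * (1 - ln t) <= t * t^-1 by rewrite ler_pM2l.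
by rewrite divff ?gt_eqF//; lra.
Qed.

Section codebook.
Context (R : realType) dA dB (A : measurableType dA) (B : measurableType dB).
Variables (rho : A * B -> R) (M : B -> R) (P : probability (seqspace A) R).
Hypotheses (mrho : measurable_fun setT rho) (rho0 : forall p, 0 <= rho p).
Hypotheses (mM : measurable_fun setT M) (M0 : forall y, 0 < M y).
Variables (rmax L : R).
Hypotheses (rho_le : forall p, rho p <= rmax) (lnM_le : forall y, `|ln (M y)| <= L).
Hypotheses (presP : measure_preserving P (@Defs.shift _ A))
           (ergP : ergodic_map P (@Defs.shift _ A)).
Variables (k : nat) (k0 : (0 < k)%N) (Q : probability (k.-tuple B) R).
Variables (f : k.-tuple A * k.-tuple B -> R) (a b : R).
Hypotheses (mf : measurable_fun setT f) (a0 : 0 < a) (fab : forall z, a <= f z <= b).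
Hypothesis f1 : forall x, Ex Q (fun y => f (x, y)) = 1.

Local Notation XY := (k.-tuple A * k.-tuple B)%type.

(** Expectation under the joint law of a source block and its random codeword. For [Z = ln f] it is
    the relative entropy of that joint law with respect to the product of [P_k] and [Q]; [Q] may
    differ from the output law, so this can exceed the mutual information. *)
Definition channel_mean (Z : XY -> R) : R :=
  Ex (law P (measurable_window 0 k) \x Q)%E (fun z => f z * Z z).

Definition channel_cond_mean (Z : XY -> R) (x : k.-tuple A) : R :=
  Ex Q (fun y => f (x, y) * Z (x, y)).

Let bf : bmf f. Proof. exact: bmf_itv mf fab. Qed.

Let f_gt0 z : 0 < f z. Proof. by have /andP[? _] := fab z; exact: lt_le_trans a0 _. Qed.

Lemma bmf_channel_cond_mean Z : bmf Z -> bmf (channel_cond_mean Z).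
Proof. by move=> bZ; exact: (@bmf_Ex_snd _ _ _ _ _ Q (fun z => f z * Z z) (bmfM bf bZ)). Qed.

Lemma channel_meanE Z : bmf Z ->
  channel_mean Z = Ex P (fun w => channel_cond_mean Z (window 0 k w)).
Proof.
move=> bZ; rewrite /channel_mean Ex_prod1; last exact: bmfM.
by rewrite Ex_law//; exact: bmf_channel_cond_mean.
Qed.

Lemma channel_mean_ln_ge0 : 0 <= channel_mean (fun z => ln (f z)).
Proof.
have bl := bmf_ln bf a0 fab.
rewrite channel_meanE//; apply: Ex_ge0 => w; rewrite /channel_cond_mean.
have <- : Ex Q (fun y => f (window 0 k w, y) - 1) = 0.
  by rewrite ExB ?Ex_cst ?f1 ?subrr//; exact: bmf_curry.
apply: le_Ex => [||y]; last exact: mul_ln_ge.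
- by apply: bmfB => //; exact: bmf_curry.
- exact: (bmf_curry (bmfM bf bl) _).
Qed.

Lemma block_average_ae Z e : bmf Z -> 0 < e ->
  {ae P, forall w, \forall m \near \oo,
    \sum_(j < k * m) channel_cond_mean Z (window (block_start k m j) k w)
      <= (k * m)%:R * (channel_mean Z + e)}.
Proof.
move=> bZ e0; rewrite channel_meanE//.
have bphi : bmf (fun w => channel_cond_mean Z (window 0 k w)).
  by apply: (bmf_comp (bmf_channel_cond_mean bZ)); exact: measurable_window.
have := segment_average presP ergP k0 bphi.
apply: filterS => w /cvgrPdist_le/(_ _ e0)[N _ HN].
exists (maxn 1 N) => // m; rewrite /= geq_max => /andP[m0 Nm].
have := HN m Nm; rewrite ler_norml => /andP[+ _].
set s := \sum_(j < _) _; set s' := \sum_(j < _) _.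
have -> : s = s' by apply: eq_bigr => j _; rewrite [in RHS]window_shift.
have J0 : 0 < (k * m)%:R :> R by rewrite ltr0n muln_gt0 k0.
set E := Ex P _ => h; rewrite mulrC -ler_pdivrMr//.
by move: h; set r := s' / _; lra.
Qed.

Section fixed_length.
Variables (n m : nat).
Local Notation J := (k * m)%N.
Variables (c del : R).
Hypotheses (c0 : 0 < c) (del0 : 0 < del) (delc : del <= 2 * c).
Hypothesis large_J : expR (- (J%:R * (del ^+ 2 / (8 * c ^+ 2)))) <= 1 / 6.

Local Notation Z1 := (fun z : XY => ln (f z)).
Local Notation Z2 := (fun z : XY => rsum rho z.1 z.2).
Local Notation Z3 := (fun z : XY => lsum M z.2).

Hypotheses (Z1c : forall z, `|Z1 z| <= c) (Z2c : forall z, `|Z2 z| <= c)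
  (Z3c : forall z, `|Z3 z| <= c).

(** One-sided, since only an excess of information, distortion or mass does harm. *)
Definition typical (Z : XY -> R) : set (seqspace A) :=
  [set w | \sum_(j < J) channel_cond_mean Z (window (block_start k m j) k w)
    <= J%:R * (channel_mean Z + del)].

Lemma measurable_typical Z : bmf Z -> measurable (typical Z).
Proof.
move=> bZ; apply: measurable_leset => //; apply: bmf_measurable.
apply: bmf_sum => j; apply: (bmf_comp (bmf_channel_cond_mean bZ)).
exact: measurable_window.
Qed.

(** The inner [del] allows for the source word (typicality), the outer one for the codeword given
    the source word (Chernoff). The bound on [lsum] is included so that greedily chosen codewords
    have controlled mass. *)
Definition covers (z : seqspace A * J.-tuple (k.-tuple B)) : Prop :=
  \sum_(j < J) rsum rho (window (block_start k m j) k z.1) (tnth z.2 j)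
    <= J%:R * (channel_mean Z2 + del) + J%:R * del /\
  \sum_(j < J) lsum M (tnth z.2 j)
    <= J%:R * (channel_mean Z3 + del) + J%:R * del.

Let bZ1 : bmf Z1. Proof. exact: bmf_ln bf a0 fab. Qed.
Let bZ2 : bmf Z2. Proof. exact: (bmf_rsum mrho rho0 rho_le). Qed.
Let bZ3 : bmf Z3.
Proof. by apply: (bmf_comp (bmf_lsum mM lnM_le k)). Qed.

Lemma measurable_covers : measurable [set z | covers z].
Proof.
apply: measurableI; apply: measurable_leset => //; apply: bmf_measurable;
  apply: bmf_sum => j.
- apply: (bmf_comp bZ2 (g := fun z : seqspace A * J.-tuple (k.-tuple B) =>
    (window (block_start k m j) k z.1, tnth z.2 j))).
  apply: measurable_fun_pair.
    by apply: (measurableT_comp (measurable_window (block_start k m j) k)).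
  by apply: (measurableT_comp (measurable_tnth j)).
- apply: (bmf_comp (bmf_lsum mM lnM_le k)
    (g := fun z : seqspace A * J.-tuple (k.-tuple B) => tnth z.2 j)).
  by apply: (measurableT_comp (measurable_tnth j)).
Qed.

Local Notation I := (channel_mean Z1).

(** [small_ball] gives each typical source word a ball of probability at least
    [q0 = expR (- tt) / 2], with [tt] equal to [J * (I + 2 * del)], and [greedy_cover] does the
    rest. The set [U] collects the typical words left uncovered. *)
Lemma codebook_exists : exists (s : seq (J.-tuple (k.-tuple B))) (U : set (seqspace A)),
  [/\ measurable U, Ex P \1_U <= expR (- (del * n%:R)),
    (size s)%:R <= expR (4 + J%:R * (I + 2 * del) + del * n%:R),
    forall y, y \in s ->
      \sum_(j < J) lsum M (tnth y j) <= J%:R * (channel_mean Z3 + 2 * del) &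
    forall w, typical Z1 w -> typical Z2 w -> typical Z3 w -> ~ U w ->
      exists2 y, y \in s &
        \sum_(j < J) rsum rho (window (block_start k m j) k w) (tnth y j)
          <= J%:R * (channel_mean Z2 + 2 * del)].
Proof.
have I0 : 0 <= I := channel_mean_ln_ge0.
have del_gt0 := del0.
set G := typical Z1 `&` typical Z2 `&` typical Z3.
have mG : measurable G.
  by apply: measurableI; [apply: measurableI|]; exact: measurable_typical.
have [tt ttE] : exists tt, tt = J%:R * (I + del) + J%:R * del.
  by exists (J%:R * (I + del) + J%:R * del).
have tt0 : 0 <= tt by rewrite ttE -mulrDr mulr_ge0//; lra.
have [q0 q0E] : exists q0, q0 = expR (- tt) / 2 by exists (expR (- tt) / 2).
have [q qE] : exists q, q = q0 / 2 by exists (q0 / 2).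
have q00 : 0 < q0 by rewrite q0E divr_gt0// expR_gt0.
have q1 : q <= 1.
  have : expR (- tt) <= 1 by rewrite -[leRHS]expR0 ler_expR oppr_le0.
  by rewrite qE q0E; lra.
have ball w : G w -> q0 <= Ex (iid Q J) (fun y => \1_[set z | covers z] (w, y)).
  rewrite q0E ttE.
  move=> [[g1 g2] g3].
  pose X (j : 'I_J) := window (block_start k m j) k w.
  have fE j y : f (X j, y) = expR (Z1 (X j, y)) by rewrite lnK// posrE.
  exact: (@small_ball _ _ _ Q J (fun j y => f (X j, y)) (fun j => bmf_curry bf _)
    (fun j y => ltW (f_gt0 _)) (fun j => f1 _) c _ _ _ del c0 del0 delc large_J
    (fun j y => Z1 (X j, y)) (fun j y => Z2 (X j, y)) (fun j y => Z3 (X j, y))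
    fE
    (fun j => bmf_measurable (bmf_curry bZ1 (X j))) (fun j y => Z1c _)
    (fun j => bmf_measurable (bmf_curry bZ2 (X j))) (fun j y => Z2c _)
    (fun j => bmf_measurable (bmf_curry bZ3 (X j))) (fun j y => Z3c (X j, y))
    g1 g2 g3).
(* As [q = expR (- tt) / 4], this gives [q * N >= expR (del * n%:R) >= del * n%:R], and
   [(1 - q) ^+ N <= expR (- (q * N))] is as small as claimed. *)
pose N := (Num.truncn (4 * expR (tt + del * n%:R))).+1.
have q_gt0 : 0 < q by rewrite qE divr_gt0.
have [|s [sN sC sU]] := greedy_cover P measurable_covers mG q_gt0 _ q1 ball N.
  by rewrite qE; lra.
exists s, (uncovered [set z | covers z] G s); split.
- exact: measurable_uncovered measurable_covers mG s.
- apply: (le_trans sU).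
  apply: (@le_trans _ _ (expR (- q) ^+ N)).
    rewrite lerXn2r ?nnegrE ?subr_ge0 ?expR_ge0//.
    exact: expR_ge1Dx.
  rewrite -expRM_natl ler_expR mulrN lerN2.
  have : q * (4 * expR (tt + del * n%:R)) <= N%:R * q.
    by rewrite mulrC ler_pM2r// ltW// truncnS_gt.
  apply: le_trans.
  have -> : q * (4 * expR (tt + del * n%:R)) = expR (del * n%:R).
    rewrite qE q0E expRD; have : expR (- tt) * expR tt = 1.
      by rewrite expRN mulVf// gt_eqF// expR_gt0.
    by move=> h; transitivity (expR (- tt) * expR tt * expR (del * n%:R)); [field|rewrite h mul1r].
  by apply: le_trans (expR_ge1Dx _); rewrite lerDr.
- apply: (@le_trans _ _ (N%:R)); first by rewrite ler_nat.
  have e1 : 1 <= expR (tt + del * n%:R).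
    by rewrite -[leLHS]expR0 ler_expR addr_ge0// mulr_ge0// ltW.
  have -> : 4 + J%:R * (I + 2 * del) + del * n%:R = 4 + (tt + del * n%:R).
    by rewrite ttE; ring.
  (* The factor [4] in [N] and its rounding up by one are absorbed together:
     [N <= 4 * u + 1 <= 5 * u] for [u >= 1]. This is the origin of the [4] in the exponent. *)
  have e4 : 5 <= expR 4 :> R by have := expR_ge1Dx (4 : R); lra.
  have trle : (Num.truncn (4 * expR (tt + del * n%:R)))%:R <= 4 * expR (tt + del * n%:R).
    by rewrite truncn_le mulr_ge0// expR_ge0.
  rewrite /N -natr1 [leRHS]expRD; move: e1 trle.
  set tr := (Num.truncn _)%:R; set u := expR (tt + _); move: tr u => tr u u1 trle.
  have : 5 * u <= expR 4 * u by rewrite ler_wpM2r// (le_trans ler01).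
  lra.
(* A chosen codeword covers some word [w], and the mass bound in [covers] does not depend on [w]. *)
- by move=> y /sC[w [_]] /=; move: (\sum_(_ < _) _) => u; lra.
- move=> w g1 g2 g3 nU.
  have : exists2 y, y \in s & covers (w, y).
    apply: contrapT => nex; apply: nU; split; first by [].
    by move=> y ys yw; apply: nex; exists y.
  move=> [y ys [h _]]; exists y => //; move: h => /=.
  by move: (\sum_(_ < _) _) => u; lra.
Qed.

End fixed_length.

End codebook.

(** Six times [del * n] are spent: four on the two deviations [2 * del] over [J <= n] blocks, one on
    the enlarged codebook, and one on the constant [4] and the [g <= K2] letters outside the
    blocks. *)
Lemma code_rate_le (R : realFieldType) (J n g k K2 I E3 v L rmax del eps : R) :
  n = J * k + g -> 0 <= g -> g <= K2 -> 0 <= J -> J <= n -> I + E3 <= k * v ->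
  4 + K2 * (L + `|v| + rmax) <= del * n -> 6 * del <= eps -> 0 < del ->
  0 <= L -> 0 <= rmax ->
  4 + J * (I + 2 * del) + del * n + (J * (E3 + 2 * del) + g * L) <= n * (v + eps).
Proof.
move=> nE g0 gK J0 Jn IE large de d0 L0 r0.
have h1 : J * (I + E3) <= J * (k * v) by apply: ler_wpM2l.
have h2 : g * L <= K2 * L by apply: ler_wpM2r.
have h3 : - (g * v) <= K2 * `|v|.
  rewrite -mulrN (le_trans (ler_wpM2l g0 (ler_norm (- v))))// normrN.
  by apply: ler_wpM2r.
have h4 : 0 <= K2 * rmax by rewrite mulr_ge0// (le_trans g0).
have h5 : J * del <= n * del by apply: ler_wpM2r => //; exact: ltW.
have h6 : n * (6 * del) <= n * eps by apply: ler_wpM2l => //; exact: le_trans Jn.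
have h7 : J * (k * v) = n * v - g * v by rewrite nE; ring.
move: large; lra.
Qed.

(** Of the reserve [3 * del], two parts go to the deviation [2 * del] per block and one to the [g]
    letters outside the blocks. Since [E2 >= 0], the number [D - 3 * del] is nonnegative and may be
    counted for those letters as well. *)
Lemma code_dist_le (R : realFieldType) (J n g k K2 E2 D v L rmax del : R) :
  n = J * k + g -> 0 <= g -> g <= K2 -> 0 <= J -> J <= n -> 0 < k ->
  0 <= E2 -> E2 <= k * (D - 3 * del) ->
  4 + K2 * (L + v + rmax) <= del * n -> 0 < del -> 0 <= v -> 0 <= L -> 0 <= rmax ->
  J * (E2 + 2 * del) + g * rmax <= n * D.
Proof.
move=> nE g0 gK J0 Jn k0 E20 E2D large d0 v0 L0 r0.
have K20 := le_trans g0 gK.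
have D0 : 0 <= D - 3 * del by rewrite -(pmulr_rge0 _ k0) (le_trans E20).
have h1 : J * E2 <= J * (k * (D - 3 * del)) by apply: ler_wpM2l.
have h2 : g * rmax <= K2 * rmax by apply: ler_wpM2r.
have h3 : 0 <= K2 * L by rewrite mulr_ge0.
have h4 : 0 <= K2 * v by rewrite mulr_ge0.
have h5 : J * del <= n * del by apply: ler_wpM2r => //; exact: ltW.
have h6 : J * (k * (D - 3 * del)) = (n - g) * (D - 3 * del) by rewrite nE; ring.
have h7 : 0 <= g * (D - 3 * del) by rewrite mulr_ge0.
move: large; lra.
Qed.

Lemma borel_cantelli_geometric (R : realType) d (T : measurableType d)
    (P : probability T R) (U : nat -> set T) (K z : R) :
  0 <= z < 1 -> (forall n, measurable (U n)) ->
  (forall n, (P (U n) <= (K * z ^+ n)%:E)%E) ->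
  {ae P, forall w, \forall n \near \oo, ~ U n w}.
Proof.
move=> /andP[z0 z1] mU PU.
have P0 : P (lim_sup_set U) = 0%E.
  apply: lim_sup_set_cvg0 => //.
  apply: (@le_lt_trans _ _ (\sum_(n <oo) (K * z ^+ n)%:E)%E).
    by apply: lee_nneseries => n; [move=> _ _; exact: measure_ge0|move=> _; exact: PU].
  rewrite (_ : (\sum_(n <oo) _)%E = (K * (1 - z)^-1)%:E) ?ltry//.
  apply/cvg_lim => //.
  rewrite (_ : (fun n => _) = EFin \o series (geometric K z)).
    apply: cvg_EFin; first exact: nearW.
    by apply: cvg_geometric_series; rewrite ger0_norm.
  by apply/funext => n; rewrite /= /series/= sumEFin.
exists (lim_sup_set U); split => //.
  by apply: bigcapT_measurable => n; exact: bigcup_measurable.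
move=> w /= nw N _; apply: contrapT => nN; apply: nw; exists N => // n /= Nn Uw.
by apply: nN; exists n.
Qed.

Lemma scaled_elog_le (R : realType) (n : nat) (x t : R) : (0 < n)%N ->
  x <= expR (n%:R * t) -> ((n%:R^-1)%:E * elog x <= t%:E)%E.
Proof.
move=> n0 xt; have n1 : 0 < n%:R^-1 :> R by rewrite invr_gt0 ltr0n.
rewrite /elog; case: (leP x 0) => [_|x0]; first by rewrite gt0_muleNy ?lte_fin// leNye.
rewrite -EFinM lee_fin ler_pdivrMl ?ltr0n//.
by rewrite -(expRK (n%:R * t)) ler_ln ?posrE// expR_gt0.
Qed.

Section coding_theorem.
Context (R : realType) dA dB (A : measurableType dA) (B : measurableType dB).
Variables (rho : A * B -> R) (M : B -> R) (P : probability (seqspace A) R).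
Hypotheses (mrho : measurable_fun setT rho) (rho0 : forall p, 0 <= rho p).
Hypotheses (mM : measurable_fun setT M) (M0 : forall y, 0 < M y).
Variables (rmax L : R).
Hypotheses (rho_le : forall p, rho p <= rmax) (lnM_le : forall y, `|ln (M y)| <= L).
Hypotheses (presP : measure_preserving P (@Defs.shift _ A))
           (ergP : ergodic_map P (@Defs.shift _ A)).
Variables (k : nat) (k0 : (0 < k)%N) (Q : probability (k.-tuple B) R).
Variables (f : k.-tuple A * k.-tuple B -> R) (a b : R).
Hypotheses (mf : measurable_fun setT f) (a0 : 0 < a) (fab : forall z, a <= f z <= b).
Hypothesis f1 : forall x, Ex Q (fun y => f (x, y)) = 1.
Variables (D v eps : R).

Local Notation XY := (k.-tuple A * k.-tuple B)%type.
Local Notation Z1 := (fun z : XY => ln (f z)).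
Local Notation Z2 := (fun z : XY => rsum rho z.1 z.2).
Local Notation Z3 := (fun z : XY => lsum M z.2).
Local Notation mean := (channel_mean P Q f).

Hypotheses (dist_lt : mean Z2 < k%:R * D) (rate_le : mean Z1 + mean Z3 <= k%:R * v).
Hypothesis eps0 : 0 < eps.

(** For [k <= n], the largest [m] such that [k] runs of [m] blocks and [k] spare letters fit into
    [n] letters. *)
Definition block_count n := ((n - k) %/ (k * k))%N.

Lemma block_count_room n : (k <= n)%N -> (k + k * block_count n * k <= n)%N.
Proof.
move=> kn; rewrite -[leqRHS](subnKC kn) leq_add2l mulnAC mulnC.
exact: leq_trunc_div.
Qed.

Lemma block_count_gap n : (n - k * block_count n * k <= k + k * k)%N.
Proof.
have : ((n - k) %% (k * k) < k * k)%N by rewrite ltn_mod muln_gt0 k0.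
have := divn_eq (n - k) (k * k); rewrite /block_count.
by rewrite mulnAC (mulnC (k * k)%N); lia.
Qed.

Lemma block_count_ge N n : (k + N * (k * k) <= n)%N -> (N <= block_count n)%N.
Proof. by move=> h; rewrite leq_divRL ?muln_gt0 ?k0//; lia. Qed.

Section fixed_length.
Variables (n : nat) (c del : R).
Hypotheses (c0 : 0 < c) (del0 : 0 < del) (delc : del <= 2 * c) (del_eps : 6 * del <= eps).
Hypothesis del_dist : mean Z2 <= k%:R * (D - 3 * del).
Hypotheses (Z1c : forall z, `|Z1 z| <= c) (Z2c : forall z, `|Z2 z| <= c)
  (Z3c : forall z, `|Z3 z| <= c).
Hypotheses (kn : (k <= n)%N)
  (n_large : 4 + (k + k * k)%:R * (L + `|v| + rmax) <= del * n%:R)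
  (J_large : 5 <= (k * block_count n)%:R * (del ^+ 2 / (8 * c ^+ 2))).

Local Notation m := (block_count n).
Local Notation J := (k * m)%N.

(** The block codewords are put at the aligned positions and [point] elsewhere. The at most
    [k + k * k] filler letters cost at most [L] each in log-mass and [rmax] each in distortion. *)
Lemma code_exists : exists (C : set (n.-tuple B)) (U : set (seqspace A)),
  [/\ finite_set C, Mn M C <= expR (n%:R * (v + eps)), measurable U,
    Ex P \1_U <= expR (- (del * n%:R)) &
    forall w, typical P Q f m del Z1 w -> typical P Q f m del Z2 w ->
      typical P Q f m del Z3 w -> ~ U w ->
      exists2 y, C y & rhon rho (window 0 n w) y <= D].
Proof.
have Jexp : expR (- (J%:R * (del ^+ 2 / (8 * c ^+ 2)))) <= 1 / 6.
  rewrite expRN div1r lef_pV2 ?posrE ?expR_gt0//.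
  by apply: le_trans (expR_ge1Dx _); move: J_large; lra.
have [s [U [mU EU sN sV sD]]] := codebook_exists P mrho rho0 mM rho_le lnM_le mf
  a0 fab f1 n c0 del0 delc Jexp Z1c Z2c Z3c.
have room := block_count_room kn.
pose h := block_pos room; have injh : injective h := @block_pos_inj _ _ _ room.
pose g := place h (point : B).
have L0 : 0 <= L := le_trans (normr_ge0 _) (lnM_le point).
have rmax0 : 0 <= rmax := le_trans (rho0 (point, point)) (rho_le _).
have n_gt0 : 0 < n%:R :> R by rewrite ltr0n (leq_trans k0).
have gapE : n%:R = J%:R * k%:R + (n - J * k)%:R :> R.
  by rewrite -natrM -natrD subnKC// (leq_trans _ room)// leq_addl.
have gap_le : (n - J * k)%:R <= (k + k * k)%:R :> R.
  by rewrite ler_nat block_count_gap.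
have gap0 : 0 <= (n - J * k)%:R :> R by [].
have k1 : 1 <= k%:R :> R by rewrite ler1n.
have Jr0 : 0 <= J%:R :> R by [].
have Jn : J%:R <= n%:R :> R.
  rewrite ler_nat (leq_trans _ (leq_trans (leq_addl k _) room))//.
  by rewrite leq_pmulr.
have E2 : 0 <= mean Z2.
  apply: Ex_ge0 => z; rewrite mulr_ge0 ?rsum_ge0//.
  by have /andP[? _] := fab z; rewrite (le_trans (ltW a0)).
have rate := code_rate_le gapE gap0 gap_le Jr0 Jn rate_le n_large del_eps del0 L0 rmax0.
have k_gt0 : 0 < k%:R :> R by rewrite ltr0n.
have dist := code_dist_le gapE gap0 gap_le Jr0 Jn k_gt0 E2 del_dist n_large del0
  (normr_ge0 _) L0 rmax0.
exists [set g y | y in [set` s]], U; split => //.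
- exact: finite_image (finite_seq _).
- apply: le_trans (_ : _ <= expR (4 + J%:R * (mean Z1 + 2 * del) + del * n%:R +
      (J%:R * (mean Z3 + 2 * del) + (n - J * k)%:R * L))) _; last by rewrite ler_expR.
  rewrite expRD; apply: le_trans (_ : _ <= (size s)%:R *
      expR (J%:R * (mean Z3 + 2 * del) + (n - J * k)%:R * L)) _.
    apply: (Mn_image_le M0) => y ys.
    apply: (le_trans (sum_place_le injh (c := L) _)) => [i|].
      by rewrite (le_trans (ler_norm _)).
    rewrite lerD2r; apply: le_trans (sV y ys).
    rewrite le_eqVlt; apply/orP; left; apply/eqP.
    apply: eq_bigr => j _; apply: eq_bigr => l _.
    by rewrite (tnth_place _ injh).
  by apply: ler_wpM2r => //; exact: expR_ge0.
- move=> w t1 t2 t3 nU; have [y ys yD] := sD w t1 t2 t3 nU.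
  exists (g y); first by exists y.
  rewrite /rhon ler_pdivrMl//; apply: le_trans dist.
  apply: (le_trans (sum_place_le injh (c := rmax) _)) => [i|]; first exact: rho_le.
  rewrite lerD2r; apply: le_trans yD.
  rewrite le_eqVlt; apply/orP; left; apply/eqP.
  apply: eq_bigr => j _; apply: eq_bigr => l _.
  by rewrite (tnth_place _ injh) !tnth_mktuple add0n.
Qed.

End fixed_length.
Theorem coding_theorem : exists C : forall n, set (n.-tuple B),
  [/\ forall n, finite_set (C n),
    forall n, (0 < n)%N ->
      ((n%:R^-1)%:E * elog (Mn M (C n)) <= (v + eps)%:E)%E &
    {ae P, forall w, \forall n \near \oo,
      exists2 y, C n y & rhon rho (window 0 n w) y <= D}].
Proof.
have bf : bmf f by exact: bmf_itv mf fab.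
have bZ1 : bmf Z1 by exact: bmf_ln bf a0 fab.
have bZ2 : bmf Z2 by exact: (bmf_rsum mrho rho0 rho_le).
have bZ3 : bmf Z3 by apply: (bmf_comp (bmf_lsum mM lnM_le k)).
have [c1 c10 Z1c] := bmf_bound bZ1; have [c2 c20 Z2c] := bmf_bound bZ2.
have [c3 c30 Z3c] := bmf_bound bZ3.
have [c [c0 c_ge1 Z1c' Z2c' Z3c']] : exists c, [/\ 0 < c, 1 <= c,
    forall z, `|Z1 z| <= c, forall z, `|Z2 z| <= c & forall z, `|Z3 z| <= c].
  (* The extra [1] makes [c >= 1], so that [del <= 1] implies the condition [del <= 2 * c] of the
     Chernoff bound. *)
  exists (c1 + c2 + c3 + 1); split; [by lra|by lra|..] => z.
  - by have := Z1c z; move: (`|_|) => u; lra.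
  - by have := Z2c z; move: (`|_|) => u; lra.
  - by have := Z3c z; move: (`|_|) => u; lra.
have k_gt0 : 0 < k%:R :> R by rewrite ltr0n.
have [del [del0 del1 del_eps del_dist]] : exists del, [/\ 0 < del, del <= 1,
    6 * del <= eps & mean Z2 <= k%:R * (D - 3 * del)].
  (* The last two entries are the rate budget [6 * del <= eps] and the distortion reserve [3 * del]
     per letter. *)
  exists (Num.min 1 (Num.min (eps / 6) ((k%:R * D - mean Z2) / (3 * k%:R)))).
  set x := (_ - _) / _.
  have x0 : 0 < x by rewrite divr_gt0 ?mulr_gt0 ?subr_gt0.
  have e0 : 0 < eps / 6 by rewrite divr_gt0.
  split.
  - by rewrite !lt_min ltr01 e0 x0.
  - by rewrite ge_min lexx.
  - by rewrite mulrC -ler_pdivlMr// !ge_min lexx orbT.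
  - set y := Num.min _ _.
    have : y <= x by rewrite !ge_min lexx !orbT.
    rewrite /x ler_pdivlMr ?mulr_gt0//; move: (mean Z2) => e.
    by clearbody y; move: y {x x0} => y; nra.
have delc : del <= 2 * c by lra.
pose W := 4 + (k + k * k)%:R * (L + `|v| + rmax).
pose kap := del ^+ 2 / (8 * c ^+ 2).
have kap0 : 0 < kap by rewrite divr_gt0 ?mulr_gt0 ?exprn_gt0.
pose N1 := (Num.truncn (5 / kap)).+1.
pose n0 := (k + N1 * (k * k) + (Num.truncn (W / del)).+1)%N.
have large n : (n0 <= n)%N -> [/\ (k <= n)%N, W <= del * n%:R &
    5 <= (k * block_count n)%:R * kap].
  move=> n0n; split.
  - by apply: leq_trans n0n; rewrite /n0 -addnA leq_addr.
  - rewrite mulrC -ler_pdivrMr// (le_trans (ltW (truncnS_gt _)))// ler_nat.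
    by rewrite (leq_trans _ n0n)// /n0 leq_addl.
  - rewrite -ler_pdivrMr// (le_trans (ltW (truncnS_gt _)))// ler_nat -/N1.
    have : (N1 <= block_count n)%N.
      by apply: block_count_ge; apply: leq_trans n0n; rewrite /n0 leq_addr.
    by move/leq_trans; apply; rewrite leq_pmull.
have code n : exists CU : set (n.-tuple B) * set (seqspace A),
  [/\ finite_set CU.1,
    (0 < n)%N -> ((n%:R^-1)%:E * elog (Mn M CU.1) <= (v + eps)%:E)%E,
    measurable CU.2,
    (P CU.2 <= (expR (del * n0%:R) * expR (- del) ^+ n)%:E)%E &
    (n0 <= n)%N -> forall w,
      typical P Q f (block_count n) del Z1 w ->
      typical P Q f (block_count n) del Z2 w ->
      typical P Q f (block_count n) del Z3 w -> ~ CU.2 w ->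
      exists2 y, CU.1 y & rhon rho (window 0 n w) y <= D].
  have Uexp : expR (del * n0%:R) * expR (- del) ^+ n =
      expR (del * n0%:R - del * n%:R) by rewrite -expRM_natl -expRD; congr expR; ring.
  have [n0n|nn0] := leqP n0 n.
    have [kn Wn Jn] := large n n0n.
    have [C [U [finC MC mU EU CD]]] := code_exists c0 del0 delc del_eps del_dist
      Z1c' Z2c' Z3c' kn Wn Jn.
    exists (C, U); split => //; first by move=> n_gt0; exact: scaled_elog_le.
    rewrite -Ex_indic// lee_fin (le_trans EU)// Uexp ler_expR lerDr.
    by rewrite mulr_ge0// ltW.
  (* Short lengths get the empty code, whose log-mass is [-oo]. The exceptional set is then
     everything, and the factor [expR (del * n0%:R)] keeps its probability bound at least [1]. *)
  exists (set0, setT); split => //.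
  - by move=> n_gt0; apply: scaled_elog_le => //; rewrite /Mn fsbig_set0 expR_ge0.
  - exact: measurableT.
  - rewrite /= probability_setT lee_fin Uexp -[leLHS]expR0 ler_expR -mulrBr.
    by rewrite mulr_ge0 ?(ltW del0)// subr_ge0 ler_nat ltnW.
pose CU n := projT1 (cid (code n)).
exists (fun n => (CU n).1); split.
- by move=> n; rewrite /CU; case: cid => /= x [].
- by move=> n n_gt0; rewrite /CU; case: cid => /= x [? /(_ n_gt0)].
have z01 : 0 <= expR (- del) < 1.
  by rewrite expR_ge0/= -[ltRHS]expR0 ltr_expR oppr_lt0.
have aeU : {ae P, forall w, \forall n \near \oo, ~ (CU n).2 w}.
  apply: (borel_cantelli_geometric z01 (K := expR (del * n0%:R))) => n;
  by rewrite /CU; case: cid => /= x [].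
have aeT Z : bmf Z -> {ae P, forall w, \forall n \near \oo,
    typical P Q f (block_count n) del Z w}.
  move=> bZ; have := block_average_ae presP ergP k0 Q mf fab bZ del0.
  apply: filterS => w [N _ HN]; exists (k + N * (k * k))%N => // n /= Nn.
  by apply: HN => /=; exact: block_count_ge.
have ae23 : {ae P, forall w,
    (\forall n \near \oo, typical P Q f (block_count n) del Z2 w) /\
    (\forall n \near \oo, typical P Q f (block_count n) del Z3 w)}.
  by move: (aeT _ bZ2) (aeT _ bZ3); apply: filterS2 => w; split.
move: aeU (aeT _ bZ1) ae23.
apply: filterS3 => w [N _ HU] [N1' _ H1] [[N2 _ H2] [N3 _ H3]].
exists (maxn n0 (maxn N (maxn N1' (maxn N2 N3)))) => // n /=.
rewrite !geq_max => /and5P[n0n Nn N1n N2n N3n].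
have [_ _ _ _] := projT2 (cid (code n)).
by move=> /(_ n0n w (H1 n N1n) (H2 n N2n) (H3 n N3n) (HU n Nn)).
Qed.

End coding_theorem.

(** * Bounded channels *)

Section channels.
Context (R : realType) dA dB (A : measurableType dA) (B : measurableType dB).
Variables (rho : A * B -> R) (M : B -> R) (P : probability (seqspace A) R).

Local Notation Z2 k := (fun z : k.-tuple A * k.-tuple B => rsum rho z.1 z.2).
Local Notation Z3 k := (fun z : k.-tuple A * k.-tuple B => lsum M z.2).

(* [f] is the density of a channel from [A^n] to [B^n] with respect to [Q]; being
   bounded away from [0] and infinity, it has a bounded logarithm. *)
Definition bounded_channel n (Q : probability (n.-tuple B) R)
    (f : n.-tuple A * n.-tuple B -> R) :=
  [/\ measurable_fun setT f,
    exists a b, 0 < a /\ forall z, a <= f z <= b &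
    forall x, Ex Q (fun y => f (x, y)) = 1].

(* The distortion [d] and the rate [v] are totals over the [n] letters. *)
Definition achievable n (d v : R) :=
  exists (Q : probability (n.-tuple B) R) (f : n.-tuple A * n.-tuple B -> R),
  [/\ bounded_channel Q f, channel_mean P Q f (Z2 n) <= d &
    channel_mean P Q f (fun z => ln (f z)) + channel_mean P Q f (Z3 n) <= v].

Lemma achievable_le n d d' v v' : d <= d' -> v <= v' ->
  achievable n d v -> achievable n d' v'.
Proof.
move=> dd' vv' [Q [f [cf fd fv]]]; exists Q, f; split => //.
  exact: le_trans dd'.
exact: le_trans vv'.
Qed.

Hypotheses (mrho : measurable_fun setT rho) (rho0 : forall p, 0 <= rho p).
Hypotheses (mM : measurable_fun setT M).
Variables (rmax L : R).
Hypotheses (rho_le : forall p, rho p <= rmax) (lnM_le : forall y, `|ln (M y)| <= L).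
Hypotheses (presP : measure_preserving P (@Defs.shift _ A)).

(** A fixed word is sent whatever the source: the density is [1] and no information is transmitted.
    This channel fills the letters left over when a length is divided into blocks. *)
Lemma achievable_constant n : achievable n (n%:R * rmax) (n%:R * L).
Proof.
exists \d_([tuple point | i < n]), (fun _ => 1); split.
- split; [exact: measurable_cst|by exists 1, 1; rewrite lexx|].
  by move=> x; rewrite Ex_cst.
- rewrite /channel_mean; under eq_Rintegral do rewrite mul1r.
  apply: Ex_le_cst => [|z]; first exact: (bmf_rsum mrho rho0 rho_le).
  rewrite /rsum -[X in X%:R * _]card_ord mulr_natl -sumr_const.
  exact: ler_sum.
- rewrite /channel_mean; under eq_Rintegral do rewrite ln1 mulr0.
  under [X in _ + X <= _]eq_Rintegral do rewrite mul1r.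
  rewrite Ex_cst add0r.
  apply: Ex_le_cst => [|z]; first by apply: (bmf_comp (bmf_lsum mM lnM_le n)).
  rewrite /lsum -[X in X%:R * _]card_ord mulr_natl -sumr_const.
  by apply: ler_sum => i _; exact: le_trans (ler_norm _) _.
Qed.

Section concatenation.
Variables (m n : nat).
Variables (Q : probability (m.-tuple B) R) (f : m.-tuple A * m.-tuple B -> R).
Variables (Q' : probability (n.-tuple B) R) (f' : n.-tuple A * n.-tuple B -> R).
Hypotheses (cf : bounded_channel Q f) (cf' : bounded_channel Q' f').

Definition cat_law : probability ((m + n).-tuple B) R :=
  law (Q \x Q')%E (@measurable_tcat _ B m n).

Definition pfst (z : (m + n).-tuple A * (m + n).-tuple B) := (tfst z.1, tfst z.2).
Definition psnd (z : (m + n).-tuple A * (m + n).-tuple B) := (tsnd z.1, tsnd z.2).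

Definition cat_density z := f (pfst z) * f' (psnd z).

Let mpfst : measurable_fun setT pfst.
Proof.
by apply: measurable_fun_pair; apply: (measurableT_comp (@measurable_tfst _ _ m n)).
Qed.

Let mpsnd : measurable_fun setT psnd.
Proof.
by apply: measurable_fun_pair; apply: (measurableT_comp (@measurable_tsnd _ _ m n)).
Qed.

Let bounds_channel k (Qk : probability (k.-tuple B) R) g :
  bounded_channel Qk g -> bmf g.
Proof. by move=> [mg [a [b [_ gab]]] _]; exact: bmf_itv mg gab. Qed.

Lemma Ex_cat_law (g : m.-tuple B -> R) (g' : n.-tuple B -> R) : bmf g -> bmf g' ->
  Ex cat_law (fun y => g (tfst y) * g' (tsnd y)) = Ex Q g * Ex Q' g'.
Proof.
move=> bg bg'.
have bgg : bmf (fun y : (m + n).-tuple B => g (tfst y) * g' (tsnd y)).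
  apply: bmfM; first by apply: (bmf_comp bg); exact: measurable_tfst.
  by apply: (bmf_comp bg'); exact: measurable_tsnd.
rewrite Ex_law// Ex_prod1; last first.
  by apply: (bmf_comp bgg); exact: measurable_tcat.
rewrite -ExZr//; apply: eq_Rintegral => y _; rewrite -ExZ//.
by apply: eq_Rintegral => y' _; rewrite tcat_tfst tcat_tsnd.
Qed.

Lemma cat_bounded_channel : bounded_channel cat_law cat_density.
Proof.
have bf := bounds_channel cf; have bf' := bounds_channel cf'.
have [_ [a [b [a0 fab]]] f1] := cf; have [_ [a' [b' [a'0 fab']]] f1'] := cf'.
split.
- by apply: measurable_funM;
    [apply: (measurableT_comp (bmf_measurable bf) mpfst)|
     apply: (measurableT_comp (bmf_measurable bf') mpsnd)].
- exists (a * a'), (b * b'); split; first exact: mulr_gt0.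
  move=> z; have /andP[h1 h2] := fab (pfst z); have /andP[h3 h4] := fab' (psnd z).
  have h5 := le_trans (ltW a0) h1; have h6 := le_trans (ltW a'0) h3.
  by apply/andP; split; apply: ler_pM => //; exact: ltW.
- move=> x; rewrite (Ex_cat_law (g := fun y => f (tfst x, y)) (g' := fun y => f' (tsnd x, y))).
  + by rewrite f1 f1' mul1r.
  + exact: bmf_curry.
  + exact: bmf_curry.
Qed.

(** Given the source word, the two halves of the codeword are independent, and the density of the
    other half integrates to [1]. Stationarity then brings the second source block back to the
    origin. Dependence between the two source blocks does no harm, as only conditional laws are
    multiplied. *)
Lemma cat_channel_mean (Z : m.-tuple A * m.-tuple B -> R)
    (Z' : n.-tuple A * n.-tuple B -> R) : bmf Z -> bmf Z' ->
  channel_mean P cat_law cat_density (fun z => Z (pfst z) + Z' (psnd z)) =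
  channel_mean P Q f Z + channel_mean P Q' f' Z'.
Proof.
move=> bZ bZ'; have [mh [a [b [a0 hab]]] h1] := cat_bounded_channel.
have bf := bounds_channel cf; have bf' := bounds_channel cf'.
have [mf [c [d [c0 fcd]]] f1] := cf; have [mf' [c' [d' [c'0 fcd']]] f1'] := cf'.
rewrite (channel_meanE P _ mh hab); last first.
  by apply: bmfD; [exact: (bmf_comp bZ)|exact: (bmf_comp bZ')].
rewrite (channel_meanE P _ mf fcd bZ) (channel_meanE P _ mf' fcd' bZ').
have bc := bmf_channel_cond_mean Q mf fcd bZ.
have bc' := bmf_channel_cond_mean Q' mf' fcd' bZ'.
have bw : bmf (fun w => channel_cond_mean Q f Z (window 0 m w)).
  by apply: (bmf_comp bc); exact: measurable_window.
have bw' : bmf (fun w => channel_cond_mean Q' f' Z' (window 0 n w)).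
  by apply: (bmf_comp bc'); exact: measurable_window.
rewrite -(Ex_preserving (measure_preserving_iter m presP) bw') -ExD//; last first.
  have [ms _] := measure_preserving_iter m presP.
  exact: (bmf_comp bw' ms).
apply: eq_Rintegral => w _; rewrite -window_shift.
have -> : window 0 m w = tfst (window 0 (m + n) w).
  by apply: eq_from_tnth => i; rewrite !tnth_mktuple.
have -> : window m n w = tsnd (window 0 (m + n) w).
  by apply: eq_from_tnth => i; rewrite !tnth_mktuple.
move: (window 0 (m + n) w) => x; rewrite /channel_cond_mean.
have cb k (g : k.-tuple A * k.-tuple B -> R) y : bmf g -> bmf (fun z => g (y, z)).
  by move=> bg; exact: bmf_curry.
have E1 := Ex_cat_law (cb _ _ (tfst x) (bmfM bf bZ)) (cb _ _ (tsnd x) bf').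
have E2 := Ex_cat_law (cb _ _ (tfst x) bf) (cb _ _ (tsnd x) (bmfM bf' bZ')).
rewrite f1' mulr1 in E1; rewrite f1 mul1r in E2.
rewrite -E1 -E2 -ExD.
- by apply: eq_Rintegral => y _; rewrite /cat_density /pfst /psnd/=; ring.
- apply: bmfM; first by apply: (bmf_comp (cb _ _ (tfst x) (bmfM bf bZ))); exact: measurable_tfst.
  by apply: (bmf_comp (cb _ _ (tsnd x) bf')); exact: measurable_tsnd.
- apply: bmfM; first by apply: (bmf_comp (cb _ _ (tfst x) bf)); exact: measurable_tfst.
  by apply: (bmf_comp (cb _ _ (tsnd x) (bmfM bf' bZ'))); exact: measurable_tsnd.
Qed.

End concatenation.

Lemma achievableD m n d1 d2 v1 v2 : achievable m d1 v1 -> achievable n d2 v2 ->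
  achievable (m + n) (d1 + d2) (v1 + v2).
Proof.
move=> [Q [f [cf fd fv]]] [Q' [f' [cf' fd' fv']]].
exists (cat_law Q Q'), (cat_density f f').
have [mf [a [b [a0 fab]]] f1] := cf; have [mf' [a' [b' [a'0 fab']]] f1'] := cf'.
have bf : bmf f by exact: bmf_itv mf fab.
have bf' : bmf f' by exact: bmf_itv mf' fab'.
have catE := cat_channel_mean cf cf'.
have b3 k : bmf (Z3 k) by apply: (bmf_comp (bmf_lsum mM lnM_le k)).
have b2 k : bmf (Z2 k) by exact: (bmf_rsum mrho rho0 rho_le).
split; first exact: cat_bounded_channel.
- have -> : channel_mean P (cat_law Q Q') (cat_density f f') (Z2 (m + n)) =
      channel_mean P Q f (Z2 m) + channel_mean P Q' f' (Z2 n).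
    rewrite -(catE _ _ (b2 m) (b2 n)); congr channel_mean.
    by apply/funext => z; rewrite /rsum big_split_ord; congr (_ + _);
      apply: eq_bigr => i _; rewrite !tnth_mktuple.
  exact: lerD.
- have -> : channel_mean P (cat_law Q Q') (cat_density f f') (Z3 (m + n)) =
      channel_mean P Q f (Z3 m) + channel_mean P Q' f' (Z3 n).
    rewrite -(catE _ _ (b3 m) (b3 n)); congr channel_mean.
    by apply/funext => z; rewrite /lsum big_split_ord; congr (_ + _);
      apply: eq_bigr => i _; rewrite !tnth_mktuple.
  have -> : channel_mean P (cat_law Q Q') (cat_density f f')
        (fun z => ln (cat_density f f' z)) =
      channel_mean P Q f (fun z => ln (f z)) + channel_mean P Q' f' (fun z => ln (f' z)).
    rewrite -(catE _ _ (bmf_ln bf a0 fab) (bmf_ln bf' a'0 fab')); congr channel_mean.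
    apply/funext => z; rewrite /cat_density lnM// posrE.
      by have /andP[/(lt_le_trans a0)] := fab (pfst z).
    by have /andP[/(lt_le_trans a'0)] := fab' (psnd z).
  by move: fv fv'; lra.
Qed.

Lemma achievableMn m d v q : achievable m d v ->
  achievable (q * m) (q%:R * d) (q%:R * v).
Proof.
move=> h; elim: q => [|q IH].
  by rewrite mul0n !mul0r; have := achievable_constant 0; rewrite !mul0r.
by rewrite mulSn -natr1 !mulrDl !mul1r !(addrC _ d) !(addrC _ v); exact: achievableD.
Qed.

End channels.

(** * Measures with densities *)

Section measures_with_density.
Context (R : realType) d (T : measurableType d).

Lemma ge0_integralD_EFin (mu : probability T R) (g h : T -> R) :
  measurable_fun setT g -> measurable_fun setT h ->
  (forall x, 0 <= g x) -> (forall x, 0 <= h x) ->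
  (\int[mu]_x (g x + h x)%:E = \int[mu]_x (g x)%:E + \int[mu]_x (h x)%:E)%E.
Proof.
move=> mg mh g0 h0; under eq_integral do rewrite EFinD.
by rewrite ge0_integralD// => [x _||x _|]; rewrite ?lee_fin//; exact/measurable_EFinP.
Qed.

(** Having the same integrals over all measurable sets, [g] and the Radon-Nikodym derivative agree
    almost everywhere, and the change of variables holds for the latter. *)
Lemma ge0_integral_density (mu nu : probability T R) (g : T -> R) :
  measurable_fun setT g -> (forall x, 0 <= g x) ->
  (forall S, measurable S -> nu S = \int[mu]_(x in S) (g x)%:E)%E ->
  forall h : T -> \bar R, (forall x, 0 <= h x)%E -> measurable_fun setT h ->
  (\int[nu]_x h x = \int[mu]_x (h x * (g x)%:E))%E.
Proof.
move=> mg g0 nuE h h0 mh.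
have mge : measurable_fun setT (EFin \o g) by exact/measurable_EFinP.
have dom : nu `<< mu.
  apply/null_content_dominatesP => S mS muS; rewrite nuE//.
  by apply: null_set_integral => //; exact: measurable_funTS.
have intg : mu.-integrable setT (EFin \o g).
  apply/integrableP; split => //; under eq_integral do rewrite gee0_abs ?lee_fin//=.
  by rewrite -nuE// -ge0_fin_numE ?fin_num_measure.
rewrite -(Radon_Nikodym_SigmaFinite.change_of_variables dom h0 measurableT mh).
set G := Radon_Nikodym_SigmaFinite.f nu mu.
have intG : mu.-integrable setT G := Radon_Nikodym_SigmaFinite.f_integrable dom.
have mG := measurable_int _ intG.
apply: ae_eq_integral => //; try exact: emeasurable_funM.
apply: ae_eqe_mul2l; apply: integral_ae_eq => // S _ mS.
transitivity (nu S); last exact: nuE.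
by apply/esym; exact: (Radon_Nikodym_SigmaFinite.f_integral dom).
Qed.

(** The nonnegative case is applied to [h + K]; the constant cancels because [g] has mean [1]. *)
Lemma Ex_density (mu nu : probability T R) (g : T -> R) :
  bmf g -> (forall x, 0 <= g x) ->
  (forall S, measurable S -> nu S = \int[mu]_(x in S) (g x)%:E)%E ->
  forall h : T -> R, bmf h -> Ex nu h = Ex mu (fun x => g x * h x).
Proof.
move=> bg g0 nuE h bh; have [K K0 hK] := bmf_bound bh.
have bhK : bmf (fun x => h x + K) by exact: bmfD.
have Eg : Ex mu g = 1.
  by apply: EFin_inj; rewrite -EFin_Ex// -nuE// probability_setT.
have hK0 x : 0 <= h x + K by have := hK x; rewrite ler_norml => /andP[]; lra.
have : Ex nu (fun x => h x + K) = Ex mu (fun x => g x * (h x + K)).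
  apply: EFin_inj; rewrite -!EFin_Ex//; last exact: bmfM.
  rewrite (ge0_integral_density (bmf_measurable bg) g0 nuE).
  - by apply: eq_integral => x _; rewrite -EFinM mulrC.
  - by move=> x; rewrite lee_fin.
  - by apply/measurable_EFinP; exact: bmf_measurable.
rewrite ExD// Ex_cst.
have -> : (fun x => g x * (h x + K)) = (fun x => g x * h x + g x * K).
  by apply/funext => x; rewrite mulrDr.
rewrite [in RHS]ExD; [|exact: bmfM|exact: bmfM].
by rewrite [in RHS]ExZr// Eg mul1r => /addIr.
Qed.

Lemma integral_indicE (mu : probability T R) (g : T -> R) (S : set T) :
  bmf g -> measurable S ->
  (\int[mu]_(x in S) (g x)%:E = (Ex mu (fun x => g x * \1_S x))%:E)%E.
Proof.
move=> bg mS; rewrite -EFin_Ex; last by apply: bmfM => //; exact: bmf_indic.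
rewrite integral_mkcond epatch_indic.
by apply: eq_integral => x _; rewrite /= EFinM.
Qed.

Lemma exists_density_probability (mu : probability T R) (g : T -> R) :
  bmf g -> (forall x, 0 <= g x) -> Ex mu g = 1 ->
  exists nu : probability T R,
    forall S, measurable S -> (nu S = \int[mu]_(x in S) (g x)%:E)%E.
Proof.
move=> bg g0 Eg.
pose W (S : set T) := (\int[mu]_(x in S) (g x)%:E)%E.
have W0 : W set0 = 0%E by rewrite /W integral_set0.
have Wge0 S : (0 <= W S)%E by apply: integral_ge0 => x _; rewrite lee_fin.
have Wsa : semi_sigma_additive W.
  apply: semi_sigma_additive_nng_induced => [|x]; last by rewrite lee_fin.
  by apply/measurable_EFinP; exact: bmf_measurable.
pose Wm : {measure set T -> \bar R} := HB.pack W (isMeasure.Build _ _ _ W W0 Wge0 Wsa).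
have W1 : Wm setT = 1%E by rewrite /= /W EFin_Ex// Eg.
pose Wp : probability T R := HB.pack (Measure.sort Wm) (Measure_isProbability.Build _ _ _ Wm W1).
by exists Wp.
Qed.

End measures_with_density.

(** * Bounded channels as upper bounds for the rate *)

Section rate_upper_bound.
Context (R : realType) dA dB (A : measurableType dA) (B : measurableType dB).
Variables (rho : A * B -> R) (M : B -> R) (P : probability (seqspace A) R).
Hypotheses (mrho : measurable_fun setT rho) (rho0 : forall p, 0 <= rho p).
Hypotheses (mM : measurable_fun setT M).
Variables (rmax L : R).
Hypotheses (rho_le : forall p, rho p <= rmax) (lnM_le : forall y, `|ln (M y)| <= L).

(** The reference law [Q] is in general not the output law of the channel, whereas couplings fix
    both marginals. The output law [Q'] has density [h] with respect to [Q], and the joint law has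
    density [f / h] with respect to the product with [Q']. Its relative entropy is the mean of
    [ln f] minus that of [Q'] with respect to [Q], hence no larger. *)
Lemma Rn_le_achievable n D v : (0 < n)%N -> achievable rho M P n (n%:R * D) v ->
  (Rn rho M (Pn P n) D <= v%:E)%E.
Proof.
move=> n0 [Q [f [[mf [a [b [a0 fab]]] f1] fd fv]]].
have bf : bmf f by exact: bmf_itv mf fab.
have f_gt0 z : 0 < f z by have /andP[/(lt_le_trans a0)] := fab z.
pose Px := law P (measurable_window 0 n); pose PQ := (Px \x Q)%E.
pose h y := Ex Px (fun x => f (x, y)).
have bh : bmf h by exact: bmf_Ex_fst.
have hab y : a <= h y <= b.
  apply/andP; split.
    by apply: Ex_ge_cst => [|x]; [exact: bmf_flip|have /andP[] := fab (x, y)].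
  by apply: Ex_le_cst => [|x]; [exact: bmf_flip|have /andP[] := fab (x, y)].
have h_gt0 y : 0 < h y by have /andP[/(lt_le_trans a0)] := hab y.
have EPQ : Ex PQ f = 1.
  rewrite Ex_prod1//; under eq_Rintegral do rewrite f1.
  by rewrite Ex_cst.
have Eh : Ex Q h = 1 by rewrite -[RHS]EPQ Ex_prod2.
have EPQ_snd g : bmf g -> Ex PQ (fun z => f z * g z.2) = Ex Q (fun y => h y * g y).
  move=> bg; rewrite Ex_prod2; last by apply: bmfM => //; exact: (bmf_comp bg).
  by apply: eq_Rintegral => y _; rewrite /= ExZr//; exact: bmf_flip.
have [W WE] := exists_density_probability bf (fun z => ltW (f_gt0 z)) EPQ.
have [Q' Q'E] := exists_density_probability bh (fun y => ltW (h_gt0 y)) Eh.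
have EW := Ex_density bf (fun z => ltW (f_gt0 z)) WE.
have EQ' := Ex_density bh (fun y => ltW (h_gt0 y)) Q'E.
have b2 : bmf (fun z : n.-tuple A * n.-tuple B => rsum rho z.1 z.2).
  exact: (bmf_rsum mrho rho0 rho_le).
have bl := bmf_lsum mM lnM_le n.
have cplW : couplings rho (Pn P n) Q' D W.
  split; [|split].
  - move=> S mS; have mSX : measurable (S `*` [set: n.-tuple B]) by exact: measurableX.
    rewrite -[LHS]Ex_indic//; transitivity (Px S) => //; rewrite -Ex_indic//; congr EFin.
    rewrite EW; last exact: bmf_indic.
    rewrite Ex_prod1; last by apply: bmfM => //; exact: bmf_indic.
    apply: eq_Rintegral => x _.
    transitivity (Ex Q (fun y => f (x, y) * \1_S x)).
      by apply: eq_Rintegral => y _; rewrite !indicE in_setX in_setT andbT.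
    by rewrite ExZr ?f1 ?mul1r//; exact: bmf_curry.
  - move=> S mS; have mSX : measurable ([set: n.-tuple A] `*` S) by exact: measurableX.
    rewrite -[LHS]Ex_indic// -[RHS]Ex_indic//; congr EFin.
    rewrite EW ?EQ'; [|exact: bmf_indic|exact: bmf_indic].
    rewrite -EPQ_snd; last exact: bmf_indic.
    by apply: eq_Rintegral => z _; rewrite !indicE /= in_setX in_setT.
  - have br : bmf (fun z : n.-tuple A * n.-tuple B => rhon rho z.1 z.2) by exact: bmfZ.
    rewrite EFin_Ex// lee_fin EW//.
    have -> : (fun z => f z * rhon rho z.1 z.2) =
        (fun z => n%:R^-1 * (f z * rsum rho z.1 z.2)).
      by apply/funext => z; rewrite /rhon mulrCA.
    rewrite ExZ; last exact: bmfM.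
    by rewrite ler_pdivrMl ?ltr0n//; exact: fd.
pose g (z : n.-tuple A * n.-tuple B) := f z / h z.2.
have lnh := bmf_ln bh a0 hab; have lnf := bmf_ln bf a0 fab.
have bhV : bmf (fun y => (h y)^-1).
  have -> : (fun y => (h y)^-1) = (fun y => expR (- ln (h y))).
    by apply/funext => y; rewrite expRN lnK ?posrE.
  by apply: bmf_expR; exact: bmfN.
have bhV2 : bmf (fun z : n.-tuple A * n.-tuple B => (h z.2)^-1) by exact: (bmf_comp bhV).
have bg : bmf g by exact: bmfM.
have g_gt0 z : 0 < g z by rewrite divr_gt0.
have dens : density W (Pn P n \x Q')%E g.
  split; first exact: bmf_measurable.
  split; first by move=> z; exact: ltW.
  move=> S mS; rewrite WE// (integral_indicE PQ bf mS).
  have := integral_indicE (Px \x Q')%E bg mS.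
  rewrite /Px => ->; congr EFin.
  have bS := bmf_indic R mS; have bgS := bmfM bg bS; have bfS := bmfM bf bS.
  rewrite [RHS](Ex_prod2 Px Q' bgS) (EQ' _ (bmf_Ex_fst Px bgS)) (Ex_prod2 Px Q bfS).
  apply: eq_Rintegral => y _; rewrite -(ExZ Px (h y) (bmf_flip bgS y)).
  apply: eq_Rintegral => x _.
  by rewrite /g /= [RHS]mulrA [h y * _]mulrC divfK// gt_eqF.
have rel : (relent W (Pn P n \x Q')%E <= (channel_mean P Q f (fun z => ln (f z)))%:E)%E.
  apply: (@le_trans _ _ (\int[W]_z elog (g z))%E).
    by apply: ereal_inf_lbound; exists g.
  have -> : (\int[W]_z elog (g z) = \int[W]_z (ln (f z) - ln (h z.2))%:E)%E.
    apply: eq_integral => z _; rewrite /elog leNgt g_gt0/= /g ln_div ?posrE//.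
  have blh2 : bmf (fun z : n.-tuple A * n.-tuple B => ln (h z.2)) by exact: (bmf_comp lnh).
  rewrite EFin_Ex ?EW; [|exact: bmfB|exact: bmfB].
  rewrite lee_fin; under eq_Rintegral do rewrite mulrBr.
  rewrite ExB; [|exact: bmfM|exact: bmfM].
  rewrite (EPQ_snd (fun y => ln (h y)))// lerBlDr lerDl.
  (* What remains is [0 <= Ex Q (fun y => h y * ln (h y))], the nonnegativity of the relative
     entropy of [Q'] with respect to [Q]. *)
  have <- : Ex Q (fun y => h y - 1) = 0 by rewrite ExB// Ex_cst Eh subrr.
  by apply: le_Ex => [||y]; [exact: bmfB|exact: bmfM|exact: mul_ln_ge].
have int3 : (\int[Q']_y (\sum_(i < n) ln (M (tnth y i)))%:E =
    (channel_mean P Q f (fun z => lsum M z.2))%:E)%E.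
  by rewrite (EFin_Ex Q' bl) EQ'// -EPQ_snd.
apply: (@le_trans _ _ (In rho (Pn P n) Q' D +
    (channel_mean P Q f (fun z => lsum M z.2))%:E)%E).
  by apply: ereal_inf_lbound; exists Q'; rewrite int3.
apply: le_trans (_ : _ <= (channel_mean P Q f (fun z => ln (f z)) +
  channel_mean P Q f (fun z => lsum M z.2))%:E)%E _; last by rewrite lee_fin.
rewrite EFinD leeD2r//; apply: le_trans rel.
by apply: ereal_inf_lbound; exists W.
Qed.

End rate_upper_bound.

(** * Approximation of densities by bounded ones *)

Section truncation.
Context (R : realType) d1 d2 (X : measurableType d1) (Y : measurableType d2).
Variables (Px : probability X R) (Q : probability Y R).
Variables (W : probability (X * Y)%type R) (f : X * Y -> R).
Hypotheses (mf : measurable_fun setT f) (f0 : forall z, 0 <= f z).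
Hypothesis WE : forall S, measurable S ->
  (W S = \int[(Px \x Q)%E]_(z in S) (f z)%:E)%E.
Hypothesis Wfst : forall S, measurable S -> (W (S `*` setT) = Px S)%E.

Local Notation PQ := (Px \x Q)%E.

Let mfe : measurable_fun setT (EFin \o f).
Proof. exact/measurable_EFinP. Qed.

Lemma integral_density1 : (\int[PQ]_z (f z)%:E = 1)%E.
Proof. by rewrite -WE// probability_setT. Qed.

(** Formally this integrates [p <= f * q]. As [f] may be unbounded, constants are added to [p] and
    [q] to stay among nonnegative extended-valued integrals, and cancelled at the end since [f]
    integrates to [1]. *)
Lemma Ex_le_density (p q : X * Y -> R) : bmf p -> bmf q ->
  (forall z, p z <= f z * q z) -> Ex PQ p <= Ex W q.
Proof.
move=> bp bq pq; have [Cp Cp0 pC] := bmf_bound bp; have [C C0 qC] := bmf_bound bq.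
have p0 z : 0 <= p z + Cp by have := pC z; rewrite ler_norml => /andP[]; lra.
have q0 z : 0 <= q z + C by have := qC z; rewrite ler_norml => /andP[]; lra.
have bp' : bmf (fun z => p z + Cp) by exact: bmfD.
have bq' : bmf (fun z => q z + C) by exact: bmfD.
have mp := bmf_measurable bp'; have mq := bmf_measurable bq'.
have intq : (\int[PQ]_z (f z * (q z + C))%:E = (Ex W q + C)%:E)%E.
  transitivity (\int[W]_z (q z + C)%:E)%E; last by rewrite EFin_Ex// ExD// Ex_cst.
  rewrite (ge0_integral_density mf f0 WE).
  - by apply: eq_integral => z _; rewrite -EFinM mulrC.
  - by move=> z; rewrite lee_fin.
  - exact/measurable_EFinP.
have intC : (\int[PQ]_z (C%:E * (f z)%:E) = C%:E)%E.
  rewrite ge0_integralZl_EFin//; last exact: ltW.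
  - by rewrite integral_density1 mule1.
  - by move=> z _; rewrite lee_fin.
have : (\int[PQ]_z ((p z + Cp)%:E + C%:E * (f z)%:E) <=
    \int[PQ]_z ((f z * (q z + C))%:E + Cp%:E))%E.
  have mCf : measurable_fun setT (fun z => C * f z) by exact: measurable_funM.
  have mfq : measurable_fun setT (fun z => f z * (q z + C)) by exact: measurable_funM.
  apply: ge0_le_integral => //.
  - by move=> z _; rewrite -EFinM -EFinD lee_fin addr_ge0// mulr_ge0// ltW.
  - under eq_fun do rewrite -EFinM -EFinD.
    by apply/measurable_EFinP; exact: measurable_funD.
  - under eq_fun do rewrite -EFinD.
    by apply/measurable_EFinP; exact: measurable_funD.
  - by move=> z _; rewrite -EFinM -!EFinD lee_fin; have := pq z; lra.
rewrite ge0_integralD//; first last.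
- by apply/measurable_EFinP; exact: measurable_funM.
- by move=> z _; rewrite -EFinM lee_fin mulr_ge0// ltW.
- exact/measurable_EFinP.
- by move=> z _; rewrite lee_fin.
rewrite intC (EFin_Ex _ bp') ExD// Ex_cst ge0_integralD//; first last.
- by move=> z _; rewrite lee_fin ltW.
- by apply/measurable_EFinP; exact: measurable_funM.
- by move=> z _; rewrite lee_fin mulr_ge0.
rewrite intq (EFin_Ex PQ (bmf_cst _ Cp)) Ex_cst -!EFinD lee_fin; lra.
Qed.

(* Donsker-Varadhan: integrate [f * ln g + f - g <= f * ln f], with all terms
   moved to the side where they are nonnegative. *)
Lemma Ex_ln_le_elog (g : X * Y -> R) : bmf g -> bmf (fun z => ln (g z)) ->
  (forall z, 0 < g z) -> Ex PQ g = 1 ->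
  ((Ex W (fun z => ln (g z)))%:E <= \int[W]_z elog (f z))%E.
Proof.
move=> bg bl g0 Eg; have [C C0 lC] := bmf_bound bl.
(* [ga] and [al] are the negative and positive parts of [f * ln f]. The first is at most [1], so
   only [al] can have an infinite integral. *)
pose ga z := Num.max (- (f z * ln (f z))) 0.
pose al z := Num.max (f z * ln (f z)) 0.
have mfl : measurable_fun setT (fun z => f z * ln (f z)).
  by apply: measurable_funM => //; apply: measurableT_comp => //; exact: measurable_ln.
have mga : measurable_fun setT ga.
  by apply: measurable_maxr => //; exact: measurableT_comp.
have mal : measurable_fun setT al by exact: measurable_maxr.
have flnf z : -1 <= f z * ln (f z).
  have := f0 z; rewrite le_eqVlt => /predU1P[<-|fz]; first by rewrite mul0r; lra.
  by apply: le_trans (mul_ln_ge fz); lra.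
have bga : bmf ga.
  apply: (@bmf_itv _ _ _ _ 0 1) => // z; rewrite le_max lexx orbT ge_max ler01 andbT.
  by rewrite lerNl flnf.
(* Where [f] vanishes, [elog] is [-oo] but has weight [0], in agreement with [0 * ln 0 = 0] in [al]
   and [ga]. *)
have elogE : (\int[W]_z elog (f z) =
    \int[PQ]_z (al z)%:E - \int[PQ]_z (ga z)%:E)%E.
  have me : measurable_fun setT (fun z => elog (f z)).
    rewrite (_ : (fun z => _) = fun z => if f z <= 0 then -oo%E else (ln (f z))%:E)//.
    apply: measurable_fun_ifT => //; first exact: measurable_fun_ler.
    by apply/measurable_EFinP; apply: measurableT_comp => //; exact: measurable_ln.
  rewrite integralE; congr (_ - _)%E.
  - rewrite (ge0_integral_density mf f0 WE);
      [|by move=> z; exact: funepos_ge0|exact: measurable_funepos].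
    apply: eq_integral => z _; rewrite funeposE /al /elog.
    case: (leP (f z) 0) => fz.
      have -> : f z = 0 by apply/eqP; rewrite eq_le fz f0.
      by rewrite mule0 mul0r maxxx.
    by rewrite -EFin_max -EFinM maxr_pMl ?ltW// mul0r mulrC.
  - rewrite (ge0_integral_density mf f0 WE);
      [|by move=> z; exact: funeneg_ge0|exact: measurable_funeneg].
    apply: eq_integral => z _; rewrite funenegE /ga /elog.
    case: (leP (f z) 0) => fz.
      have -> : f z = 0 by apply/eqP; rewrite eq_le fz f0.
      by rewrite mule0 mul0r oppr0 maxxx.
    by rewrite -EFinN -EFin_max -EFinM maxr_pMl ?ltW// mul0r -mulrN mulrC.
(* This is [t - 1 <= t * ln t] at [t = f z / g z], multiplied by [g z], with [C * f z] added on both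
   sides. *)
have key z : ga z + (f z * (ln (g z) + C) + f z) <= al z + (g z + C * f z).
  have -> : ga z = al z - f z * ln (f z).
    rewrite /ga /al; move: (f z * ln (f z)) => t; rewrite /Num.max.
    by case: ltP => ?; case: ltP => ?; lra.
  suff : f z * ln (g z) + f z - g z <= f z * ln (f z) by lra.
  have := f0 z; rewrite le_eqVlt => /predU1P[<-|fz].
    by rewrite !mul0r add0r sub0r oppr_le0 ltW.
  have fg : 0 < f z / g z by rewrite divr_gt0.
  have := mul_ln_ge fg; rewrite ln_div ?posrE// => h.
  have : g z * (f z / g z - 1) <= g z * (f z / g z * (ln (f z) - ln (g z))).
    by rewrite ler_pM2l.
  have -> : g z * (f z / g z * (ln (f z) - ln (g z))) = f z * ln (f z) - f z * ln (g z).
    by field; rewrite gt_eqF.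
  have -> : g z * (f z / g z - 1) = f z - g z by field; rewrite gt_eqF.
  by lra.
have lC0 z : 0 <= ln (g z) + C by have := lC z; rewrite ler_norml => /andP[]; lra.
have bC : bmf (fun z => ln (g z) + C) by exact: bmfD.
have ga0 z : 0 <= ga z by rewrite le_max lexx orbT.
have al0 z : 0 <= al z by rewrite le_max lexx orbT.
have mlC : measurable_fun setT (fun z => ln (g z) + C) := bmf_measurable bC.
have mg := bmf_measurable bg.
have : (\int[PQ]_z (ga z)%:E + ((Ex W (fun z => ln (g z) + C))%:E + 1) <=
    \int[PQ]_z (al z)%:E + (1 + C%:E))%E.
  have -> : ((Ex W (fun z => ln (g z) + C))%:E = \int[PQ]_z (f z * (ln (g z) + C))%:E)%E.
    rewrite -EFin_Ex// (ge0_integral_density mf f0 WE).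
    - by apply: eq_integral => z _; rewrite -EFinM mulrC.
    - by move=> z; rewrite lee_fin.
    - exact/measurable_EFinP.
  have -> : (1 + C%:E = \int[PQ]_z (g z)%:E + \int[PQ]_z (C * f z)%:E)%E.
    rewrite EFin_Ex// Eg; congr (_ + _)%E.
    under eq_integral do rewrite EFinM.
    have -> : (\int[PQ]_z (C%:E * (f z)%:E) = C%:E * \int[PQ]_z (f z)%:E)%E.
      by apply: ge0_integralZl_EFin => //; [move=> z _; rewrite lee_fin|exact: ltW].
    by rewrite integral_density1 mule1.
  have mF : measurable_fun setT (fun z => f z * (ln (g z) + C)) by exact: measurable_funM.
  have mCf : measurable_fun setT (fun z => C * f z) by exact: measurable_funM.
  have F0 z : 0 <= f z * (ln (g z) + C) by exact: mulr_ge0.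
  have Cf0 z : 0 <= C * f z by rewrite mulr_ge0// ltW.
  have gge0 z : 0 <= g z by exact: ltW.
  rewrite -integral_density1 -!ge0_integralD_EFin//; first last.
  - by move=> z; exact: addr_ge0.
  - exact: measurable_funD.
  - by move=> z; exact: addr_ge0.
  - exact: measurable_funD.
  apply: ge0_le_integral => //.
  - by move=> z _; rewrite lee_fin !addr_ge0.
  - by apply/measurable_EFinP; do 2 apply: measurable_funD => //.
  - by apply/measurable_EFinP; do 2 apply: measurable_funD => //.
  - by move=> z _; rewrite lee_fin.
rewrite ExD// Ex_cst elogE (EFin_Ex _ bga).
have : (0 <= \int[PQ]_z (al z)%:E)%E by apply: integral_ge0 => z _; rewrite lee_fin.
case: (\int[PQ]_z (al z)%:E)%E => [r| |] //= _.
  by rewrite -!EFinD !lee_fin; lra.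
by move=> _; rewrite addye ?leey.
Qed.

Lemma Ex_min_cvg (e : R) : 0 < e ->
  \forall n \near \oo, 1 - e <= Ex PQ (fun z => Num.min (f z) n%:R).
Proof.
move=> e0; pose h n z := (Num.min (f z) n%:R)%:E.
have bh n : bmf (fun z => Num.min (f z) n%:R : R).
  apply: (@bmf_itv _ _ _ _ 0 n%:R); first exact: measurable_minr.
  by move=> z; rewrite ge_min lexx orbT le_min f0 ler0n.
have : (\int[PQ]_z h n z)%E @[n --> \oo] --> (\int[PQ]_z (f z)%:E)%E.
  have -> : (\int[PQ]_z (f z)%:E = \int[PQ]_z (limn (h ^~ z)))%E.
    apply: eq_integral => z _; apply/esym/cvg_lim => //.
    apply: cvg_EFin; first exact: nearW.
    apply: cvg_near_cst; exists (Num.truncn (f z)).+1 => // n /= fn.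
    by apply/eqP; rewrite /h/= (min_idPl _)// (le_trans (ltW (truncnS_gt _)))// ler_nat.
  apply: cvg_monotone_convergence => //.
  - by move=> n; apply/measurable_EFinP; exact: bmf_measurable (bh n).
  - by move=> n z _; rewrite lee_fin le_min f0 ler0n.
  - move=> z _ m n mn; rewrite lee_fin le_min ge_min lexx/=.
    by rewrite ge_min ler_nat mn orbT.
rewrite integral_density1 => /fine_cvgP[_ /cvgrPdist_le/(_ _ e0)].
apply: filterS => n /=; rewrite ler_norml => /andP[_].
by rewrite /comp /Rintegral /h; lra.
Qed.

Section truncate_at.
Variables (k : nat) (e : R).
Hypotheses (k2 : (2 <= k)%N) (ke : k%:R^-1 <= e / 4)
  (min_ge : 1 - e / 4 <= Ex PQ (fun z => Num.min (f z) k%:R)).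

(** The truncation [u0] has conditional mass [s x], and the missing mass [b x] is spread evenly with
    respect to [Q]. Scaling by [1 - eta] leaves at least [eta] to spread, which bounds the density
    from below. Outside [G] the density is replaced by [1], so that it integrates to [1] for every
    [x] and not merely almost every [x]. *)
Let eta : R := (k%:R ^+ 2)^-1.
Let u0 z := (1 - eta) * Num.min (f z) k%:R.
Let s x := Ex Q (fun y => u0 (x, y)).
Let G := [set x | s x <= 1 - eta].
Let u z := u0 z * \1_G z.1.
Let b x := 1 - s x * \1_G x.

Definition truncated_density z := u z + b z.1.

Let k_ge2 : 2 <= k%:R :> R. Proof. by rewrite (ler_nat R 2 k). Qed.

Let eta0 : 0 < eta. Proof. by rewrite invr_gt0 exprn_gt0//; have := k_ge2; lra. Qed.

Let eta_k : eta <= k%:R^-1.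
Proof.
rewrite /eta lef_pV2 ?posrE ?exprn_gt0 ?expr2; have := k_ge2; rewrite ?mulr_gt0; try lra.
by move=> ?; rewrite -[leLHS]mul1r ler_wpM2r//; lra.
Qed.

Let eta_half : eta <= 1 / 2.
Proof.
apply: (le_trans eta_k); rewrite div1r lef_pV2 ?posrE//; have := k_ge2; lra.
Qed.

Let bmin : bmf (fun z => Num.min (f z) k%:R : R).
Proof.
apply: (@bmf_itv _ _ _ _ 0 k%:R); first exact: measurable_minr.
by move=> z; rewrite ge_min lexx orbT le_min f0 ler0n.
Qed.

Let min0 z : 0 <= Num.min (f z) k%:R. Proof. by rewrite le_min f0 ler0n. Qed.

Let bu0 : bmf u0. Proof. exact: bmfZ. Qed.

Let u0_ge0 z : 0 <= u0 z.
Proof. by rewrite mulr_ge0// subr_ge0; have := eta_half; lra. Qed.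

Let u0_le z : u0 z <= (1 - eta) * f z.
Proof.
rewrite ler_wpM2l//; first by rewrite subr_ge0; have := eta_half; lra.
by rewrite ge_min lexx.
Qed.

Let bs : bmf s. Proof. exact: bmf_Ex_snd. Qed.

Let s_ge0 x : 0 <= s x. Proof. exact: Ex_ge0. Qed.

Let mG : measurable G.
Proof. by apply: measurable_leset => //; exact: bmf_measurable. Qed.

Let b1G : bmf (\1_G : X -> R). Proof. exact: bmf_indic. Qed.

Let bu : bmf u. Proof. by apply: bmfM => //; exact: (bmf_comp b1G). Qed.

Let bb : bmf b. Proof. by apply: bmfB => //; exact: bmfM. Qed.

Let sG x : s x * \1_G x <= 1 - eta.
Proof.
rewrite indicE; have [/set_mem Gx|_] := boolP (x \in G); first by rewrite mulr1.
by rewrite mulr0 subr_ge0; have := eta_half; lra.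
Qed.

Let b_ge x : eta <= b x. Proof. by have := sG x; rewrite /b; lra. Qed.

Let u_ge0 z : 0 <= u z. Proof. by rewrite mulr_ge0// indicE. Qed.

(** Since [u0 <= (1 - eta) * f] and the first marginal of [W] is [Px], the mean of [s] over the
    complement of [G] is at most [1 - eta] times its probability; but [s] exceeds [1 - eta]
    everywhere there. *)
Let bad_null : Px (~` G) = 0%E.
Proof.
have mB : measurable (~` G) by exact: measurableC.
have bB := bmf_indic R mB.
have mBT : measurable (~` G `*` [set: Y]) by exact: measurableX.
have sB : Ex Px (fun x => s x * \1_(~` G) x) <= (1 - eta) * Ex Px \1_(~` G).
  have -> : Ex Px (fun x => s x * \1_(~` G) x) = Ex PQ (fun z => u0 z * \1_(~` G) z.1).
    rewrite Ex_prod1; last by apply: bmfM => //; exact: (bmf_comp bB).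
    by apply: eq_Rintegral => x _; rewrite /= ExZr//; exact: bmf_curry.
  have -> : Ex Px \1_(~` G) = Ex W (fun z => \1_(~` G) z.1).
    apply: EFin_inj; rewrite Ex_indic// -Wfst// -Ex_indic//; congr EFin.
    by apply: eq_Rintegral => z _; rewrite !indicE in_setX in_setT andbT.
  have bB1 : bmf (fun z : X * Y => \1_(~` G) z.1 : R) by exact: (bmf_comp bB).
  rewrite -ExZ//; apply: Ex_le_density; [exact: bmfM|exact: bmfZ|].
  move=> z; rewrite mulrA ler_wpM2r ?indicE//.
  by rewrite mulrC; exact: u0_le.
have : {ae Px, forall x, (s x - (1 - eta)) * \1_(~` G) x = 0}.
  apply: Ex_eq0_ae.
  - by apply: bmfM => //; exact: bmfB.
  - move=> x; rewrite indicE; have [/set_mem Gx|_] := boolP (x \in ~` G); last by rewrite mulr0.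
    by rewrite mulr1 subr_ge0 ltW// ltNge; apply/negP.
  - under eq_Rintegral do rewrite mulrBl.
    by rewrite ExB ?ExZ ?subr_le0//; [exact: bmfM|exact: bmfZ].
move=> [N [mN N0 subN]]; apply: subset_measure0 N0 => // x Gx; apply: subN => /=.
rewrite indicE mem_set// mulr1 => /eqP; rewrite subr_eq0 => /eqP sx.
by apply: Gx; rewrite /G/= sx.
Qed.

Let beta := Ex Px b.

Let betaE : beta = 1 - Ex PQ u0.
Proof.
rewrite /beta ExB ?Ex_cst//; last exact: bmfM.
congr (_ - _); rewrite Ex_prod1// -/s.
have := ExM_indic_null bs (measurableC mG) bad_null.
have -> : (fun x => s x * \1_(~` G) x) = (fun x => s x - s x * \1_G x).
  by apply/funext => x; rewrite !indicE in_setC; case: (x \in G) => /=; lra.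
by rewrite ExB//; [lra|exact: bmfM].
Qed.

Let beta_le : beta <= e / 2.
Proof.
rewrite betaE ExZ//; have := min_ge; set m := Ex _ _ => me.
have m1 : m <= 1.
  rewrite -lee_fin -EFin_Ex// -integral_density1; apply: ge0_le_integral => //.
  - by move=> z _; rewrite lee_fin.
  - by apply/measurable_EFinP; exact: bmf_measurable bmin.
  - by move=> z _; rewrite lee_fin ge_min lexx.
have : eta * m <= eta * 1 by rewrite ler_wpM2l// ltW.
by have := eta_k; have := ke; lra.
Qed.

Let bfst : bmf (fun z : X * Y => b z.1). Proof. exact: (bmf_comp bb). Qed.

Lemma truncated_bmf : bmf truncated_density.
Proof. exact: bmfD. Qed.

Lemma truncated_ge z : eta <= truncated_density z.
Proof. by have := b_ge z.1; have := u_ge0 z; rewrite /truncated_density; lra. Qed.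

Lemma truncated_itv : exists a c, 0 < a /\ forall z, a <= truncated_density z <= c.
Proof.
have [K K0 bK] := bmf_bound truncated_bmf; exists eta, K; split => // z.
by rewrite truncated_ge (le_trans (ler_norm _)).
Qed.

Lemma Ex_truncated x : Ex Q (fun y => truncated_density (x, y)) = 1.
Proof.
rewrite (ExD Q (bmf_curry bu x) (bmf_cst _ (b x))) Ex_cst.
have -> : Ex Q (fun y => u (x, y)) = s x * \1_G x.
  exact: (ExZr Q (\1_G x) (bmf_curry bu0 x)).
by rewrite /b; lra.
Qed.

(** The part [u] is dominated by [f], and the spread mass, of mean at most [e / 2], pays at most
    [C]. *)
Lemma Ex_truncatedM_le (Z : X * Y -> R) C : bmf Z -> (forall z, 0 <= Z z <= C) ->
  Ex PQ (fun z => truncated_density z * Z z) <= Ex W Z + C * e.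
Proof.
move=> bZ ZC; under eq_Rintegral do rewrite mulrDl.
have C0 : 0 <= C by have /andP[] := ZC point; exact: le_trans.
have Z0 z : 0 <= Z z by have /andP[] := ZC z.
rewrite ExD; [|exact: bmfM|exact: bmfM]; apply: lerD.
  apply: Ex_le_density => //; first exact: bmfM.
  move=> z; rewrite ler_wpM2r// /u indicE.
  have := u0_le z; have : 0 <= eta * f z by rewrite mulr_ge0// ltW.
  by have := f0 z; case: (_ \in _); rewrite /=; lra.
apply: (@le_trans _ _ (Ex PQ (fun z => C * b z.1))).
  apply: le_Ex; [exact: bmfM|exact: bmfZ|move=> z].
  by rewrite mulrC ler_wpM2r ?(le_trans (ltW eta0))//; have /andP[] := ZC z.
rewrite ExZ// ler_wpM2l// Ex_prod1//; under eq_Rintegral do rewrite /= Ex_cst.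
by have := beta_le; rewrite -/beta; have := ke; have := eta_k; have := eta0; lra.
Qed.

Let ln_eta : - ln eta <= 2 * k%:R.
Proof.
have k_gt0 : 0 < k%:R :> R by have := k_ge2; lra.
rewrite /eta lnV ?posrE ?exprn_gt0// opprK lnXn// -[leLHS]mulr_natl ler_pM2l//.
by have := expR_ge1Dx (ln k%:R : R); rewrite lnK ?posrE//; lra.
Qed.

(** The pointwise bound [u * ln g <= f * (ln g + eta * - ln eta)] has three cases. Outside [G] one
    has [ln g = 0]. Where [f <= k], the lost part [eta * f] is paid at the lowest value [ln eta].
    Where [f > k], the choice [k >= 2] gives [u0 >= 1], so [ln g >= 0] and [u0 <= f] suffices. The
    mean of [ln g] under [W] is then bounded by [Ex_ln_le_elog]. *)
Lemma Ex_truncated_ln_le :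
  ((Ex PQ (fun z => truncated_density z * ln (truncated_density z)))%:E <=
  \int[W]_z elog (f z) + e%:E)%E.
Proof.
set g := truncated_density; have bg : bmf g := truncated_bmf.
have [a [c [a0 gac]]] := truncated_itv.
have g0 z : 0 < g z := lt_le_trans eta0 (truncated_ge z).
have bl : bmf (fun z => ln (g z)) := bmf_ln bg a0 gac.
have Eg : Ex PQ g = 1.
  by rewrite Ex_prod1//; under eq_Rintegral do rewrite Ex_truncated; rewrite Ex_cst.
have eta_ln : 0 <= eta * - ln eta.
  rewrite mulr_ge0 ?(ltW eta0)// oppr_ge0 ln_le0//; have := eta_half; lra.
have h1 : Ex PQ (fun z => u z * ln (g z)) <= Ex W (fun z => ln (g z) + eta * - ln eta).
  apply: Ex_le_density; [exact: bmfM|exact: bmfD|move=> z].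
  rewrite mulrDr /u indicE; have [/set_mem Gz|nGz] := boolP (z.1 \in G); last first.
    have -> : g z = 1.
      by rewrite /g /truncated_density /u /b indicE (negbTE nGz) !mulr0 add0r subr0.
    by rewrite ln1 !mulr0 add0r mulr_ge0.
  rewrite mulr1; have [fk|fk] := leP (f z) k%:R.
    have -> : u0 z = (1 - eta) * f z by rewrite /u0 (min_idPl _).
    have : eta * f z * ln eta <= eta * f z * ln (g z).
      by rewrite ler_wpM2l ?mulr_ge0 ?(ltW eta0)// ler_ln ?posrE// truncated_ge.
    by lra.
  have u1 : 1 <= u0 z.
    rewrite /u0 (min_idPr _) ?(ltW fk)//.
    have : 1 / 2 * 2 <= (1 - eta) * k%:R by apply: ler_pM => //; have := eta_half; lra.
    lra.
  have g1 : 0 <= ln (g z).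
    rewrite ln_ge0// (le_trans u1)// /g /truncated_density /u indicE mem_set// mulr1.
    by rewrite lerDl (le_trans (ltW eta0))// b_ge.
  have uf : u0 z <= f z.
    have := u0_le z; have : 0 <= eta * f z by rewrite mulr_ge0// ltW.
    lra.
  have := ler_wpM2r g1 uf; have : 0 <= f z * (eta * - ln eta) by rewrite mulr_ge0.
  by lra.
(* Here [ln g <= g], and [g] has conditional mean [1]. *)
have h2 : Ex PQ (fun z => b z.1 * ln (g z)) <= beta.
  have -> : beta = Ex PQ (fun z => b z.1 * g z).
    rewrite Ex_prod1; last exact: bmfM.
    apply: eq_Rintegral => x _.
    by rewrite (ExZ Q (b x) (bmf_curry bg x)) Ex_truncated mulr1.
  apply: le_Ex; [exact: bmfM|exact: bmfM|move=> z].
  rewrite ler_wpM2l ?(le_trans (ltW eta0))//.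
  by have := expR_ge1Dx (ln (g z)); rewrite lnK ?posrE//; lra.
have h3 : Ex PQ (fun z => g z * ln (g z)) <= Ex W (fun z => ln (g z)) + e.
  rewrite (_ : (fun z => _) = fun z => u z * ln (g z) + b z.1 * ln (g z)); last first.
    by apply/funext => z; rewrite /g /truncated_density mulrDl.
  rewrite ExD; [|exact: bmfM|exact: bmfM].
  rewrite ExD// Ex_cst in h1.
  (* The reason for taking [eta] as [k ^- 2]: the factor [- ln eta <= 2 * k] is beaten by one power
     of [k]. *)
  have : eta * - ln eta <= 2 * k%:R^-1.
    apply: (@le_trans _ _ (eta * (2 * k%:R))); first by rewrite ler_wpM2l// ltW.
    have k0 : k%:R != 0 :> R by rewrite gt_eqF//; have := k_ge2; lra.
    by rewrite /eta le_eqVlt; apply/orP; left; apply/eqP; field.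
  by move: h1 h2 beta_le ke; lra.
apply: (@le_trans _ _ (Ex W (fun z => ln (g z)) + e)%:E); first by rewrite lee_fin.
by rewrite EFinD leeD2r//; exact: Ex_ln_le_elog.
Qed.

End truncate_at.

Theorem bounded_density_approx (e : R) : 0 < e -> exists g : X * Y -> R,
  [/\ bmf g, exists a c, 0 < a /\ forall z, a <= g z <= c,
    forall x, Ex Q (fun y => g (x, y)) = 1,
    forall Z C, bmf Z -> (forall z, 0 <= Z z <= C) ->
      Ex PQ (fun z => g z * Z z) <= Ex W Z + C * e &
    ((Ex PQ (fun z => g z * ln (g z)))%:E <= \int[W]_z elog (f z) + e%:E)%E].
Proof.
move=> e0; have e4 : 0 < e / 4 by lra.
have [N _ HN] := Ex_min_cvg e4.
pose k := maxn (maxn 2 N) (Num.truncn (e / 4)^-1).+1.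
have k2 : (2 <= k)%N by rewrite /k !leq_max leqnn.
have Nk : (N <= k)%N by rewrite /k !leq_max leqnn orbT.
have ke : k%:R^-1 <= e / 4.
  rewrite invf_ple ?posrE ?ltr0n ?(leq_trans _ k2)//.
  by rewrite (le_trans (ltW (truncnS_gt _)))// ler_nat leq_maxr.
exists (truncated_density k); split.
- exact: truncated_bmf.
- exact: truncated_itv k2.
- exact: Ex_truncated.
- by move=> Z C; exact: (Ex_truncatedM_le k2 ke (HN k Nk)).
- exact: (Ex_truncated_ln_le k2 ke (HN k Nk)).
Qed.

End truncation.

(** * The rate-distortion limit *)

Section rate_limit.
Context (R : realType) dA dB (A : measurableType dA) (B : measurableType dB).
Variables (rho : A * B -> R) (M : B -> R) (P : probability (seqspace A) R).
Hypotheses (mrho : measurable_fun setT rho) (rho0 : forall p, 0 <= rho p).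
Hypotheses (mM : measurable_fun setT M).
Variables (rmax L : R).
Hypotheses (rho_le : forall p, rho p <= rmax) (lnM_le : forall y, `|ln (M y)| <= L).
Hypotheses (presP : measure_preserving P (@Defs.shift _ A)).

Local Notation rate n D := (Rn rho M (Pn P n) D).
Local Notation achv := (achievable rho M P).

Lemma achievable_of_Rn_lt n D v e : (0 < n)%N -> (rate n D < v%:E)%E -> 0 < e ->
  achv n (n%:R * D + e) (v + e).
Proof.
move=> n0 /ereal_inf_lt[_ [Q ->]] lt_v e0.
have bl := bmf_lsum mM lnM_le n.
have b2 : bmf (fun z : n.-tuple A * n.-tuple B => rsum rho z.1 z.2).
  exact: (bmf_rsum mrho rho0 rho_le).
have b3 : bmf (fun z : n.-tuple A * n.-tuple B => lsum M z.2) by exact: (bmf_comp bl).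
move: lt_v; rewrite (EFin_Ex Q bl) -lteBrDr// -EFinB => /ereal_inf_lt[_ [W [W1 [W2 WD]] <-]].
move=> /ereal_inf_lt[_ [f [mf [f0 WE]] <-]] lt_v.
pose Px := law P (measurable_window 0 n).
have [c2 c20 b2c] := bmf_bound b2; have [c3 c30 b3c] := bmf_bound b3.
pose C := c2 + c3.
have C0 : 0 < C by rewrite addr_gt0.
(* The approximation compares means of functions with values in an interval from [0], so [lsum] is
   shifted by [C] into [[0, 2 * C]]. The rate thus loses [2 * C * e'] for the mass and [e'] for the
   information, altogether [e]. *)
have e'0 : 0 < e / (1 + 2 * C) by rewrite divr_gt0// addr_gt0// mulr_gt0.
have [g [bg gac g1 gZ gl]] := @bounded_density_approx _ _ _ _ _ Px Q W f mf f0 WE W1 _ e'0.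
set e' := e / (1 + 2 * C) in e'0 gZ gl.
have eE : e' * (1 + 2 * C) = e by rewrite /e' divfK// gt_eqF// addr_gt0// mulr_gt0.
have EW2 : Ex W (fun z => rsum rho z.1 z.2) <= n%:R * D.
  have br : bmf (fun z : n.-tuple A * n.-tuple B => rhon rho z.1 z.2) by exact: bmfZ.
  move: WD; rewrite EFin_Ex// lee_fin.
  by rewrite /rhon ExZ// ler_pdivrMl// ltr0n.
have EW3 : Ex W (fun z => lsum M z.2) = Ex Q (@lsum _ _ _ M n).
  have msnd : measurable_fun setT (@snd (n.-tuple A) (n.-tuple B)) by exact: measurable_snd.
  rewrite -(Ex_law W msnd bl) /Rintegral; congr fine.
  have sndE S : snd @^-1` S = [set: n.-tuple A] `*` S.
    by apply/seteqP; split => z //= [].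
  apply: eq_measure_integral => S mS _; apply/esym.
  by rewrite -[LHS]W2// -sndE.
exists Q, g; split.
- by split => //; exact: bmf_measurable.
- apply: (le_trans (gZ _ C b2 _)) => [z|].
    rewrite rsum_ge0//=; apply: (le_trans (ler_norm _)); apply: (le_trans (b2c z)).
    by rewrite /C lerDl ltW.
  apply: lerD => //; rewrite -eE mulrC ler_wpM2l ?(ltW e'0)//; lra.
- have b3C : bmf (fun z : n.-tuple A * n.-tuple B => lsum M z.2 + C) by exact: bmfD.
  have C3 : c3 <= C by rewrite /C lerDr ltW.
  have h3 := gZ _ (2 * C) b3C.
  have {}h3 : Ex (Px \x Q)%E (fun z => g z * lsum M z.2) <= Ex Q (@lsum _ _ _ M n) + 2 * C * e'.
    have : Ex (Px \x Q)%E (fun z => g z * (lsum M z.2 + C)) <=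
        Ex W (fun z => lsum M z.2 + C) + 2 * C * e'.
      apply: h3 => z; have := b3c z; rewrite ler_norml => /andP[].
      move=> h4 h5; apply/andP; split; move: h4 h5 C3; lra.
    have -> : (fun z => g z * (lsum M z.2 + C)) = (fun z => g z * lsum M z.2 + g z * C).
      by apply/funext => z; rewrite mulrDr.
    rewrite ExD; [|exact: bmfM|exact: bmfM].
    have Eg : Ex (Px \x Q)%E g = 1.
      by rewrite Ex_prod1//; under eq_Rintegral do rewrite g1; rewrite Ex_cst.
    by rewrite ExZr// Eg ExD// !Ex_cst EW3; lra.
  have : ((Ex (Px \x Q)%E (fun z => g z * ln (g z)))%:E < (v - Ex Q (@lsum _ _ _ M n) + e')%:E)%E.
    by apply: (le_lt_trans gl); rewrite EFinD lteD2rE.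
  rewrite lte_fin /channel_mean -/Px; move: eE h3.
  set X1 := Ex _ _; set X2 := Ex _ _; set X3 := Ex _ _; lra.
Qed.

Lemma achievable_rate_ge n d v : achv n d v -> - (n%:R * L) <= v.
Proof.
move=> [Q [f [[mf [a [b [a0 fab]]] f1] _]]]; apply: le_trans.
have I0 := channel_mean_ln_ge0 P mf a0 fab f1.
have bf : bmf f by exact: bmf_itv mf fab.
have b3 : bmf (fun z : n.-tuple A * n.-tuple B => lsum M z.2).
  by apply: (bmf_comp (bmf_lsum mM lnM_le n)).
rewrite -[leLHS]add0r; apply: lerD => //.
have <- : Ex (law P (measurable_window 0 n) \x Q)%E (fun z => f z * - (n%:R * L)) = - (n%:R * L).
  rewrite ExZr// Ex_prod1//; under eq_Rintegral do rewrite f1.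
  by rewrite Ex_cst mul1r.
apply: le_Ex; [exact: bmfM|exact: bmfM|move=> z].
rewrite ler_wpM2l//; first by have /andP[/(le_trans (ltW a0))] := fab z.
rewrite -mulrN -[X in X%:R * _]card_ord mulr_natl -sumr_const; apply: ler_sum => i _.
by have := lnM_le (tnth z.2 i); rewrite ler_norml => /andP[].
Qed.

(** A crude bound that keeps the infimum of the rates per letter away from [-oo]; the [2] leaves
    room for the error [1] with which a channel is extracted. *)
Lemma Rn_ge n D : (0 < n)%N -> ((- (n%:R * L) - 2)%:E <= rate n D)%E.
Proof.
move=> n0; rewrite leNgt; apply/negP => lt.
have := achievable_rate_ge (achievable_of_Rn_lt n0 lt ltr01); lra.
Qed.

(* Inserting one block of the better code of distortion [D0] among many blocks of a
   nearly optimal code lowers the distortion strictly below [D]. *)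
Lemma achievable_below k k0 D D0 v eps : (0 < k)%N -> (0 < k0)%N -> D0 < D ->
  (rate k D < (k%:R * v)%:E)%E -> (rate k0 D0 < +oo)%E -> 0 < eps ->
  exists K D'', [/\ (0 < K)%N, D'' < D & achv K (K%:R * D'') (K%:R * (v + eps))].
Proof.
move=> k_gt0 k0_gt0 D0D rk rk0 eps0.
have [v0 rv0] : exists v0, (rate k0 D0 < v0%:E)%E.
  case: (rate k0 D0) rk0 => [r| |] // _; last by exists 0; rewrite ltNye.
  by exists (r + 1); rewrite lte_fin ltrDl.
(* The number [r] of good blocks is so large that the rate of the one inserted block costs little
   per letter. *)
pose c := (`|v0| + eps + k0%:R * `|v|) / (eps / 2).
pose r := (Num.truncn c).+1.
have eps2 : 0 < eps / 2 by lra.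
have rc : `|v0| + eps + k0%:R * `|v| <= r%:R * (eps / 2).
  by rewrite -ler_pdivrMr// ltW// truncnS_gt.
have k1 : 1 <= k%:R :> R by rewrite ler1n.
have k0r : 0 < k0%:R :> R by rewrite ltr0n.
have r0 : 0 <= r%:R :> R by [].
(* The [r + 1] channels each lose [e1 <= x] in distortion, altogether at most half of the amount
   [k0 * (D - D0)] gained by the insertion. *)
pose x := k0%:R * (D - D0) / (2 * (r%:R + 1)).
have x0 : 0 < x by rewrite divr_gt0// ?mulr_gt0 ?subr_gt0// ltr_wpDl.
have [e1 [e10 e1eps e1x]] : exists e1, [/\ 0 < e1, e1 <= eps / 2 & e1 <= x].
  by exists (Num.min (eps / 2) x); rewrite lt_min eps2 x0 !ge_min !lexx orbT.
have h1 := achievableMn mrho rho0 mM rho_le lnM_le presP r (achievable_of_Rn_lt k_gt0 rk e10).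
have h2 := achievable_of_Rn_lt k0_gt0 rv0 e10.
have h := achievableD mrho rho0 mM rho_le lnM_le presP h1 h2.
set K := (r * k + k0)%N in h; set T := r%:R * _ + _ in h.
have K0 : (0 < K)%N by rewrite addn_gt0 k0_gt0 orbT.
have KE : K%:R = r%:R * k%:R + k0%:R :> R by rewrite natrD natrM.
have Kr : 0 < K%:R :> R by rewrite ltr0n.
exists K, (T / K%:R); split => //.
- rewrite ltr_pdivrMr// KE /T.
  have : (r%:R + 1) * e1 <= (r%:R + 1) * x by rewrite ler_wpM2l// addr_ge0.
  have -> : (r%:R + 1) * x = k0%:R * (D - D0) / 2.
    by rewrite /x; field; rewrite gt_eqF// ltr_wpDl.
  have : 0 < k0%:R * (D - D0) by rewrite mulr_gt0// subr_gt0.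
  by lra.
- have -> : K%:R * (T / K%:R) = T by rewrite mulrC divfK// gt_eqF.
  apply: achievable_le h => //; rewrite KE.
  have h3 : r%:R * e1 <= r%:R * k%:R * (eps / 2).
    rewrite (@le_trans _ _ (r%:R * (eps / 2)))// ?ler_wpM2l// ler_wpM2r ?ler_peMr//.
    exact: ltW.
  have h4 : r%:R * (eps / 2) <= r%:R * k%:R * (eps / 2).
    by rewrite ler_wpM2r ?ler_peMr// ltW.
  have h5 := ler_norm v0.
  have h6 : - (k0%:R * v) <= k0%:R * `|v|.
    by rewrite -mulrN ler_wpM2l ?(ltW k0r)// -normrN ler_norm.
  have h7 : 0 < k0%:R * eps by rewrite mulr_gt0.
  by move: rc; lra.
Qed.

(** A length [n] is cut into [n %/ K] copies of the channel and a remainder coded by a fixed word.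
    The remainder costs at most [K * rmax] in distortion, paid by the slack [D - D''] of the copies,
    and a bounded amount of rate, paid by [n * eps]. *)
Lemma Rn_eventually_le K D D'' w eps : (0 < K)%N -> 0 <= D -> D'' < D -> 0 < eps ->
  achv K (K%:R * D'') (K%:R * w) ->
  \forall n \near \oo, (rate n D <= (n%:R * (w + eps))%:E)%E.
Proof.
move=> K0 D0 DD eps0 h.
have Kr : 0 < K%:R :> R by rewrite ltr0n.
have L0 : 0 <= L := le_trans (normr_ge0 _) (lnM_le point).
have rmax0 : 0 <= rmax := le_trans (rho0 (point, point)) (rho_le _).
pose q0 := (Num.truncn (rmax / (D - D''))).+1.
pose N := (Num.truncn (K%:R * (`|w| + L) / eps)).+1.
exists (K * q0 + N)%N => // n /= Nn.
have n0 : (0 < n)%N by apply: leq_trans Nn; rewrite addn_gt0 orbT.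
have nN : K%:R * (`|w| + L) <= n%:R * eps.
  rewrite -ler_pdivrMr// (le_trans (ltW (truncnS_gt _)))// ler_nat.
  by rewrite (leq_trans _ Nn)// leq_addl.
have qq : (q0 <= n %/ K)%N.
  by rewrite leq_divRL// mulnC (leq_trans _ Nn)// leq_addr.
have DD0 : 0 < D - D'' by rewrite subr_gt0.
have q_ge : rmax <= (n %/ K)%:R * (D - D'').
  rewrite -ler_pdivrMr// (le_trans (ltW (truncnS_gt _)))// ler_nat.
  exact: qq.
have := achievableD mrho rho0 mM rho_le lnM_le presP
  (achievableMn mrho rho0 mM rho_le lnM_le presP (n %/ K) h)
  (achievable_constant P mrho rho0 mM rho_le lnM_le (n %% K)).
rewrite -divn_eq => ach; apply: (Rn_le_achievable mrho rho0 mM rho_le lnM_le) => //.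
have nE : n%:R = (n %/ K)%:R * K%:R + (n %% K)%:R :> R by rewrite -natrM -natrD -divn_eq.
have mK : (n %% K)%:R <= K%:R :> R by rewrite ler_nat ltnW// ltn_mod.
move: ach; set q := (n %/ K)%:R in q_ge nE *; set m := (n %% K)%:R in nE mK *.
have m0 : 0 <= m by exact: ler0n.
apply: achievable_le.
- have h1 : m * rmax <= K%:R * rmax by rewrite ler_wpM2r.
  have h2 : K%:R * rmax <= K%:R * (q * (D - D'')) by rewrite ler_wpM2l// ltW.
  have h3 : 0 <= m * D by rewrite mulr_ge0.
  by rewrite nE; lra.
- have h1 : m * L <= K%:R * L by rewrite ler_wpM2r.
  have h2 : - (m * w) <= K%:R * `|w|.
    rewrite -mulrN (le_trans (ler_wpM2l m0 (ler_norm (- w))))// normrN.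
    by rewrite ler_wpM2r.
  have h3 : n%:R * w = q * K%:R * w + m * w by rewrite nE mulrDl.
  by rewrite mulrDr h3; lra.
Qed.

(** The limit is the infimum [l] of [rate n D / n] over positive [n]. A length whose value is close
    to [l] yields a channel of distortion strictly below [D], whose repetition is nearly as good at
    every large length. The same channel is the second conclusion, the input for coding. *)
Lemma RD_finite D : (Dmin rho M P < D%:E)%E -> exists r : R,
  RD rho M P D = r%:E /\
  forall eps, 0 < eps -> exists K D'', [/\ (0 < K)%N, D'' < D &
    achv K (K%:R * D'') (K%:R * (r + eps))].
Proof.
move=> /ereal_inf_lt[_ [D0 [D00 RD0] <-]]; rewrite lte_fin => D0D.
have D_ge0 : 0 <= D by exact: le_trans (ltW D0D).
(* Were all these rates infinite, the sequence would be constantly [+oo] from length one on, and so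
   would be its limit [RD] at [D0]. *)
have [k0 [k0_gt0 rk0]] : exists k0, (0 < k0)%N /\ (rate k0 D0 < +oo)%E.
  apply: contrapT => /forallNP nk; move: RD0; rewrite /RD.
  rewrite (_ : limn _ = +oo%E)//; apply/cvg_lim => //.
  apply: cvg_near_cst; exists 1%N => // n /= n1; apply/eqP.
  have -> : rate n D0 = +oo%E.
    apply/eqP; rewrite eq_le leey/= leNgt; apply/negP => lt; exact: (nk n).
  by rewrite gt0_muley// lte_fin invr_gt0 ltr0n.
pose a n := ((n%:R^-1)%:E * rate n D)%E.
have a_lt n t : (0 < n)%N -> (a n < t%:E)%E = (rate n D < (n%:R * t)%:E)%E.
  by move=> n0; rewrite /a muleC lte_pdivrMr ?ltr0n// muleC.
have a_le n t : (0 < n)%N -> (rate n D <= (n%:R * t)%:E)%E -> (a n <= t%:E)%E.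
  move=> n0 h; rewrite /a muleC lee_pdivrMr ?ltr0n//.
  by rewrite -EFinM mulrC.
have below k t eps : (0 < k)%N -> (a k < t%:E)%E -> 0 < eps ->
    exists K D'', [/\ (0 < K)%N, D'' < D & achv K (K%:R * D'') (K%:R * (t + eps))].
  move=> k_gt0; rewrite a_lt// => akt eps0.
  exact: achievable_below k_gt0 k0_gt0 D0D akt rk0 eps0.
pose l := ereal_inf [set a n | n in [set n | (0 < n)%N]].
have l_le n : (0 < n)%N -> (l <= a n)%E by move=> n0; apply: ereal_inf_lbound; exists n.
have l_lt t : (l < t)%E -> exists k, (0 < k)%N /\ (a k < t)%E.
  by move=> /ereal_inf_lt[_ [k k_gt0 <-] akt]; exists k.
have l_fin : l \is a fin_num.
  rewrite fin_numE; apply/andP; split.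
    apply/eqP => lNy; have [|k [k_gt0]] := l_lt (- L - 2)%:E; first by rewrite lNy ltNyr.
    rewrite a_lt// ltNge => /negP; apply; apply: le_trans (Rn_ge D k_gt0).
    by rewrite lee_fin; have : 1 <= k%:R :> R; [rewrite ler1n|lra].
  rewrite -ltey; apply: le_lt_trans (l_le _ k0_gt0) _.
  have [v0 rv0] : exists v0, (rate k0 D0 < v0%:E)%E.
    case: (rate k0 D0) rk0 => [r| |] // _; last by exists 0; rewrite ltNye.
    by exists (r + 1); rewrite lte_fin ltrDl.
  have e0 : 0 < k0%:R * (D - D0) by rewrite mulr_gt0 ?ltr0n ?subr_gt0.
  have := achievable_of_Rn_lt k0_gt0 rv0 e0.
  have -> : k0%:R * D0 + k0%:R * (D - D0) = k0%:R * D by ring.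
  move=> /(Rn_le_achievable mrho rho0 mM rho_le lnM_le k0_gt0) h.
  apply: (@le_lt_trans _ _ (k0%:R^-1 * (v0 + k0%:R * (D - D0)))%:E); last exact: ltry.
  apply: a_le => //; rewrite mulrA divff ?mul1r// pnatr_eq0 -lt0n//.
pose r := fine l; have lE : l = r%:E by rewrite /r fineK.
have near_le eps : 0 < eps -> \forall n \near \oo,
    ((r%:E <= a n) /\ (a n <= (r + eps)%:E))%E.
  move=> eps0; have e4 : 0 < eps / 4 by lra.
  have [|k [k_gt0 akt]] := l_lt (r + eps / 4)%:E; first by rewrite lE lte_fin ltrDl.
  have [K [D'' [K0 DD h]]] := below _ _ _ k_gt0 akt e4.
  have [N _ HN] := Rn_eventually_le K0 D_ge0 DD e4 h.
  exists N.+1 => // n /= Nn; have n0 : (0 < n)%N by exact: leq_trans Nn.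
  split; first by rewrite -lE; exact: l_le.
  (* One quarter for the choice of [k], one for the inserted block, one for the remainder of [n]
     modulo [K]. *)
  apply: (@le_trans _ _ (r + eps / 4 + eps / 4 + eps / 4)%:E); last by rewrite lee_fin; lra.
  by apply: a_le => //; exact: HN (ltnW Nn).
exists r; split.
  have fin n eps : (r%:E <= a n)%E -> (a n <= (r + eps)%:E)%E -> a n \is a fin_num.
    by move=> h1 h2; rewrite fin_real// (lt_le_trans (ltNyr r) h1) (le_lt_trans h2) ?ltry.
  rewrite /RD; apply/cvg_lim => //; apply/fine_cvgP; split.
    by apply: filterS (near_le 1 ltr01) => n [h1 h2]; exact: fin h1 h2.
  apply/cvgrPdist_le => e e0; apply: filterS (near_le e e0) => n [h1 h2].
  have := h1; have := h2; rewrite -(fineK (fin _ _ h1 h2)) !lee_fin => h3 h4.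
  rewrite /= -/(a n) ler_norml; move: h3 h4; move: (fine (a n)) => x.
  by move=> h3 h4; apply/andP; split; lra.
move=> eps eps0; have eps2 : 0 < eps / 2 by lra.
have [|k [k_gt0 akt]] := l_lt (r + eps / 2)%:E; first by rewrite lE lte_fin ltrDl.
have [K [D'' [K0 DD h]]] := below _ _ _ k_gt0 akt eps2.
by exists K, D''; split => //; apply: achievable_le h => //; rewrite -addrA -splitr.
Qed.

End rate_limit.

(** * From almost sure coding to the theorem *)

Lemma measurable_rhon_le (R : realType) dA dB (A : measurableType dA)
    (B : measurableType dB) (rho : A * B -> R) (n : nat) (y : n.-tuple B) (D : R) :
  measurable_fun setT rho ->
  measurable [set w : seqspace A | rhon rho (window 0 n w) y <= D].
Proof.
move=> mrho; apply: measurable_leset => //; apply: measurable_funM => //.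
apply: measurable_sum => i; apply: (measurableT_comp mrho).
apply: measurable_fun_pair => //.
by apply: (measurableT_comp (measurable_tnth i)); exact: measurable_window.
Qed.

(** The unions of the tails of the complements decrease to their upper limit, a null set, and the
    [n]-th union contains the complement of [F n]. *)
Lemma measure_cvg1_of_ae_eventually (R : realType) d (T : measurableType d)
    (P : probability T R) (F : nat -> set T) :
  (forall n, measurable (F n)) -> {ae P, forall w, \forall n \near \oo, F n w} ->
  P (F n) @[n --> \oo] --> 1%E.
Proof.
move=> mF aeF; pose G n := \bigcup_(k in [set k | (n <= k)%N]) ~` F k.
have mG n : measurable (G n).
  by apply: bigcup_measurable => k _; exact: measurableC.
have P0 : P (lim_sup_set (fun n => ~` F n)) = 0%E.
  have mL : measurable (lim_sup_set (fun n => ~` F n)).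
    by apply: bigcapT_measurable => n; exact: mG.
  have [N [mN N0 subN]] := aeF; apply: subset_measure0 N0 => // w lw.
  apply: subN => -[n _ Fn]; have [k /= nk] := lw n I.
  by apply; exact: Fn.
have cvgG : P (G n) @[n --> \oo] --> 0%E.
  rewrite -P0; apply: lim_sup_set_cvg.
    by move=> k; exact: measurableC.
  by rewrite -ge0_fin_numE// fin_num_measure//; exact: (mG 0%N).
have cvg1 : (1 - P (G n))%E @[n --> \oo] --> (1 - 0)%E.
  by apply: cvgeB => //; exact: cvg_cst.
rewrite sube0 in cvg1.
apply: (squeeze_cvge _ cvg1 (cvg_cst 1%E)).
apply: nearW => n; rewrite probability_le1// andbT -probability_setC//.
apply: le_measure; rewrite ?inE//; first exact: measurableC.
by move=> w nG; apply: contrapT => nF; apply: nG; exists n => /=.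
Qed.

Theorem theorem4 (R : realType) (A Ah : completePseudoMetricType R)
  (polA : polish A) (polAh : polish Ah)
  (rho : (borel A * borel Ah)%type -> R) (M : borel Ah -> R)
  (P : probability (seqspace (borel A)) R) :
  measurable_fun setT rho -> (forall p, 0 <= rho p) ->
  measurable_fun setT M -> (forall y, 0 < M y) ->
  (exists rho_max : R, 0 <= rho_max /\ forall p, rho p <= rho_max) ->
  (exists L_max : R, forall y, `|ln (M y)| <= L_max) ->
  stationary P -> ergodic P ->
  forall D eps : R, (Dmin rho M P < D%:E)%E -> 0 < eps ->
  (exists C : forall n : nat, set (n.-tuple (borel Ah)),
     (forall n, finite_set (C n)) /\
     (forall n : nat, (0 < n)%N ->
        ((n%:R^-1)%:E * elog (Mn M (C n)) <= RD rho M P D + eps%:E)%E) /\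
     (Pn P n (blowup rho (C n) D) @[n --> \oo] --> 1%E)) /\
  (ergodic_in_blocks P ->
   exists C : forall n : nat, set (n.-tuple (borel Ah)),
     (forall n, finite_set (C n)) /\
     (forall n : nat, (0 < n)%N ->
        ((n%:R^-1)%:E * elog (Mn M (C n)) <= RD rho M P D + eps%:E)%E) /\
     {ae P, forall x, \forall n \near \oo,
        (rhon_set rho (window 0 n x) (C n) <= D%:E)%E}).
Proof.
move=> mrho rho0 mM M0 [rmax [_ rho_le]] [L lnM_le] statP ergP D eps DminD eps0.
have presP := stationary_preserving statP.
have [r [RDE ach]] := RD_finite mrho rho0 mM rho_le lnM_le presP DminD.
have eps2 : 0 < eps / 2 by lra.
(* Half of [eps] goes to the choice of the channel, half to its code. *)
have [k [D'' [k0 DD [Q [f [[mf [a [b [a0 fab]]] f1] fd fv]]]]]] := ach _ eps2.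
have fd' : channel_mean P Q f (fun z => rsum rho z.1 z.2) < k%:R * D.
  by apply: le_lt_trans fd _; rewrite ltr_pM2l// ltr0n.
have [C [finC CM CD]] := coding_theorem mrho rho0 mM M0 rho_le lnM_le presP ergP k0
  mf a0 fab f1 fd' fv eps2.
have rate n : (0 < n)%N ->
    ((n%:R^-1)%:E * elog (Mn M (C n)) <= RD rho M P D + eps%:E)%E.
  move=> n0; rewrite RDE -EFinD; have -> : r + eps = r + eps / 2 + eps / 2 by lra.
  exact: CM.
split; last first.
  move=> _; exists C; split => //; split => //.
  apply: filterS CD => w; apply: filterS => n [y Cy yD].
  by apply: (@le_trans _ _ (rhon rho (window 0 n w) y)%:E);
    [apply: ereal_inf_lbound; exists y|rewrite lee_fin].
exists C; split => //; split => //.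
pose F n := [set w : seqspace (borel A) | exists2 y, C n y & rhon rho (window 0 n w) y <= D].
apply: (@measure_cvg1_of_ae_eventually _ _ _ P F) => // n.
(* Finiteness of the code makes the set of covered source sequences measurable. *)
have -> : F n = \bigcup_(y in C n) [set w | rhon rho (window 0 n w) y <= D].
  by apply/seteqP; split => [w [y Cy yD]|w [y Cy yD]]; exists y.
apply: fin_bigcup_measurable => // y _; exact: measurable_rhon_le.
Qed.
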